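(* Let $\{(X_i,Y_i): i\ge 1\}$ be i.i.d. random vectors distributed as $(X,Y)$, where $X,Y$ are square integrable real random variables satisfying $Y=r(X)+\varepsilon$ with $X$ and $\varepsilon$ independent, and let the support of $X$ be the interval $\mathcal S=[a,b]$, $-\infty\le a<b\le+\infty$. Let $\sigma^2$ be the variance of $\varepsilon$, and let $u_0$ be the threshold and $(\alpha_0,\beta_0)$ the associated linear coefficients defined in the context. Assume: 1. $\mathbb E(X^2)<\infty$, $\mathbb E(\varepsilon^2)<\infty$ and $\mathbb E(\varepsilon)=0$; 2. the distribution function $F_X$ of $X$ is continuous; 3. $u_0\neq a$, that is, for any $\alpha,\beta\in\mathbb R$, $\mathbb P(r(X)=\alpha+\beta X)<1$; 4. for some $0<\eta_1<1$, $\gamma=F_X^{-1}(1-\eta_1)>u_0$, and $\gamma_n$ is the $(1-\eta_1)$ empirical quantile of $X_1,\dots,X_n$; 5. $f:\mathbb R\to\mathbb R$ is non-negative and non-decreasing, and strictly increasing in a neighbourhood of $u_0$; 6. $\mathbb E(X^2Y^2)<\infty$. Let $\widehat u=\widehat u_n$ be the penalized threshold estimator defined in the context and assume that $\widehat u_n$ converges to $u_0$ in probability. Then, for any fixed constant $\psi>0$ with $u_0+\psi<b$, $$\sqrt n\,\{(\widehat\alpha_{\widehat u+\psi},\widehat\beta_{\widehat u+\psi})-(\alpha_0,\beta_0)\}$$ converges in distribution to the bivariate normal law $\mathcal N(0,\Sigma_{u_0+\psi})$, where $$\Sigma_{u_0+\psi}=\sigma^2\left\{\mathbb E\left(\mathbb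 I_{\{X\ge u_0+\psi\}}\widetilde{\mathbf X}\widetilde{\mathbf X}^{\top}\right)\right\}^{-1},\qquad \widetilde{\mathbf X}=(1,X)^{\top}.$$
   Context: Here $r:\mathbb R\to\mathbb R$ is the regression function; if $a$ or $b$ is infinite, $[a,b]$ is understood as its intersection with $\mathbb R$. The threshold is $$u_0=\inf\{u\in\mathcal S:\ u<b \text{ and for some } \alpha,\beta\in\mathbb R,\ \mathbb P(r(X)=\alpha+\beta X\mid X>u)=1\},$$ with $u_0=+\infty$ if the set is empty. When $u_0$ is finite, $\alpha_0,\beta_0\in\mathbb R$ denote the values such that $\mathbb P(r(X)=\alpha_0+\beta_0X\mid X>u_0)=1$. $\mathcal Z_n=\{(X_i,Y_i):1\le i\le n\}$ is the sample, $\mathbb P_n(g(X,Y))=\frac1n\sum_{i=1}^n g(X_i,Y_i)$ is the empirical mean, and $\mathbb I_A$ is the indicator of $A$. The least squares estimators using only observations with $X_i\ge u$ are $$(\widehat\alpha_u,\widehat\beta_u)=\operatorname{argmin}_{\alpha,\beta}\ \mathbb P_n\{(Y-\alpha-\beta X)^2\,\mathbb I_{\{X\ge u\}}\},$$ and the empirical loss is $$\widehat\ell(u,\mathcal Z_n)=\frac{\mathbb P_n[\{Y-(\widehat\alpha_u+\widehat\beta_u X)\}^2\,\mathbb I_{\{X\ge u\}}]}{\mathbb P_n(\mathbb I_{\{X\ge u\}})}.$$ With penalty parameters $\lambda_n>0$ and penalty function $f$, set $\mathrm{PL}(u,\mathcal Z_n)=\widehat\ell(u,\mathcal Z_n)+\lambda_n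 f(u)$. The threshold estimator is $$\widehat u_n=\operatorname{argmin}_{u:\,u\le\gamma_n}\mathrm{PL}(u,\mathcal Z_n),$$ so that $\widehat u_n\le\gamma_n$ and $\mathrm{PL}(\widehat u_n,\mathcal Z_n)\le\mathrm{PL}(u,\mathcal Z_n)$ for all $u\le\gamma_n$. *)

(* Defs.v *)
From HB Require Import structures.
From mathcomp Require Import all_boot all_order all_algebra.
From mathcomp Require Import all_classical all_reals all_analysis.

Set Implicit Arguments.
Unset Strict Implicit.
Unset Printing Implicit Defensive.

Import Order.TTheory GRing.Theory Num.Theory.
Import numFieldNormedType.Exports.

Local Open Scope classical_set_scope.
Local Open Scope ring_scope.

Section probability_notions.
Context d (T : measurableType d) (R : realType) (P : probability T R).

Definition cond_prob (A B : set T) : R := fine (P (A `&` B)) / fine (P B).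

Definition law_support (X : {RV P >-> R}) : set R :=
  [set x | forall e : R, 0 < e -> (0 < distribution P X (ball x e))%E].

Definition quantile (X : {RV P >-> R}) (p : R) : R :=
  inf [set x | (p%:E <= cdf X x)%E].

Definition independent2 d1 d2 (S1 : measurableType d1) (S2 : measurableType d2)
    (X : T -> S1) (Y : T -> S2) : Prop :=
  forall A B, measurable A -> measurable B ->
    P (X @^-1` A `&` Y @^-1` B) = (P (X @^-1` A) * P (Y @^-1` B))%E.

(* Mutual independence: the product rule over every finite subfamily. *)
Definition independent_seq d1 (S1 : measurableType d1) (Z : nat -> T -> S1) :
    Prop :=
  forall (J : seq nat) (A : nat -> set S1), uniq J ->
    (forall i, measurable (A i)) ->
    P (\bigcap_(i in [set` J]) (Z i @^-1` A i)) =
      (\prod_(i <- J) P (Z i @^-1` A i))%E.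

Definition same_law d1 (S1 : measurableType d1) (Z W : T -> S1) : Prop :=
  forall A, measurable A -> P (Z @^-1` A) = P (W @^-1` A).

Definition cvg_in_prob (V : nat -> T -> R) (c : R) : Prop :=
  forall e : R, 0 < e -> P [set w | e <= `|V n w - c|] @[n --> \oo] --> 0%E.

Definition cvg_in_law (V : nat -> T -> R * R) (mu : probability (R * R)%type R) :
    Prop :=
  forall g : R * R -> R, continuous g ->
    (exists M : R, forall z, `|g z| <= M) ->
    (\int[P]_w (g (V n w))%:E)%E @[n --> \oo] --> (\int[mu]_z (g z)%:E)%E.

End probability_notions.

(* mu = N(m, S): the law of m + A Z with A A^T = S and Z standard normal in the
   plane. This includes the degenerate laws (S singular). *)
Definition is_binormal (R : realType) (mu : probability (R * R)%type R)
    (m : R * R) (S : 'M[R]_2) : Prop :=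
  exists2 A : 'M[R]_2, A *m A^T = S &
    forall B : set (R * R), measurable B ->
      mu B = (normal_prob (0 : R) 1 \x normal_prob (0 : R) 1)%E
        [set z | B (m.1 + (A 0 0 * z.1 + A 0 1 * z.2),
                    m.2 + (A 1 0 * z.1 + A 1 1 * z.2))].

Section model.
Context d (T : measurableType d) (R : realType) (P : probability T R).

(* u_0, as an extended real: ereal_inf set0 = +oo. *)
Definition threshold (X : {RV P >-> R}) (r : R -> R) (b : \bar R) : \bar R :=
  ereal_inf [set u%:E | u in
    [set u : R | [/\ law_support X u, (u%:E < b)%E & exists alpha beta : R,
      cond_prob P [set w | r (X w) = alpha + beta * X w] [set w | u < X w]
        = 1]]].

Definition xtilde (x : R) : 'cV[R]_2 := \col_i (if i == 0 then 1 else x).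

Definition design_moment (X : {RV P >-> R}) (u : R) : 'M[R]_2 :=
  \matrix_(i, j) fine 'E_P[fun w =>
     (u <= X w)%R%:R * (xtilde (X w) *m (xtilde (X w))^T) i j].

Definition asymptotic_cov (X : {RV P >-> R}) (sigma2 u : R) : 'M[R]_2 :=
  sigma2 *: invmx (design_moment X u).

End model.

(* A sample of size n consists of the first n terms (x_i, y_i) of a sequence z,
   indexed from 0. *)
Section empirical.
Context (R : realType).
Implicit Types (n : nat) (z : nat -> R * R) (u : R) (th : R * R).

Definition emp_mean n z (g : R * R -> R) : R := n%:R^-1 * \sum_(i < n) g (z i).

Definition emp_quantile n z (p : R) : R :=
  inf [set x | p <= emp_mean n z (fun s => (s.1 <= x)%R%:R)].

Definition trunc_loss n z u th : R :=
  emp_mean n z (fun s => (s.2 - (th.1 + th.2 * s.1)) ^+ 2 * (u <= s.1)%R%:R).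

(* th is in the argmin; it is the only element as soon as two distinct x_i are
   at least u. *)
Definition is_lse n z u th : Prop :=
  forall th', trunc_loss n z u th <= trunc_loss n z u th'.

(* When th is a least squares estimate at u, this is the empirical loss; its
   value is then the same for all elements of the argmin. *)
Definition emp_loss n z u th : R :=
  trunc_loss n z u th / emp_mean n z (fun s => (u <= s.1)%R%:R).

Definition pen_loss n z (lambda : R) (f : R -> R) u th : R :=
  emp_loss n z u th + lambda * f u.

(* v minimizes u |-> pen_loss n z lambda f u (th u) over u <= g, up to tau.
   The case tau = 0 is v = argmin. Slack is needed for such a v to exist: the
   loss is constant in u between consecutive x_i, left endpoint excluded, so
   an exact minimizer never lies where f is strictly increasing. *)
Definition pen_argmin n z (lambda : R) (f : R -> R) (th : R -> R * R)
    (g tau v : R) : Prop :=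
  v <= g /\ forall u, u <= g ->
    pen_loss n z lambda f v (th v) <= pen_loss n z lambda f u (th u) + tau.

End empirical.

(* Main.v *)
(* Beyond u_0 the regression function is affine, so for a threshold v > u_0 the
   scaled error D of the least squares estimate solves m_n(v) D = W_n(v), where
   m_n(v) is the empirical second moment matrix of (1, X) on {X >= v} and
   W_n(v) = n^(-1/2) sum_i e_i (1, X_i) 1_{X_i >= v}. Of the random threshold
   v = uhat + psi only its convergence to v0 = u_0 + psi matters: a maximal
   inequality in v, applied to the observations with |X_i - v0| <= delta, makes
   W_n equicontinuous at v0 in probability, because X has no atom at v0; with
   the weak law of large numbers the same holds for m_n. So D is close to
   M^-1 W_n(v0), and Slutsky's argument reduces the theorem to the central limit
   theorem for i.i.d. plane vectors.

   The latter is proved by Lindeberg's replacement method for the test functions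
   k(x - .) k(y - .), where k(t) = 1 / (1 + t^2) is rational, with explicit Taylor
   remainders, and integrable. Smoothing a Lipschitz function g >= 0 with k and
   applying Fatou's lemma gives liminf E g(V_n) >= E g(V); Lipschitz envelopes
   extend this to g continuous and bounded, where g and its opposite give the
   limit. *)
Require Import Defs.
From HB Require Import structures.
From mathcomp Require Import all_boot all_order all_algebra.
From mathcomp Require Import all_classical all_reals all_analysis.
From mathcomp Require Import measurable_realfun ring lra.

Set Implicit Arguments.
Unset Strict Implicit.
Unset Printing Implicit Defensive.

Import Order.TTheory GRing.Theory Num.Theory.
Import numFieldNormedType.Exports.

Local Open Scope classical_set_scope.
Local Open Scope ring_scope.

(** * Integrability and independence *)

(** The random threshold depends on the whole sample, so bounds must hold for all thresholds at
    once; they are stated for every [v] outside one measurable set of small probability, which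
    spares the measurability of a supremum. The maximal inequality is pathwise: scanning the
    abscissas downwards to the first large tail sum produces a nonnegative quantity, the squared
    total minus twice a sum of errors times predictable coefficients. It is at least [lam ^+ 2] if
    some tail sum is large, and it has the mean of the squared total because the errors are centered
    given the abscissas. No sorting of the sample and no martingale is involved. In the replacement
    method no sequence of independent normal vectors is built: a single Gaussian vector, whose scale
    shrinks, stands for all the Gaussian terms still present, and stability of the normal law splits
    off one term per step. The Cauchy kernel has no first moment, hence the capped modulus when
    Lipschitz functions are smoothed; its positivity and that of the test function allow Tonelli and
    Fatou without domination. *)

Section real_integral.
Context d (T : measurableType d) (R : realType) (m : {measure set T -> \bar R}).
Implicit Types f g : T -> R.

Definition Rintegrable f := m.-integrable [set: T] (EFin \o f).

Lemma RintegrableD f g : Rintegrable f -> Rintegrable g ->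
  Rintegrable (fun x => f x + g x).
Proof. exact: integrableD. Qed.

Lemma RintegrableB f g : Rintegrable f -> Rintegrable g ->
  Rintegrable (fun x => f x - g x).
Proof. exact: integrableB. Qed.

Lemma RintegrableZ k f : Rintegrable f -> Rintegrable (fun x => k * f x).
Proof. exact: integrableZl. Qed.

Lemma Rintegrable_sum (I : Type) (s : seq I) (p : pred I) (h : I -> T -> R) :
  (forall i, p i -> Rintegrable (h i)) ->
  Rintegrable (fun x => \sum_(i <- s | p i) h i x).
Proof.
move=> ih; rewrite /Rintegrable.
rewrite [X in m.-integrable _ X](_ : _ =
    fun x => (\sum_(i <- s | p i) (EFin \o h i) x)%E); last first.
  by apply/funext => x /=; rewrite sumEFin.
exact: integrable_sum.
Qed.

Lemma Rintegrable_measurable f : Rintegrable f -> measurable_fun setT f.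
Proof. by move=> /measurable_int /measurable_EFinP. Qed.

Lemma le_Rintegrable f g : measurable_fun setT f ->
  (forall x, `|f x| <= g x) -> Rintegrable g -> Rintegrable f.
Proof.
move=> mf fg; apply: le_integrable => //; first exact/measurable_EFinP.
by move=> x _ /=; rewrite lee_fin (le_trans (fg x))// ler_norm.
Qed.

Lemma RintegrableP f : measurable_fun setT f ->
  (\int[m]_x `|f x|%:E < +oo)%E -> Rintegrable f.
Proof. by move=> mf fi; apply/integrableP; split => //; exact/measurable_EFinP. Qed.

Lemma Rintegral_sum (I : Type) (s : seq I) (p : pred I) (h : I -> T -> R) :
  (forall i, p i -> Rintegrable (h i)) ->
  \int[m]_x (\sum_(i <- s | p i) h i x) =
  \sum_(i <- s | p i) \int[m]_x h i x.
Proof.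
move=> ih; elim: s => [|i s IH].
  under eq_Rintegral do rewrite big_nil.
  by rewrite big_nil Rintegral_cst// mul0r.
under eq_Rintegral do rewrite big_cons.
rewrite big_cons; case: ifP => pi; last by [].
by rewrite RintegralD//; [rewrite IH|exact: ih|exact: Rintegrable_sum].
Qed.

Lemma EFin_Rintegral f : Rintegrable f ->
  (\int[m]_x f x)%:E = (\int[m]_x (f x)%:E)%E.
Proof. by move=> fi; rewrite fineK//; exact: integrable_fin_num. Qed.

End real_integral.

Section probability_integral.
Context d (T : measurableType d) (R : realType) (P : probability T R).
Implicit Types f g : T -> R.

Lemma Rintegrable_cst k : Rintegrable P (fun=> k).
Proof. exact: finite_measure_integrable_cst. Qed.

Lemma bounded_Rintegrable f M : measurable_fun setT f ->
  (forall x, `|f x| <= M) -> Rintegrable P f.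
Proof.
by move=> mf fM; apply: (@le_Rintegrable _ _ _ _ _ (fun=> M)) => //;
  exact: Rintegrable_cst.
Qed.

Lemma Rintegral_probability_cst k : \int[P]_x k = k.
Proof.
transitivity (k * fine (P setT)); first exact: Rintegral_cst.
by rewrite probability_setT mulr1.
Qed.

Lemma Rintegral_le_cst f M : Rintegrable P f -> (forall x, f x <= M) ->
  \int[P]_x f x <= M.
Proof.
move=> fi fM; rewrite -[leRHS]Rintegral_probability_cst.
by apply: le_Rintegral => //; exact: Rintegrable_cst.
Qed.

Lemma markov_Rintegral f (c : R) : Rintegrable P f -> (forall x, 0 <= f x) ->
  0 < c -> (P [set x | (c <= f x)%R] <= ((\int[P]_x f x) / c)%:E)%E.
Proof.
move=> fi f0 c0.
have mf := Rintegrable_measurable fi.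
have mA : measurable [set x | c <= f x].
  by rewrite -[X in measurable X]setTI; exact: measurable_fun_le.
rewrite -(fineK (fin_num_measure P _ mA)) lee_fin ler_pdivlMr// -lee_fin.
rewrite EFinM fineK ?fin_num_measure// EFin_Rintegral// muleC.
rewrite -(setIT [set x | _]) -integral_indic// -ge0_integralZl//; last first.
- by rewrite lee_fin ltW.
- exact/measurable_EFinP/measurable_indic.
apply: ge0_le_integral => //=.
- by move=> x _; rewrite lee_fin mulr_ge0// ltW.
- by apply/measurable_EFinP/measurable_funM => //; exact: measurable_indic.
- exact/measurable_EFinP.
move=> x _; rewrite lee_fin indicE.
by have [/set_mem/=|_] := boolP (_ \in _); rewrite ?mulr1 ?mulr0.
Qed.

End probability_integral.

Section distribution_integral.
Context d d' (T : measurableType d) (T' : measurableType d') (R : realType).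

(** Positive and negative parts are treated separately, so neither a sign nor integrability of [f]
    is required. *)
Lemma integral_distributionE (P : probability T R) (X : {mfun T >-> T'})
    (f : T' -> \bar R) : measurable_fun setT f ->
  (\int[distribution P X]_y f y = \int[P]_w f (X w))%E.
Proof.
move=> mf; rewrite integralE [RHS](@integralE _ _ _ _ _ (f \o X)).
rewrite (funepos_comp f X) (funeneg_comp f X).
rewrite ge0_integral_distribution; last 2 first.
- exact: measurable_funepos.
- by move=> y; exact: funepos_ge0.
rewrite ge0_integral_distribution => [//||y]; last exact: funeneg_ge0.
exact: measurable_funeneg.
Qed.

End distribution_integral.

Section pair_mfun.
Context d d1 d2 (T : measurableType d) (S1 : measurableType d1)
  (S2 : measurableType d2).

Definition pair_mfun (U : {mfun T >-> S1}) (V : {mfun T >-> S2}) (w : T) :=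
  (U w, V w).

Lemma measurable_pair_mfun U V : measurable_fun setT (pair_mfun U V).
Proof. exact/measurable_fun_pair. Qed.

HB.instance Definition _ U V :=
  isMeasurableFun.Build _ _ _ _ (pair_mfun U V) (measurable_pair_mfun U V).

End pair_mfun.

(** * Joint laws of independent variables *)

Section independence.
Context d (T : measurableType d) (R : realType) (P : probability T R).
Context d1 d2 (S1 : measurableType d1) (S2 : measurableType d2).
Variables (U : {mfun T >-> S1}) (V : {mfun T >-> S2}).
Hypothesis UV : independent2 P U V.

(** Independence is the product rule on rectangles, and these determine the product measure. *)
Let UVlaw (B : set (S1 * S2)) : measurable B ->
  (distribution P U \x distribution P V)%E B =
  distribution P (pair_mfun U V) B.
Proof. by move=> mB; exact: product_measure_unique. Qed.

Lemma ge0_independent_integral (f : S1 * S2 -> \bar R) :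
  measurable_fun setT f -> (forall z, 0 <= f z)%E ->
  (\int[P]_w f (U w, V w) = \int[P]_w \int[P]_w' f (U w', V w))%E.
Proof.
move=> mf f0.
transitivity (\int[distribution P (pair_mfun U V)]_z f z)%E.
  by rewrite ge0_integral_distribution.
rewrite (eq_measure_integral (distribution P U \x distribution P V)%E); last first.
  by move=> A mA _; exact/esym/UVlaw.
rewrite fubini_tonelli2//= ge0_integral_distribution//=.
- apply: eq_integral => w _; rewrite /= /fubini_G ge0_integral_distribution//.
  exact: measurableT_comp.
- exact: measurable_fun_fubini_tonelli_G.
- by move=> y; apply: integral_ge0.
Qed.

(** A signed integrand must be integrable for the product law; this is transported from the
    integrability of [f (U, V)] through the equality of laws [UVlaw]. *)
Lemma independent_integral (f : S1 * S2 -> R) :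
  measurable_fun setT f -> Rintegrable P (fun w => f (U w, V w)) ->
  (\int[P]_w (f (U w, V w))%:E = \int[P]_w \int[P]_w' (f (U w', V w))%:E)%E.
Proof.
move=> mf fi.
have mf' : measurable_fun setT (EFin \o f) by exact/measurable_EFinP.
have fi' : (distribution P U \x distribution P V)%E.-integrable setT (EFin \o f).
  apply/integrableP; split=> //.
  rewrite (eq_measure_integral (distribution P (pair_mfun U V))); last first.
    by move=> A mA _; exact: UVlaw.
  rewrite ge0_integral_distribution//; first by case/integrableP : fi.
  exact: measurableT_comp.
transitivity (\int[distribution P (pair_mfun U V)]_z (f z)%:E)%E.
  by rewrite integral_distribution.
rewrite (eq_measure_integral (distribution P U \x distribution P V)%E); last first.
  by move=> A mA _; exact/esym/UVlaw.
rewrite -integral21_prod_meas1// integral_distributionE//=; last first.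
  exact: (@measurable_fubini_G _ _ S1 S2 R (distribution P U)
            (distribution P V) _ fi').
apply: eq_integral => w _; rewrite /fubini_G integral_distributionE//.
apply/measurable_EFinP.
exact: (measurableT_comp mf (pair2_measurable (V w))).
Qed.

(** Integrability of the product comes first: Tonelli on absolute values factors its mean into two
    finite means. *)
Lemma independent_RintegralM (f : S1 -> R) (g : S2 -> R) :
  measurable_fun setT f -> measurable_fun setT g ->
  Rintegrable P (f \o U) -> Rintegrable P (g \o V) ->
  Rintegrable P (fun w => f (U w) * g (V w)) /\
  \int[P]_w (f (U w) * g (V w)) = (\int[P]_w f (U w)) * \int[P]_w g (V w).
Proof.
move=> mf mg fi gi.
have mfg : measurable_fun setT (fun z : S1 * S2 => f z.1 * g z.2).
  by apply: measurable_funM; apply: measurableT_comp.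
have fgi : Rintegrable P (fun w => f (U w) * g (V w)).
  apply: RintegrableP.
    by apply: measurable_funM; apply: measurableT_comp.
  rewrite (ge0_independent_integral (f := fun z => `|f z.1 * g z.2|%:E))//=.
  - have nfi := integrable_norm fi.
    under eq_integral => w _.
      under eq_integral => w' _ do rewrite normrM mulrC EFinM.
      rewrite integralZl//.
      rewrite -EFin_Rintegral// -EFinM mulrC EFinM.
      over.
    rewrite integralZl//=; last exact: (integrable_norm gi).
    by rewrite -EFin_Rintegral ?ltry//; exact: (integrable_norm gi).
  - by apply/measurable_EFinP/measurableT_comp.
split=> //.
rewrite [LHS]/Rintegral.
rewrite (independent_integral (f := fun z => f z.1 * g z.2))//=.
under eq_integral => w _.
  under eq_integral => w' _ do rewrite mulrC EFinM.
  rewrite integralZl//.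
  rewrite -EFin_Rintegral// -EFinM mulrC EFinM.
  over.
rewrite integralZl//= -EFin_Rintegral//.
Qed.

End independence.

Section decoupling.
Context d d1 (T : measurableType d) (R : realType) (P : probability T R)
  (S : measurableType d1) (Z : nat -> {mfun T >-> S}) (k : nat).

(* Integrating out one term of an independent sequence with the others fixed:
   the others are summarized by the identity into the sigma-algebra they
   generate, which avoids building an infinite product space. *)
Definition cylinders_off : set (set T) :=
  [set B | exists2 N : nat, True & exists2 A : nat -> set S,
     forall i, measurable (A i) &
     B = \bigcap_(i in [set` [seq i <- iota 0 N | i != k]]) (Z i @^-1` A i)].

Definition sigma_off := g_sigma_algebraType cylinders_off.

Lemma measurable_cylinders_off : cylinders_off `<=` measurable.
Proof.
move=> _ [N _ [A mA ->]]; apply: bigcap_measurableType => // i _.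
by rewrite -[X in measurable X]setTI; apply: measurable_funP.
Qed.

Lemma cylinders_offI : setI_closed cylinders_off.
Proof.
move=> _ _ [N _ [A mA ->]] [M _ [B mB ->]].
exists (maxn N M) => //.
(* Each cylinder is padded with [setT] beyond its own length, so that both constrain the same range
   of indices. *)
exists (fun i => (if (i < N)%N then A i else setT) `&`
                 (if (i < M)%N then B i else setT)).
  by move=> i; apply: measurableI; case: ifP.
rewrite predeqE => w; split.
  move=> [wA wB] i /=; rewrite mem_filter mem_iota/= add0n => /andP[ik _].
  split; case: ifPn => // iN.
    by apply: wA; rewrite /= mem_filter ik mem_iota.
  by apply: wB; rewrite /= mem_filter ik mem_iota.
move=> wAB; split=> i /=; rewrite mem_filter mem_iota/= add0n => /andP[ik iN].
  have := wAB i; rewrite /= mem_filter ik mem_iota/= add0n leq_max iN => /(_ isT).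
  by case.
have := wAB i; rewrite /= mem_filter ik mem_iota/= add0n leq_max iN orbT.
by move=> /(_ isT)[].
Qed.

Lemma cylinders_offT : cylinders_off setT.
Proof.
exists 0%N => //; exists (fun=> setT) => //.
by rewrite bigcapT.
Qed.

Definition off_id (w : T) : sigma_off := w.

Lemma measurable_off_id : measurable_fun setT off_id.
Proof.
apply: (@measurability _ _ _ sigma_off setT off_id cylinders_off) => // _ [B GB <-].
by rewrite setTI; exact: measurable_cylinders_off.
Qed.

HB.instance Definition _ := isMeasurableFun.Build _ _ _ _ off_id measurable_off_id.

Lemma measurable_off i : i != k -> measurable_fun [set: sigma_off] (Z i).
Proof.
move=> ik _ A mA; rewrite setTI; apply: sub_sigma_algebra.
exists i.+1 => //; exists (fun j => if j == i then A else setT).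
  by move=> j; case: ifP.
rewrite predeqE => w; split => [wA j _|/(_ i)].
  by rewrite /preimage /=; case: eqP => // ->.
rewrite eqxx; apply.
have : i \in [seq j <- iota 0 i.+1 | j != k] by rewrite mem_filter ik mem_iota add0n/=.
exact.
Qed.

Hypothesis indZ : independent_seq P Z.

(** For fixed [A], both sides are finite measures in [B], and they agree on the cylinders, a
    generating family closed under intersection. *)
Lemma independent_off : independent2 P (Z k) off_id.
Proof.
move=> A B mA mB.
have mZA : measurable (Z k @^-1` A).
  by rewrite -[X in measurable X]setTI; apply: measurable_funP.
have p0 : 0 <= fine (P (Z k @^-1` A)) by exact: fine_ge0.
rewrite setIC.
transitivity (mscale (NngNum p0) P B); last first.
  by rewrite /mscale/= fineK// fin_num_measure.
apply: (g_sigma_algebra_measure_unique cylinders_off measurable_cylinders_off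
  (fun=> setT) (fun=> cylinders_offT) _ (mrestr P mZA)) => //.
- by rewrite bigcup_const.
- exact: cylinders_offI.
- move=> _ [N _ [C mC ->]].
  rewrite -[LHS]/(P (_ `&` _)) -[RHS]/((fine (P (Z k @^-1` A)))%:E * P _)%E.
  rewrite fineK ?fin_num_measure// setIC.
  set J := [seq i <- iota 0 N | i != k].
  have uJ : uniq J by rewrite filter_uniq// iota_uniq.
  have kJ : k \notin J by rewrite mem_filter eqxx.
  rewrite (indZ uJ mC).
  (* The product rule over [k :: J], with [A] placed at index [k], splits off the factor of
     [Z k]. *)
  have := indZ (J := k :: J) (A := fun i => if i == k then A else C i).
  rewrite /= kJ uJ => /(_ isT) indkJ.
  have {indkJ} := indkJ _.
  rewrite big_cons eqxx.
  rewrite (eq_big_seq (fun i => P (Z i @^-1` C i))); last first.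
    by move=> i; rewrite mem_filter => /andP[/negPf ->].
  move=> <-; last by move=> i; case: ifP.
  congr (P _); rewrite predeqE => w; split.
    move=> [wA wC] i /=; rewrite inE; case: eqP => [->//|ik] /=.
    exact: wC.
  move=> H; split; first by have := H k; rewrite /= mem_head eqxx => /(_ isT).
  move=> i iJ; have := H i; rewrite /= inE iJ orbT => /(_ isT).
  by case: eqP => // ik; move: kJ; rewrite -ik iJ.
- move=> _; rewrite /= /mrestr setTI.
  by rewrite (le_lt_trans (probability_le1 _ _))// ltry.
Qed.

End decoupling.

(** * The standard normal law of the plane *)

Section density.
Local Open Scope ereal_scope.
Context d (T : measurableType d) (R : realType).
Variables (mu nu : {measure set T -> \bar R}) (h : T -> R).
Hypotheses (mh : measurable_fun setT h) (h0 : forall x, (0 <= h x)%R).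
Hypothesis nuE : forall A, measurable A -> nu A = \int[mu]_(x in A) (h x)%:E.

Import HBNNSimple.

Let integral_density_nnsfun (f : {nnsfun T >-> R}) :
  \int[nu]_x (f x)%:E = \int[mu]_x (f x * h x)%:E.
Proof.
under [LHS]eq_integral do rewrite fimfunE -fsumEFin//.
rewrite [LHS]ge0_integral_fsum//; last 2 first.
  - by move=> r; exact/measurable_EFinP/measurableT_comp.
  - by move=> n x _; rewrite EFinM nnfun_muleindic_ge0.
under [RHS]eq_integral.
  move=> x xD; rewrite fimfunE EFinM -fsumEFin// ge0_mule_fsuml; last first.
    by move=> r; rewrite EFinM nnfun_muleindic_ge0.
  over.
rewrite [RHS]ge0_integral_fsum//; last 2 first.
  - move=> r; apply: emeasurable_funM; last exact/measurable_EFinP.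
    by apply/measurable_EFinP/measurableT_comp.
  - move=> n x _; rewrite mule_ge0//; last by rewrite lee_fin.
    by rewrite EFinM nnfun_muleindic_ge0.
apply: eq_fsbigr => r; rewrite inE => -[x _ fxr].
have r0 : (0 <= r)%R by rewrite -fxr.
have mf : measurable (f @^-1` [set r]) by [].
under eq_integral do rewrite EFinM.
rewrite ge0_integralZl//; last exact/measurable_EFinP.
rewrite integral_indic//= setIT nuE//.
under [RHS]eq_integral do rewrite EFinM -muleA.
rewrite ge0_integralZl//; last 2 first.
- by apply: emeasurable_funM; exact/measurable_EFinP.
- by move=> y _; rewrite mule_ge0// lee_fin.
congr (_ * _); rewrite integral_mkcond; apply: eq_integral => y _.
by rewrite patchE indicE; case: ifPn; rewrite ?mul1e ?mul0e.
Qed.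

(** Monotone convergence from simple functions, for which [nuE] is applied on each level set. *)
Lemma ge0_integral_density (f : T -> \bar R) :
  measurable_fun setT f -> (forall x, 0 <= f x) ->
  \int[nu]_x f x = \int[mu]_x (f x * (h x)%:E).
Proof.
move=> mf f0.
pose f_ := nnsfun_approx measurableT mf.
transitivity (lim (\int[nu]_x (f_ n x)%:E @[n --> \oo])%E).
  rewrite -monotone_convergence//=.
  - apply: eq_integral => ? /[!inE] xD; apply/esym/cvg_lim => //=.
    exact: cvg_nnsfun_approx.
  - by move=> n; exact/measurable_EFinP/measurable_funTS.
  - by move=> n ? _; rewrite lee_fin.
  - by move=> ? _ ? ? mn; rewrite lee_fin; exact/lefP/nd_nnsfun_approx.
under eq_fun do rewrite integral_density_nnsfun.
rewrite -monotone_convergence//=.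
- apply: eq_integral => x _; apply/cvg_lim => //.
  under eq_fun do rewrite EFinM.
  apply: cvgeMr => //; exact: cvg_nnsfun_approx.
- by move=> n; apply/measurable_EFinP; exact: measurable_funM.
- by move=> n x _; rewrite lee_fin mulr_ge0.
- move=> x _ a b ab; rewrite lee_fin ler_wpM2r//.
  exact/lefP/nd_nnsfun_approx.
Qed.

End density.

Section affine_substitution.
Context (R : realType).
Notation leb := (@lebesgue_measure R).

Lemma ge0_integral_affine (G : R -> R) (a b : R) : 0 < a -> continuous G ->
  (forall x, 0 <= G x) ->
  (\int[leb]_x (G x)%:E = \int[leb]_x (a * G (a * x + b))%:E)%E.
Proof.
move=> a0 cG G0.
pose F x : R := x * a + b.
have F' : F^`()%classic = cst a.
  apply/funext => x; rewrite /F derive1E deriveD// deriveM// derive_cst scaler0.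
  by rewrite derive_cst add0r addr0 derive_id /GRing.scale/= mulr1.
rewrite (@increasing_ge0_integration_by_substitutionT _ F G)//.
- apply: eq_integral => x _; rewrite F' /F; congr EFin.
  by rewrite -[LHS]/(G (x * a + b) * a) mulrC (mulrC x).
- by move=> x y xy; rewrite /F ltrD2r ltr_pM2r.
- by rewrite F' => ?; exact: cvg_cst.
- by rewrite F'; exact: is_cvg_cst.
- by rewrite F'; exact: is_cvg_cst.
- apply: (@cvg_comp _ _ _ (fun x => x * a) (fun x => x + b) _ -oo%R).
    by apply/gt0_cvgMlNy => //; exact: cvg_id.
  exact: cvg_addrr_Ny.
- apply: (@cvg_comp _ _ _ (fun x => x * a) (fun x => x + b) _ +oo%R).
    by apply/gt0_cvgMly => //; exact: cvg_id.
  exact: cvg_addrr.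
Qed.

End affine_substitution.

Section normal_stability.
Context (R : realType).
Notation leb := (@lebesgue_measure R).
Notation N := (normal_prob (0 : R) 1).

Lemma ge0_integral_normal_prob (m s : R) (f : R -> \bar R) :
  measurable_fun setT f -> (forall x, (0 <= f x)%E) ->
  (\int[normal_prob m s]_x f x = \int[leb]_x (f x * (normal_pdf m s x)%:E))%E.
Proof.
move=> mf f0; apply: ge0_integral_density => //.
- exact: measurable_normal_pdf.
- by move=> x; exact: normal_pdf_ge0.
Qed.

Lemma normal_pdf_affine (m s t : R) : 0 < s ->
  normal_pdf (0 : R) 1 ((t - m) / s) / s = normal_pdf m s t.
Proof.
move=> s0.
rewrite !normal_pdfE ?oner_eq0 ?gt_eqF// /normal_peak /normal_fun.
rewrite expr1n mul1r mulrAC; congr (_ * _).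
  by rewrite -mulrnAr sqrtrM ?sqr_ge0// sqrtr_sqr gtr0_norm// invfM mulrC.
rewrite subr0; congr expR; rewrite exprMn exprVn; field.
by rewrite gt_eqF.
Qed.

(* The two densities in (x, t) agree: x^2 + ((t - a x) / b)^2 = t^2 + ((x - a t) / b)^2. *)
Lemma normal_pdf_exchange (a b x t : R) : 0 < b -> a ^+ 2 + b ^+ 2 = 1 ->
  normal_pdf 0 1 x * normal_pdf (a * x) b t =
  normal_pdf 0 1 t * normal_pdf (a * t) b x.
Proof.
move=> b0 ab.
rewrite !normal_pdfE ?oner_eq0 ?gt_eqF// /normal_fun.
rewrite -!mulrA; congr (_ * _); rewrite !(mulrCA (expR _)); congr (_ * _).
rewrite -!expRD; congr expR.
have b20 : b != 0 by rewrite gt_eqF.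
have sqE u v : (u - a * v) ^+ 2 = u ^+ 2 - 2 * a * u * v + (1 - b ^+ 2) * v ^+ 2.
  have <- : a ^+ 2 = 1 - b ^+ 2 by rewrite -ab addrK.
  by ring.
rewrite !subr0 (sqE t x) (sqE x t) expr1n -[b ^+ 2 *+ 2]mulr_natr invfM.
have cb : b ^+ 2 * b ^- 2 = 1 by rewrite divff// expf_neq0.
apply/eqP; rewrite -subr_eq0; apply/eqP.
transitivity ((x ^+ 2 - t ^+ 2) * 2^-1 * (b ^+ 2 * b ^- 2 - 1)); first by ring.
by rewrite cb subrr mulr0.
Qed.

(** For fixed [x], substituting [t = a * x + b * y] turns the inner law into the normal law of mean
    [a * x] and deviation [b]. Then [normal_pdf_exchange] swaps the roles of [x] and [t], and
    integrating [x] out first leaves a density of total mass 1. *)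
Lemma normal_stable1 (a b : R) (f : R -> R) : 0 < b -> a ^+ 2 + b ^+ 2 = 1 ->
  continuous f -> (forall x, 0 <= f x) ->
  (\int[N]_x \int[N]_y (f (a * x + b * y))%:E = \int[N]_x (f x)%:E)%E.
Proof.
move=> b0 ab cf f0.
have mf : measurable_fun setT f by exact: continuous_measurable_fun.
have mf2 : measurable_fun setT (fun z : R * R => f (a * z.1 + b * z.2)).
  apply: measurableT_comp => //; apply: measurable_funD; exact: measurable_funM.
transitivity (\int[N]_x \int[leb]_t (f t * normal_pdf (a * x) b t)%:E)%E.
  apply: eq_integral => x _.
  rewrite ge0_integral_normal_prob; last 2 first.
  - apply/measurable_EFinP/measurableT_comp => //.
    by apply: measurable_funD => //; exact: measurable_funM.
  - by move=> y; rewrite lee_fin.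
  rewrite [RHS](@ge0_integral_affine R _ b (a * x))//.
  - apply: eq_integral => y _; rewrite -EFinM; congr EFin.
    rewrite -(normal_pdf_affine (a * x))// addrK [b * y / b]mulrAC divff ?gt_eqF//.
    rewrite mul1r (addrC (b * y)).
    move: (f _) (normal_pdf _ _ _) => g p.
    by field; rewrite gt_eqF.
  - move=> t; apply: cvgM; first exact: cf.
    by apply: continuous_normal_pdf; rewrite gt_eqF.
  - by move=> t; rewrite mulr_ge0// normal_pdf_ge0.
have mpdf : measurable_fun setT
    (fun z : R * R => normal_pdf (a * z.1) b z.2).
  under eq_fun do rewrite -normal_pdf_affine//.
  apply: measurable_funM => //; apply: measurableT_comp.
    exact: measurable_normal_pdf.
  apply: measurable_funM => //; apply: measurable_funB => //.
  exact: measurable_funM.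
have mp : measurable_fun setT
    (fun z : R * R => (f z.2 * normal_pdf (a * z.1) b z.2)%:E).
  by apply/measurable_EFinP/measurable_funM => //; exact: measurableT_comp.
have mq : measurable_fun setT (fun z : R * R =>
    (f z.2 * normal_pdf 0 1 z.2 * normal_pdf (a * z.2) b z.1)%:E).
  apply/measurable_EFinP/measurable_funM; last first.
    exact: (measurableT_comp mpdf (@measurable_swap _ _ R R)).
  apply: measurable_funM; first exact: measurableT_comp.
  by apply: measurableT_comp => //; exact: measurable_normal_pdf.
rewrite ge0_integral_normal_prob; last 2 first.
- apply: (measurable_fun_fubini_tonelli_F (m2 := leb) (fun z : R * R =>
    (f z.2 * normal_pdf (a * z.1) b z.2)%:E)) => // z.
  by rewrite lee_fin mulr_ge0// normal_pdf_ge0.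
- by move=> x; apply: integral_ge0 => t _; rewrite lee_fin mulr_ge0// normal_pdf_ge0.
rewrite [RHS]ge0_integral_normal_prob; last 2 first.
- exact/measurable_EFinP.
- by move=> x; rewrite lee_fin.
transitivity (\int[leb]_x \int[leb]_t
    (f t * normal_pdf 0 1 t * normal_pdf (a * t) b x)%:E)%E.
  apply: eq_integral => x _.
  rewrite muleC -ge0_integralZl//=.
  - apply: eq_integral => t _; rewrite -EFinM; congr EFin.
    by rewrite mulrCA normal_pdf_exchange// mulrA.
  - exact: (measurableT_comp mp (pair1_measurable x)).
  - by move=> t _; rewrite lee_fin mulr_ge0// normal_pdf_ge0.
  - by rewrite lee_fin normal_pdf_ge0.
rewrite (@fubini_tonelli _ _ _ _ _ leb leb (fun z =>
  (f z.2 * normal_pdf 0 1 z.2 * normal_pdf (a * z.2) b z.1)%:E))/=; last 2 first.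
- exact: mq.
- by move=> z; rewrite lee_fin !mulr_ge0// normal_pdf_ge0.
apply: eq_integral => t _.
under eq_integral do rewrite EFinM.
have mt : measurable_fun setT (fun x : R => (normal_pdf (a * t) b x)%:E).
  by apply/measurable_EFinP; exact: measurable_normal_pdf.
rewrite ge0_integralZl//=; last 2 first.
- by move=> x _; rewrite lee_fin normal_pdf_ge0.
- by rewrite lee_fin mulr_ge0// normal_pdf_ge0.
by rewrite integral_normal_pdf mule1 EFinM.
Qed.

(** Dividing both coefficients by their norm [rho] reduces to unit variance, applied to [f] composed
    with multiplication by [rho]. *)
Lemma normal_stable (s t : R) (f : R -> R) : 0 < t ->
  continuous f -> (forall x, 0 <= f x) ->
  (\int[N]_x \int[N]_y (f (s * x + t * y))%:E =
   \int[N]_x (f (Num.sqrt (s ^+ 2 + t ^+ 2) * x))%:E)%E.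
Proof.
move=> t0 cf f0; set rho := Num.sqrt _.
have rho0 : 0 < rho by rewrite sqrtr_gt0 ltr_wpDl ?sqr_ge0 ?exprn_gt0.
have rhon : rho != 0 by rewrite gt_eqF.
rewrite -(@normal_stable1 (s / rho) (t / rho) (fun x => f (rho * x))).
- apply: eq_integral => x _; apply: eq_integral => y _; congr ((f _)%:E).
  by field.
- by rewrite divr_gt0.
- rewrite !expr_div_n -mulrDl sqr_sqrtr ?divff//; last by rewrite addr_ge0 ?sqr_ge0.
  by rewrite gt_eqF// ltr_wpDl ?sqr_ge0 ?exprn_gt0.
- move=> x; apply: continuous_comp; last exact: cf.
  by apply: cvgM; [exact: cvg_cst|exact: cvg_id].
- by [].
Qed.

End normal_stability.

Section product_stability.
Local Open Scope ereal_scope.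
Context (R : realType) (N : probability R R).
Hypothesis N_stable : forall (s t : R) (f : R -> R), (0 < t)%R ->
  continuous f -> (forall x, (0 <= f x)%R) ->
  \int[N]_x \int[N]_y (f (s * x + t * y)%R)%:E =
  \int[N]_x (f (Num.sqrt (s ^+ 2 + t ^+ 2) * x)%R)%:E.

Variable gam : probability (R * R)%type R.
Hypothesis gamE : forall f : R * R -> \bar R, measurable_fun setT f ->
  (forall z, 0 <= f z) -> \int[gam]_z f z = \int[N]_x \int[N]_y f (x, y).

(** The four integrals are reordered so that the two variables of one coordinate become adjacent,
    and [N_stable] is used once per coordinate. This is why separate continuity of [G] is the right
    assumption. *)
Lemma product_stable (s t : R) (G : R * R -> R) : (0 < t)%R ->
  measurable_fun setT G -> (forall z, (0 <= G z)%R) ->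
  (forall x, continuous (fun y => G (x, y))) ->
  (forall y, continuous (fun x => G (x, y))) ->
  \int[gam]_z \int[gam]_z' (G (s * z.1 + t * z'.1, s * z.2 + t * z'.2)%R)%:E =
  \int[gam]_z (G (Num.sqrt (s ^+ 2 + t ^+ 2) * z.1,
                     Num.sqrt (s ^+ 2 + t ^+ 2) * z.2)%R)%:E.
Proof.
move=> t0 mG G0 cG1 cG2; set rho := Num.sqrt _.
have mGE d (T : measurableType d) (u v : T -> R) : measurable_fun setT u ->
    measurable_fun setT v -> measurable_fun setT (fun w => (G (u w, v w))%:E).
  move=> mu mv; apply/measurable_EFinP; apply: (measurableT_comp mG).
  exact/measurable_fun_pair.
have mlin d (T : measurableType d) (u v : T -> R) : measurable_fun setT u ->
    measurable_fun setT v -> measurable_fun setT (fun w => s * u w + t * v w)%R.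
  by move=> mu mv; apply: measurable_funD; apply: measurable_funM.
have mscal d (T : measurableType d) (u : T -> R) : measurable_fun setT u ->
    measurable_fun setT (fun w => rho * u w)%R.
  by move=> mu; apply: measurable_funM.
have G0E x : 0 <= (G x)%:E by rewrite lee_fin.
transitivity (\int[N]_x1 \int[N]_x2 \int[N]_y1 \int[N]_y2
    (G (s * x1 + t * y1, s * x2 + t * y2)%R)%:E).
  rewrite gamE; last 2 first.
  - apply: (measurable_fun_fubini_tonelli_F (m2 := gam)
      (fun w : (R * R) * (R * R) =>
         (G (s * w.1.1 + t * w.2.1, s * w.1.2 + t * w.2.2)%R)%:E)) => //.
    by apply: mGE; apply: mlin; apply: measurableT_comp.
  - by move=> z; apply: integral_ge0.
  apply: eq_integral => x1 _; apply: eq_integral => x2 _.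
  rewrite gamE => [//||//].
  by apply: mGE; apply: mlin.
transitivity (\int[N]_x1 \int[N]_y1 \int[N]_x2 \int[N]_y2
    (G (s * x1 + t * y1, s * x2 + t * y2)%R)%:E).
  apply: eq_integral => x1 _.
  rewrite (@fubini_tonelli _ _ R R R N N (fun w => \int[N]_y2
    (G (s * x1 + t * w.2, s * w.1 + t * y2)%R)%:E))//; last first.
    by move=> w; apply: integral_ge0.
  apply: (measurable_fun_fubini_tonelli_F (m2 := N)
      (fun w : (R * R) * R =>
         (G (s * x1 + t * w.1.2, s * w.1.1 + t * w.2)%R)%:E)) => //.
  by apply: mGE; apply: mlin => //; apply: measurableT_comp.
transitivity (\int[N]_x1 \int[N]_y1 \int[N]_v
    (G (s * x1 + t * y1, rho * v)%R)%:E).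
  apply: eq_integral => x1 _; apply: eq_integral => y1 _.
  exact: (N_stable s t0 (cG1 _)).
transitivity (\int[N]_v \int[N]_x1 \int[N]_y1
    (G (s * x1 + t * y1, rho * v)%R)%:E).
  rewrite -(gamE (f := fun w : R * R => \int[N]_v
    (G (s * w.1 + t * w.2, rho * v)%R)%:E)); last 2 first.
  - apply: (measurable_fun_fubini_tonelli_F (m2 := N) (fun w : (R * R) * R =>
         (G (s * w.1.1 + t * w.1.2, rho * w.2)%R)%:E)) => //.
    by apply: mGE; [apply: mlin; apply: measurableT_comp|exact: mscal].
  - by move=> w; apply: integral_ge0.
  rewrite (@fubini_tonelli _ _ _ R R (gam) N (fun w : (R * R) * R =>
         (G (s * w.1.1 + t * w.1.2, rho * w.2)%R)%:E)); last 2 first.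
  - by apply: mGE; [apply: mlin; apply: measurableT_comp|exact: mscal].
  - by [].
  apply: eq_integral => v _.
  rewrite gamE => [//||//].
  by apply: (mGE _ (R * R)%type (fun z => s * z.1 + t * z.2)%R (fun=> rho * v)%R);
    [apply: mlin|exact: measurable_cst].
transitivity (\int[N]_v \int[N]_u (G (rho * u, rho * v)%R)%:E).
  apply: eq_integral => v _.
  exact: (N_stable s t0 (cG2 _)).
have mGr : measurable_fun setT (fun z : R * R => (G (rho * z.1, rho * z.2)%R)%:E).
  by apply: mGE; apply: mscal.
rewrite gamE => [|//|z]; last exact: G0E.
apply/esym; exact: (fubini_tonelli (m1 := N) (m2 := N) _ mGr).
Qed.

End product_stability.

(* [normal_prob] lives on [measurableTypeR R], whose display is not that of [R]. *)
Definition of_measurableTypeR (R : realType) (x : measurableTypeR R) : R := x.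

Lemma measurable_of_measurableTypeR (R : realType) :
  measurable_fun setT (@of_measurableTypeR R).
Proof. by move=> _ A mA; rewrite setTI. Qed.

HB.instance Definition _ (R : realType) := isMeasurableFun.Build _ _ _ _
  (@of_measurableTypeR R) (@measurable_of_measurableTypeR R).

Definition std_normal (R : realType) : probability R R :=
  [the probability _ _ of distribution (normal_prob (0 : R) 1)
    (@of_measurableTypeR R)].

Lemma ge0_integral_std_normal (R : realType) (f : R -> \bar R) :
  measurable_fun setT f -> (forall x, (0 <= f x)%E) ->
  (\int[std_normal R]_x f x = \int[normal_prob (0 : R) 1]_x f x)%E.
Proof. by move=> mf f0; rewrite ge0_integral_distribution. Qed.

Lemma std_normal_stable (R : realType) (s t : R) (f : R -> R) : 0 < t ->
  continuous f -> (forall x, 0 <= f x) ->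
  (\int[std_normal R]_x \int[std_normal R]_y (f (s * x + t * y))%:E =
   \int[std_normal R]_x (f (Num.sqrt (s ^+ 2 + t ^+ 2) * x))%:E)%E.
Proof.
move=> t0 cf f0.
have mf : measurable_fun setT f by exact: continuous_measurable_fun.
have mlin (x : R) : measurable_fun setT (fun y => (f (s * x + t * y))%:E).
  apply/measurable_EFinP/measurableT_comp => //.
  by apply: measurable_funD => //; exact: measurable_funM.
rewrite ge0_integral_std_normal; last 2 first.
- apply: (measurable_fun_fubini_tonelli_F (m2 := std_normal R)
    (fun z : R * R => (f (s * z.1 + t * z.2))%:E)) => [|z].
    apply/measurable_EFinP/measurableT_comp => //.
    by apply: measurable_funD => //; exact: measurable_funM.
  by rewrite lee_fin.
- by move=> x; apply: integral_ge0 => y _; rewrite lee_fin.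
rewrite ge0_integral_std_normal; last 2 first.
- by apply/measurable_EFinP/measurableT_comp => //; exact: measurable_funM.
- by move=> x; rewrite lee_fin.
rewrite -(normal_stable s t0 cf f0).
apply: eq_integral => x _; rewrite ge0_integral_std_normal//.
by move=> y; rewrite lee_fin.
Qed.

Definition std_binormal (R : realType) : probability (R * R)%type R :=
  [the probability _ _ of (std_normal R \x std_normal R)%E].

Lemma std_binormalE (R : realType) (A : set (R * R)) : measurable A ->
  std_binormal R A = (normal_prob (0 : R) 1 \x normal_prob (0 : R) 1)%E A.
Proof.
move=> mA; rewrite /std_binormal/= /product_measure1 ge0_integral_std_normal//.
exact: measurable_fun_xsection.
Qed.

Lemma ge0_integral_std_binormal (R : realType) (f : R * R -> \bar R) :
  measurable_fun setT f -> (forall z, (0 <= f z)%E) ->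
  (\int[std_binormal R]_z f z =
   \int[std_normal R]_x \int[std_normal R]_y f (x, y))%E.
Proof. by move=> mf f0; exact: fubini_tonelli1. Qed.

Lemma std_binormal_stable (R : realType) (s t : R) (G : R * R -> R) : 0 < t ->
  measurable_fun setT G -> (forall z, 0 <= G z) ->
  (forall x, continuous (fun y => G (x, y))) ->
  (forall y, continuous (fun x => G (x, y))) ->
  (\int[std_binormal R]_z \int[std_binormal R]_z'
     (G (s * z.1 + t * z'.1, s * z.2 + t * z'.2))%:E =
   \int[std_binormal R]_z (G (Num.sqrt (s ^+ 2 + t ^+ 2) * z.1,
                     Num.sqrt (s ^+ 2 + t ^+ 2) * z.2))%:E)%E.
Proof.
exact: (product_stable (@std_normal_stable R) (@ge0_integral_std_binormal R)).
Qed.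

(** * First two moments of the standard normal law *)

Section std_normal_moments.
Context (R : realType).
Notation leb := (@lebesgue_measure R).

Lemma normal_pdf_scale (c x : R) : 0 < c ->
  normal_pdf 0 1 (c * x) = c^-1 * normal_pdf 0 c^-1 x.
Proof.
move=> c0; rewrite -(@normal_pdf_affine _ 0 c^-1) ?invr_gt0// subr0 invrK.
by rewrite mulrCA mulVf ?gt_eqF// mulr1 mulrC.
Qed.

Lemma integral_normal_pdf_scale (c : R) : 0 < c ->
  (\int[leb]_x (normal_pdf 0 1 (c * x))%:E = (c^-1)%:E)%E.
Proof.
move=> c0.
under eq_integral => x _.
  rewrite normal_pdf_scale//.
  rewrite EFinM.
  over.
rewrite ge0_integralZl//=.
- by rewrite integral_normal_pdf mule1.
- by apply/measurable_EFinP; exact: measurable_normal_pdf.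
- by move=> x _; rewrite lee_fin normal_pdf_ge0.
- by rewrite lee_fin invr_ge0 ltW.
Qed.

(* From [1 + u <= exp u], integrated: this is the derivative of [c^-1] at 1. *)
Lemma normal_pdf_scale_ge (c x : R) :
  normal_pdf 0 1 x * (1 - (c ^+ 2 - 1) / 2 * x ^+ 2) <= normal_pdf 0 1 (c * x).
Proof.
rewrite !normal_pdfE ?oner_eq0// /normal_fun !subr0 expr1n.
have -> : - (c * x) ^+ 2 / (1 *+ 2) = - x ^+ 2 / (1 *+ 2) + - ((c ^+ 2 - 1) / 2 * x ^+ 2) :> R by field.
rewrite expRD [leRHS]mulrA; apply: ler_wpM2l; last exact: expR_ge1Dx.
by rewrite mulr_ge0 ?normal_peak_ge0 ?expR_ge0.
Qed.

(** Kept as an extended real until its finiteness is established. *)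
Let m2 := (\int[std_normal R]_x (x ^+ 2)%:E)%E.

Let m2E : m2 = (\int[leb]_x (x ^+ 2 * normal_pdf 0 1 x)%:E)%E.
Proof.
rewrite /m2 ge0_integral_std_normal; last 2 first.
- by apply/measurable_EFinP; exact: measurable_funX.
- by move=> x; rewrite lee_fin sqr_ge0.
rewrite ge0_integral_normal_prob//.
- by apply/measurable_EFinP; exact: measurable_funX.
- by move=> x; rewrite lee_fin sqr_ge0.
Qed.

Let mx2 : measurable_fun setT (fun x : R => (x ^+ 2 * normal_pdf 0 1 x)%:E).
Proof.
apply/measurable_EFinP; apply: measurable_funM; last exact: measurable_normal_pdf.
exact: measurable_funX.
Qed.

Let x2_ge0 (x : R) : 0 <= x ^+ 2 * normal_pdf 0 1 x.
Proof. by rewrite mulr_ge0 ?sqr_ge0// normal_pdf_ge0. Qed.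

Let mpdf (c : R) : measurable_fun setT (fun x : R => (normal_pdf 0 1 (c * x))%:E).
Proof.
apply/measurable_EFinP; apply: measurableT_comp; first exact: measurable_normal_pdf.
exact: measurable_funM.
Qed.

Let mpdf1 : measurable_fun setT (fun x : R => (normal_pdf 0 1 x)%:E).
Proof. by apply/measurable_EFinP; exact: measurable_normal_pdf. Qed.

(** The inequality [normal_pdf_scale_ge] integrated, its terms arranged to keep every integrand
    nonnegative; this separates the cases [c < 1] and [c > 1]. *)
Let m2_ub (c : R) : 0 < c < 1 -> (((1 - c ^+ 2) / 2)%:E * m2 + 1 <= (c^-1)%:E)%E.
Proof.
move=> /andP[c0 c1].
have k0 : 0 <= (1 - c ^+ 2) / 2.
  by rewrite divr_ge0// subr_ge0 expr_le1// ltW.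
rewrite -(integral_normal_pdf 0 1) m2E -ge0_integralZl//; last first.
  by move=> x _; rewrite lee_fin.
rewrite -ge0_integralD//; last 3 first.
- by move=> x _; rewrite -EFinM lee_fin mulr_ge0.
- exact: measurable_funeM.
- by move=> x _; rewrite lee_fin normal_pdf_ge0.
rewrite -integral_normal_pdf_scale//; apply: ge0_le_integral => //.
- by move=> x _; rewrite -EFinM -EFinD lee_fin addr_ge0 ?normal_pdf_ge0// mulr_ge0.
- by apply: emeasurable_funD; [exact: measurable_funeM|exact: mpdf1].
- exact: mpdf.
move=> x _; rewrite -EFinM -EFinD lee_fin.
apply: le_trans (normal_pdf_scale_ge c x).
by rewrite le_eqVlt; apply/orP; left; apply/eqP; field.
Qed.

Let m2_lb (c : R) : 1 < c -> (1 <= ((c ^+ 2 - 1) / 2)%:E * m2 + (c^-1)%:E)%E.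
Proof.
move=> c1.
have c0 : 0 < c by exact: lt_trans c1.
have k0 : 0 <= (c ^+ 2 - 1) / 2.
  by rewrite divr_ge0// subr_ge0 expr_ge1// ltW.
rewrite -{1}(integral_normal_pdf 0 1) m2E -ge0_integralZl//; last first.
  by move=> x _; rewrite lee_fin.
rewrite -integral_normal_pdf_scale// -ge0_integralD//; last 4 first.
- by move=> x _; rewrite -EFinM lee_fin mulr_ge0.
- exact: measurable_funeM.
- by move=> x _; rewrite lee_fin normal_pdf_ge0.
- exact: mpdf.
apply: ge0_le_integral => //.
- by move=> x _; rewrite lee_fin normal_pdf_ge0.
- by apply: emeasurable_funD; [exact: measurable_funeM|exact: mpdf].
move=> x _; rewrite -EFinM -EFinD lee_fin -lerBlDl.
apply: le_trans (normal_pdf_scale_ge c x).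
by rewrite le_eqVlt; apply/orP; left; apply/eqP; field.
Qed.

(** The two sides of [m2_ub], and those of [m2_lb], would agree at [c = 1]; comparing slopes there,
    from the left and from the right, forces the value 1. The limit is replaced by one explicit [c]
    on each side. *)
Lemma std_normal_second_moment : (\int[std_normal R]_x (x ^+ 2)%:E = 1)%E.
Proof.
rewrite -/m2.
have m20 : (0 <= m2)%E by apply: integral_ge0 => x _; rewrite lee_fin sqr_ge0.
have m2fin : m2 \is a fin_num.
  rewrite ge0_fin_numE// ltey; apply/eqP => m2y.
  (* At [c = 1/2] the upper bound is the finite number 2, while the left side would be infinite. *)
  have := @m2_ub 2^-1; rewrite m2y gt0_muley ?lte_fin//; last lra.
  have h2 : 0 < (2^-1 : R) < 1 by rewrite invr_gt0 ltr0n invf_lt1 ?ltr1n ?ltr0n.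
  by move=> /(_ h2); rewrite addye// leye_eq.
rewrite -(fineK m2fin); congr EFin.
set m := fine m2.
have ub (c : R) : 0 < c < 1 -> ((1 - c ^+ 2) / 2 * m + 1) * c <= 1.
  move=> c01; have /andP[c0 _] := c01; have := m2_ub c01.
  by rewrite -(fineK m2fin) -EFinM -EFinD lee_fin -[c^-1]mul1r ler_pdivlMr.
have lb (c : R) : 1 < c -> c <= (c ^+ 2 - 1) / 2 * m * c + 1.
  move=> c1; have c0 : 0 < c by exact: lt_trans c1.
  have := m2_lb c1; rewrite -(fineK m2fin) -EFinM -EFinD lee_fin -(ler_pM2r c0).
  by rewrite mul1r mulrDl mulVf// gt_eqF.
have m0 : 0 <= m by exact: fine_ge0.
clear m20.
apply/eqP; rewrite eq_le; apply/andP; split.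
- rewrite leNgt; apply/negP => m1.
  (* With [c = 1 - e] and after division by [e], the bound [ub] reads
     [(m - 1) - 3/2 m e + m e^2 / 2 <= 0]; the choice [3 m e = m - 1] makes the left side
     positive. *)
  pose e := (m - 1) / (3 * m).
  have e0 : 0 < e by rewrite divr_gt0 ?subr_gt0// mulr_gt0// (lt_trans _ m1).
  have em : 3 * m * e = m - 1 by rewrite /e; field; rewrite gt_eqF// (lt_trans _ m1).
  have e1 : e < 2^-1 by nra.
  have : 1 - e > 0 by lra.
  have /ub : 0 < 1 - e < 1 by apply/andP; split; lra.
  move=> h c0.
  have : 0 < e * (m - 1 + m * e ^+ 2).
    by rewrite mulr_gt0// addr_gt0 ?subr_gt0// mulr_gt0 ?exprn_gt0// (lt_trans _ m1).
  have : e * (3 * m * e) = e * (m - 1) by rewrite em.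
  lra.
- rewrite leNgt; apply/negP => m1.
  (* With [c = 1 + e] the bound [lb] reads [1 <= (1 + e/2) (1 + e) m], which fails for
     [m = 1 - 4 e]. *)
  pose e := (1 - m) / 4.
  have e0 : 0 < e by rewrite /e; lra.
  have me : m = 1 - 4 * e by rewrite /e; lra.
  have : 1 + e > 0 by lra.
  have /lb : 1 < 1 + e by lra.
  rewrite me => h c0.
  have e2 : 0 < e ^+ 2 by rewrite exprn_gt0.
  have e3 : 0 < e ^+ 3 by rewrite exprn_gt0.
  have e4 : 0 < e ^+ 4 by rewrite exprn_gt0.
  lra.
Qed.

Lemma Rintegrable_std_normal_sqr : Rintegrable (std_normal R) (fun x => x ^+ 2).
Proof.
apply: RintegrableP; first exact: measurable_funX.
under eq_integral do rewrite ger0_norm ?sqr_ge0//.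
by rewrite std_normal_second_moment ltry.
Qed.

Lemma Rintegrable_std_normal_id : Rintegrable (std_normal R) (fun x => x).
Proof.
apply: (@le_Rintegrable _ R R (std_normal R) _ (fun x => 1 + x ^+ 2)) => //.
  by move=> x; rewrite ler_norml; apply/andP; split; nra.
apply: RintegrableD; first exact: Rintegrable_cst.
exact: Rintegrable_std_normal_sqr.
Qed.

Lemma std_normal_sqr : \int[std_normal R]_x (x ^+ 2) = 1.
Proof. by rewrite /Rintegral std_normal_second_moment. Qed.

(* Stability gives E (Z + Z')^2 = 2 E Z^2, whence (E Z)^2 = 0. *)
Lemma std_normal_mean : \int[std_normal R]_x x = 0.
Proof.
set N := std_normal R; set mu := \int[N]_x x.
have := @std_normal_stable R 1 1 (fun x => x ^+ 2) ltr01.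
have csqr : continuous (fun x : R => x ^+ 2) by exact: sqr_continuous.
move=> /(_ csqr (fun x => sqr_ge0 x)).
have inner x : (\int[N]_y ((1 * x + 1 * y) ^+ 2)%:E = (x ^+ 2 + 2 * mu * x + 1)%:E)%E.
  rewrite -EFin_Rintegral.
    congr EFin.
    transitivity (\int[N]_y (x ^+ 2 + (2 * x * y + y ^+ 2))).
      by apply: eq_Rintegral => y _; ring.
    rewrite RintegralD//; last 2 first.
    - exact: Rintegrable_cst.
    - apply: RintegrableD; last exact: Rintegrable_std_normal_sqr.
      by apply: RintegrableZ; exact: Rintegrable_std_normal_id.
    rewrite RintegralD//; last 2 first.
    - by apply: RintegrableZ; exact: Rintegrable_std_normal_id.
    - exact: Rintegrable_std_normal_sqr.
    rewrite RintegralZl//; last exact: Rintegrable_std_normal_id.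
    by rewrite Rintegral_probability_cst std_normal_sqr -/mu; ring.
  apply: (@le_Rintegrable _ R R N _ (fun y => 2 * x ^+ 2 + 2 * y ^+ 2)).
  - by apply: measurable_funX; apply: measurable_funD => //; exact: measurable_funM.
  - by move=> y; rewrite ger0_norm ?sqr_ge0//; have := sqr_ge0 (x - y); lra.
  - apply: RintegrableD; first exact: Rintegrable_cst.
    by apply: RintegrableZ; exact: Rintegrable_std_normal_sqr.
under eq_integral do rewrite inner.
rewrite -EFin_Rintegral; last first.
  apply: RintegrableD; last exact: Rintegrable_cst.
  apply: RintegrableD; first exact: Rintegrable_std_normal_sqr.
  by apply: RintegrableZ; exact: Rintegrable_std_normal_id.
rewrite RintegralD//; last 2 first.
- apply: RintegrableD; first exact: Rintegrable_std_normal_sqr.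
  by apply: RintegrableZ; exact: Rintegrable_std_normal_id.
- exact: Rintegrable_cst.
rewrite RintegralD//; last 2 first.
- exact: Rintegrable_std_normal_sqr.
- by apply: RintegrableZ; exact: Rintegrable_std_normal_id.
rewrite RintegralZl//; last exact: Rintegrable_std_normal_id.
rewrite Rintegral_probability_cst std_normal_sqr -/mu.
under eq_integral do rewrite exprMn sqr_sqrtr ?addr_ge0 ?sqr_ge0//.
rewrite expr1n.
rewrite -EFin_Rintegral; last by apply: RintegrableZ; exact: Rintegrable_std_normal_sqr.
rewrite RintegralZl//; last exact: Rintegrable_std_normal_sqr.
rewrite std_normal_sqr => -[] h.
have : mu ^+ 2 = 0 by lra.
by move=> /eqP; rewrite sqrf_eq0 => /eqP.
Qed.

End std_normal_moments.

Section std_binormal_moments.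
Context (R : realType).
Notation gam := (std_binormal R).
Notation N := (std_normal R).

Lemma ge0_integral_binormal_fst (f : R -> \bar R) : measurable_fun setT f ->
  (forall x, (0 <= f x)%E) ->
  (\int[gam]_z f z.1 = \int[N]_x f x)%E.
Proof.
move=> mf f0; rewrite ge0_integral_std_binormal//=; last exact: measurableT_comp.
apply: eq_integral => x _.
by rewrite integral_cst// -[X in (_ * X)%E]/(N setT) probability_setT mule1.
Qed.

Lemma ge0_integral_binormal_snd (f : R -> \bar R) : measurable_fun setT f ->
  (forall x, (0 <= f x)%E) ->
  (\int[gam]_z f z.2 = \int[N]_x f x)%E.
Proof.
move=> mf f0; rewrite ge0_integral_std_binormal//=; last exact: measurableT_comp.
rewrite integral_cst//.
by rewrite -[X in (_ * X)%E]/(N setT) probability_setT mule1.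
Qed.

Definition fst_mfun (z : R * R) : R := z.1.
Definition snd_mfun (z : R * R) : R := z.2.

HB.instance Definition _ := isMeasurableFun.Build _ _ _ _ fst_mfun
  (measurable_fst : measurable_fun setT fst_mfun).
HB.instance Definition _ := isMeasurableFun.Build _ _ _ _ snd_mfun
  (measurable_snd : measurable_fun setT snd_mfun).

Lemma std_binormal_independent : independent2 gam fst_mfun snd_mfun.
Proof.
move=> A B mA mB.
have -> : fst_mfun @^-1` A `&` snd_mfun @^-1` B = A `*` B by [].
have fstE C : measurable C -> gam (fst_mfun @^-1` C) = N C.
  move=> mC; have -> : fst_mfun @^-1` C = C `*` [set: R].
    by rewrite predeqE => -[x y]; split => [|[]].
  by rewrite /std_binormal/= product_measure1E// -[X in (_ * X)%E]/(N setT) probability_setT mule1.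
have sndE C : measurable C -> gam (snd_mfun @^-1` C) = N C.
  move=> mC; have -> : snd_mfun @^-1` C = [set: R] `*` C.
    by rewrite predeqE => -[x y]; split => [|[]].
  by rewrite /std_binormal/= product_measure1E// -[X in (X * _)%E]/(N setT) probability_setT mul1e.
by rewrite fstE// sndE// /std_binormal/= product_measure1E.
Qed.

Lemma Rintegrable_binormal_sqr1 : Rintegrable gam (fun z => z.1 ^+ 2).
Proof.
apply: RintegrableP; first exact: measurable_funX.
under eq_integral do rewrite ger0_norm ?sqr_ge0//.
rewrite (@ge0_integral_binormal_fst (fun x => (x ^+ 2)%:E)).
- by rewrite std_normal_second_moment ltry.
- by apply/measurable_EFinP; exact: measurable_funX.
- by move=> x; rewrite lee_fin sqr_ge0.
Qed.

Lemma Rintegrable_binormal_sqr2 : Rintegrable gam (fun z => z.2 ^+ 2).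
Proof.
apply: RintegrableP; first exact: measurable_funX.
under eq_integral do rewrite ger0_norm ?sqr_ge0//.
rewrite (@ge0_integral_binormal_snd (fun x => (x ^+ 2)%:E)).
- by rewrite std_normal_second_moment ltry.
- by apply/measurable_EFinP; exact: measurable_funX.
- by move=> x; rewrite lee_fin sqr_ge0.
Qed.

Lemma integral_binormal_fst (f : R -> \bar R) : measurable_fun setT f ->
  (\int[gam]_z f z.1 = \int[N]_x f x)%E.
Proof.
move=> mf; rewrite (@integralE _ _ _ gam _ (f \o fst)) [RHS]integralE.
rewrite (funepos_comp f fst) (funeneg_comp f fst); congr (_ - _)%E.
  by apply: (ge0_integral_binormal_fst (f := f^\+%E)) => //; exact: measurable_funepos.
by apply: (ge0_integral_binormal_fst (f := f^\-%E)) => //; exact: measurable_funeneg.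
Qed.

Lemma integral_binormal_snd (f : R -> \bar R) : measurable_fun setT f ->
  (\int[gam]_z f z.2 = \int[N]_x f x)%E.
Proof.
move=> mf; rewrite (@integralE _ _ _ gam _ (f \o snd)) [RHS]integralE.
rewrite (funepos_comp f snd) (funeneg_comp f snd); congr (_ - _)%E.
  by apply: (ge0_integral_binormal_snd (f := f^\+%E)) => //; exact: measurable_funepos.
by apply: (ge0_integral_binormal_snd (f := f^\-%E)) => //; exact: measurable_funeneg.
Qed.

Lemma Rintegral_binormal_fst (f : R -> R) : measurable_fun setT f ->
  \int[gam]_z f z.1 = \int[N]_x f x.
Proof.
by move=> mf; rewrite /Rintegral (integral_binormal_fst (f := EFin \o f))//; exact/measurable_EFinP.
Qed.

Lemma Rintegral_binormal_snd (f : R -> R) : measurable_fun setT f ->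
  \int[gam]_z f z.2 = \int[N]_x f x.
Proof.
by move=> mf; rewrite /Rintegral (integral_binormal_snd (f := EFin \o f))//; exact/measurable_EFinP.
Qed.

Lemma Rintegrable_binormal1 : Rintegrable gam (fun z => z.1).
Proof.
apply: (@le_Rintegrable _ _ R gam _ (fun z => 1 + z.1 ^+ 2)).
- exact: measurable_fst.
- by move=> x; rewrite ler_norml; apply/andP; split; nra.
by apply: RintegrableD; [exact: Rintegrable_cst|exact: Rintegrable_binormal_sqr1].
Qed.

Lemma Rintegrable_binormal2 : Rintegrable gam (fun z => z.2).
Proof.
apply: (@le_Rintegrable _ _ R gam _ (fun z => 1 + z.2 ^+ 2)).
- exact: measurable_snd.
- by move=> x; rewrite ler_norml; apply/andP; split; nra.
by apply: RintegrableD; [exact: Rintegrable_cst|exact: Rintegrable_binormal_sqr2].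
Qed.

Lemma binormal_mean1 : \int[gam]_z z.1 = 0.
Proof. by rewrite (Rintegral_binormal_fst (f := fun x => x))// std_normal_mean. Qed.

Lemma binormal_mean2 : \int[gam]_z z.2 = 0.
Proof. by rewrite (Rintegral_binormal_snd (f := fun x => x))// std_normal_mean. Qed.

Lemma binormal_sqr1 : \int[gam]_z (z.1 ^+ 2) = 1.
Proof.
by rewrite (Rintegral_binormal_fst (f := fun x => x ^+ 2)) ?std_normal_sqr.
Qed.

Lemma binormal_sqr2 : \int[gam]_z (z.2 ^+ 2) = 1.
Proof.
by rewrite (Rintegral_binormal_snd (f := fun x => x ^+ 2)) ?std_normal_sqr.
Qed.

Lemma binormal_cross : Rintegrable gam (fun z => z.1 * z.2) /\
  \int[gam]_z (z.1 * z.2) = 0.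
Proof.
have [i12 ->] := independent_RintegralM std_binormal_independent
  (f := fun x => x) (g := fun x => x) (@measurable_id _ R setT) (@measurable_id _ R setT)
  Rintegrable_binormal1 Rintegrable_binormal2.
by split=> //; rewrite binormal_mean1 mul0r.
Qed.

End std_binormal_moments.

(** * Central limit theorem for Cauchy kernels *)

Section cauchy_kernel.
Context (R : realType).
Implicit Types x y w : R.

Definition cker x : R := (1 + x ^+ 2)^-1.
Definition cker1 x : R := - (2 * x) / (1 + x ^+ 2) ^+ 2.
(* Half the second derivative of [cker]. *)
Definition cker2 x : R := (3 * x ^+ 2 - 1) / (1 + x ^+ 2) ^+ 3.

Let q_ge1 x : 1 <= 1 + x ^+ 2. Proof. by rewrite lerDl sqr_ge0. Qed.
Let q_gt0 x : 0 < 1 + x ^+ 2. Proof. exact: lt_le_trans (q_ge1 x). Qed.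
Let q_neq0 x : 1 + x ^+ 2 != 0. Proof. by rewrite gt_eqF. Qed.

Lemma cker_ge0 x : 0 <= cker x.
Proof. by rewrite invr_ge0 ltW. Qed.

Lemma cker_le1 x : cker x <= 1.
Proof. by rewrite invf_le1. Qed.

(** [n] is one coordinate of a plane vector of squared length [d], so [|n|] is at most the square
    root of [d], hence at most [d] because [d >= 1]. *)
Let ler_div1 (n m d : R) : 1 <= d -> n ^+ 2 + m ^+ 2 = d -> `|n / d| <= 1.
Proof.
move=> d1 nm; have d0 : 0 < d by exact: lt_le_trans d1.
rewrite normrM normfV (gtr0_norm d0) ler_pdivrMr// mul1r.
have n2 : n ^+ 2 <= d ^+ 2.
  apply: (@le_trans _ _ d); first by rewrite -nm lerDl sqr_ge0.
  by rewrite expr2 ler_peMl// ltW.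
by rewrite -ler_sqr ?nnegrE ?(ltW d0)// real_normK ?num_real.
Qed.

(* The three remainders are the imaginary parts of products of [(x + i)^-1] and
   [(x + w + i)^-1], which have modulus at most 1. *)
Lemma cker_bounds x w :
  [/\ `|cker (x + w) - cker x| <= `|w|,
      `|cker (x + w) - cker x - cker1 x * w| <= `|w| ^+ 2 &
      `|cker (x + w) - cker x - cker1 x * w - cker2 x * w ^+ 2| <= `|w| ^+ 3].
Proof.
have d1 n m : 1 <= (1 + x ^+ 2) ^+ n * (1 + (x + w) ^+ 2) ^+ m.
  by rewrite mulr_ege1// exprn_ege1.
have qx := q_neq0 x; have qxw := q_neq0 (x + w).
rewrite /cker /cker1 /cker2; split.
- rewrite (_ : _ - _ = w * (- (2 * x + w) / ((1 + x ^+ 2) ^+ 1 * (1 + (x + w) ^+ 2) ^+ 1))).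
    (* The witness is the real part of [(x + i) (x + w + i)], whose imaginary part is [2 x + w]. The
       next two witnesses are the real parts of [(x + i)^2 (x + w + i)] and
       [(x + i)^3 (x + w + i)]. *)
    rewrite normrM ler_piMr//; apply: (@ler_div1 _ (x * (x + w) - 1)) => //.
    by ring.
  by field; rewrite qxw qx.
- rewrite (_ : _ - _ - _ = w ^+ 2 * ((3 * x ^+ 2 + 2 * x * w - 1) / ((1 + x ^+ 2) ^+ 2 * (1 + (x + w) ^+ 2) ^+ 1))).
    rewrite normrM normrX ler_piMr ?exprn_ge0//.
    apply: (@ler_div1 _ ((x ^+ 2 - 1) * (x + w) - 2 * x)) => //.
    by ring.
  by field; rewrite qxw qx.
- rewrite (_ : _ - _ - _ - _ = w ^+ 3 * (- (x ^+ 3 - 3 * x + (x + w) * (3 * x ^+ 2 - 1)) / ((1 + x ^+ 2) ^+ 3 * (1 + (x + w) ^+ 2) ^+ 1))).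
    rewrite normrM normrX ler_piMr ?exprn_ge0//.
    apply: (@ler_div1 _ ((x ^+ 3 - 3 * x) * (x + w) - (3 * x ^+ 2 - 1))) => //.
    by ring.
  by field; rewrite qxw qx.
Qed.

Lemma cker1_le1 x : `|cker1 x| <= 1.
Proof.
apply: (@ler_div1 _ (x ^+ 2 - 1)); first by rewrite exprn_ege1.
by ring.
Qed.

Lemma cker2_le1 x : `|cker2 x| <= 1.
Proof.
apply: (@ler_div1 _ (x ^+ 3 - 3 * x)); first by rewrite exprn_ege1.
by ring.
Qed.

Lemma continuous_cker : continuous cker.
Proof.
move=> x; apply: cvgV => //; apply: cvgD; first exact: cvg_cst.
exact: sqr_continuous.
Qed.

Definition cker_lin x y w1 w2 : R := cker1 x * cker y * w1 + cker x * cker1 y * w2.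

(** The three products are separate arguments, so that the same form applies to increments and to
    their second moments. *)
Definition cker_quad x y (c11 c12 c22 : R) : R :=
  cker2 x * cker y * c11 + cker1 x * cker1 y * c12 + cker x * cker2 y * c22.

(** Two bounds in one: the quadratic one, for large [s], asks for second moments only; the cubic
    one, for small [s], makes the remainder negligible under scaling. *)
Lemma cker_expansion x y w1 w2 (s := `|w1| + `|w2|) :
  `|cker (x + w1) * cker (y + w2) - cker x * cker y - cker_lin x y w1 w2
    - cker_quad x y (w1 ^+ 2) (w1 * w2) (w2 ^+ 2)| <= 2 * (s ^+ 2 * Num.min 1 s).
Proof.
have [b1 b1' b1''] := cker_bounds x w1; have [b2 b2' b2''] := cker_bounds y w2.
have := cker_le1 x; have := cker_le1 y; have := cker_ge0 x; have := cker_ge0 y.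
have := cker1_le1 x; have := cker1_le1 y; have := cker2_le1 x; have := cker2_le1 y.
move: b1 b1' b1'' b2 b2' b2''; rewrite /cker_lin /cker_quad.
move: (cker x) (cker y) (cker1 x) (cker1 y) (cker2 x) (cker2 y) => k l k1 l1 k2 l2.
move: (cker (x + w1)) (cker (y + w2)) => kw lw.
rewrite /s; set a : R := `|w1|; set b : R := `|w2|.
have a0 : 0 <= a by exact: normr_ge0.
have b0 : 0 <= b by exact: normr_ge0.
move=> D1 E1 F1 D2 E2 F2 l2b k2b l1b k1b l0 k0 lb kb.
set D := kw - k in D1 E1 F1; set D' := lw - l in D2 E2 F2.
have nk : `|k| <= 1 by rewrite ger0_norm.
have nl : `|l| <= 1 by rewrite ger0_norm.
(* Each one-variable remainder is multiplied by the value of the other factor; what is left is the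
   defect of the cross term. *)
have remE : kw * lw - k * l - (k1 * l * w1 + k * l1 * w2) -
   (k2 * l * w1 ^+ 2 + k1 * l1 * (w1 * w2) + k * l2 * w2 ^+ 2) =
   k * (D' - l1 * w2 - l2 * w2 ^+ 2) + l * (D - k1 * w1 - k2 * w1 ^+ 2) +
   (D * D' - k1 * l1 * (w1 * w2)) by rewrite /D /D'; ring.
rewrite remE.
have cubic : `|D * D' - k1 * l1 * (w1 * w2)| <= a * b ^+ 2 + a ^+ 2 * b.
  rewrite (_ : _ - _ = D * (D' - l1 * w2) + (D - k1 * w1) * (l1 * w2)); last by ring.
  rewrite (le_trans (ler_normD _ _))// !normrM lerD//; first exact: ler_pM.
  apply: ler_pM => //.
  by rewrite -[leRHS]mul1r ler_wpM2r.
have quadr : `|D * D' - k1 * l1 * (w1 * w2)| <= a * b + a * b.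
  rewrite (le_trans (ler_normB _ _))// !normrM lerD//; first exact: ler_pM.
  rewrite -[leRHS]mul1r; apply: ler_pM => //; rewrite ?mulr_ge0//.
  by rewrite mulr_ile1.
have F1' : `|D - k1 * w1 - k2 * w1 ^+ 2| <= a ^+ 2 + a ^+ 2.
  rewrite (le_trans (ler_normB _ _))// lerD// normrM normrX.
  by rewrite -[leRHS]mul1r ler_wpM2r// exprn_ge0.
have F2' : `|D' - l1 * w2 - l2 * w2 ^+ 2| <= b ^+ 2 + b ^+ 2.
  rewrite (le_trans (ler_normB _ _))// lerD// normrM normrX.
  by rewrite -[leRHS]mul1r ler_wpM2r// exprn_ge0.
have tri (u v : R) : `|D' - l1 * w2 - l2 * w2 ^+ 2| <= u ->
    `|D - k1 * w1 - k2 * w1 ^+ 2| <= v ->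
    `|k * (D' - l1 * w2 - l2 * w2 ^+ 2) + l * (D - k1 * w1 - k2 * w1 ^+ 2) +
   (D * D' - k1 * l1 * (w1 * w2))| <= u + v + `|D * D' - k1 * l1 * (w1 * w2)|.
  move=> hu hv; rewrite (le_trans (ler_normD _ _))// lerD2r.
  rewrite (le_trans (ler_normD _ _))// lerD// normrM -[leRHS]mul1r ler_pM//.
have F1'' := F1; have F2'' := F2.
have [s1|s1] := leP 1 (a + b).
- rewrite mulr1 (le_trans (tri _ _ F2' F1'))//.
  apply: (le_trans (lerD (lexx _) quadr)); nra.
- rewrite (le_trans (tri _ _ F2'' F1''))//.
  apply: (le_trans (lerD (lexx _) cubic)).
  have : 0 <= a * b ^+ 2 by rewrite mulr_ge0 ?exprn_ge0.
  have : 0 <= a ^+ 2 * b by rewrite mulr_ge0 ?exprn_ge0.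
  have : 0 <= a ^+ 3 by rewrite exprn_ge0.
  have : 0 <= b ^+ 3 by rewrite exprn_ge0.
  lra.
Qed.

End cauchy_kernel.

Section real_dominated_convergence.
Context d (T : measurableType d) (R : realType) (m : {measure set T -> \bar R}).

Lemma Rintegral_dominated_cvg (f : nat -> T -> R) (h g : T -> R) :
  (forall n, measurable_fun setT (f n)) ->
  (forall x, f n x @[n --> \oo] --> h x) -> Rintegrable m g ->
  (forall n x, `|f n x| <= g x) ->
  \int[m]_x f n x @[n --> \oo] --> \int[m]_x h x.
Proof.
move=> mf fh ig fg.
have mh : measurable_fun setT h by exact: (measurable_fun_cvg mf).
have [] := @dominated_convergence _ T R m setT measurableT
  (fun n => EFin \o f n) (EFin \o h) (EFin \o g).
- by move=> n; exact/measurable_EFinP.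
- exact/measurable_EFinP.
- by apply: aeW => w _; apply: cvg_EFin; [exact: nearW|exact: fh].
- exact: ig.
- by apply: aeW => w n _; rewrite /= lee_fin.
by move=> ih _ cv; apply: fine_cvg; rewrite EFin_Rintegral.
Qed.

End real_dominated_convergence.

Section one_step.
Context d (T : measurableType d) (R : realType) (P : probability T R).
Variables (U1 U2 : T -> R) (c11 c12 c22 : R).
Hypotheses (iU1 : Rintegrable P U1) (iU2 : Rintegrable P U2).
Hypotheses (iU11 : Rintegrable P (fun w => U1 w ^+ 2))
  (iU22 : Rintegrable P (fun w => U2 w ^+ 2)).
Hypotheses (EU1 : \int[P]_w U1 w = 0) (EU2 : \int[P]_w U2 w = 0).
Hypotheses (EU11 : \int[P]_w (U1 w ^+ 2) = c11)
  (EU12 : \int[P]_w (U1 w * U2 w) = c12) (EU22 : \int[P]_w (U2 w ^+ 2) = c22).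

Let mU1 := Rintegrable_measurable iU1.
Let mU2 := Rintegrable_measurable iU2.

(** A smooth variant of Lindeberg's truncated second moment: the weight [Num.min 1 _] is bounded by
    1 and tends to 0 with [t] at each point. *)
Definition lindeberg_tail (t : R) : R :=
  \int[P]_w ((`|U1 w| + `|U2 w|) ^+ 2 * Num.min 1 (t * (`|U1 w| + `|U2 w|))).

Let S w : R := `|U1 w| + `|U2 w|.

Let mS : measurable_fun setT S.
Proof. by apply: measurable_funD; exact: measurableT_comp. Qed.

Let iS2 : Rintegrable P (fun w => S w ^+ 2).
Proof.
apply: (@le_Rintegrable _ _ _ _ _ (fun w => 2 * U1 w ^+ 2 + 2 * U2 w ^+ 2)).
- exact: measurable_funX.
- move=> w; rewrite ger0_norm ?sqr_ge0// /S.
  rewrite -(real_normK (num_real (U1 w))) -(real_normK (num_real (U2 w))).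
  have := sqr_ge0 (`|U1 w| - `|U2 w|); lra.
- by apply: RintegrableD; exact: RintegrableZ.
Qed.

Let iU12 : Rintegrable P (fun w => U1 w * U2 w).
Proof.
apply: (@le_Rintegrable _ _ _ _ _ (fun w => S w ^+ 2)) => //.
- exact: measurable_funM.
- move=> w; rewrite normrM /S.
  have := normr_ge0 (U1 w); have := normr_ge0 (U2 w); nra.
Qed.

Let m_tail (t : R) : measurable_fun setT (fun w => S w ^+ 2 * Num.min 1 (t * S w)).
Proof.
apply: measurable_funM; first exact: measurable_funX.
by apply: measurable_minr => //; exact: measurable_funM.
Qed.

Let tail_ge0 (t : R) w : 0 <= t -> 0 <= S w ^+ 2 * Num.min 1 (t * S w).
Proof.
by move=> t0; rewrite mulr_ge0 ?sqr_ge0// le_min ler01/= mulr_ge0// addr_ge0.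
Qed.

Let tail_le (t : R) w : 0 <= t -> S w ^+ 2 * Num.min 1 (t * S w) <= S w ^+ 2.
Proof. by move=> t0; rewrite ler_piMr ?sqr_ge0// ge_min lexx. Qed.

Let i_tail (t : R) : 0 <= t -> Rintegrable P (fun w => S w ^+ 2 * Num.min 1 (t * S w)).
Proof.
move=> t0; apply: (@le_Rintegrable _ _ _ _ _ (fun w => S w ^+ 2)) => // w.
by rewrite ger0_norm ?tail_ge0// tail_le.
Qed.

Let mK x y t : measurable_fun setT (fun w => cker (x + t * U1 w) * cker (y + t * U2 w)).
Proof.
by apply: measurable_funM; apply: measurableT_comp;
  [apply: continuous_measurable_fun; exact: continuous_cker
  |apply: measurable_funD => //; exact: measurable_funM
  |apply: continuous_measurable_fun; exact: continuous_cker
  |apply: measurable_funD => //; exact: measurable_funM].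
Qed.

Lemma cker2_ge0 (x y : R) : 0 <= cker x * cker y.
Proof. by rewrite mulr_ge0// cker_ge0. Qed.

Lemma cker2_norm_le1 (x y : R) : `|cker x * cker y| <= 1.
Proof. by rewrite ger0_norm ?cker2_ge0// mulr_ile1 ?cker_ge0 ?cker_le1. Qed.

(** The linear term of the expansion has mean 0 and the quadratic one depends on the law through
    second moments only, so the law enters otherwise through its tail alone. *)
Lemma cker_one_step (x y t : R) : 0 <= t ->
  `|\int[P]_w (cker (x + t * U1 w) * cker (y + t * U2 w)) - cker x * cker y
    - t ^+ 2 * cker_quad x y c11 c12 c22| <= 2 * t ^+ 2 * lindeberg_tail t.
Proof.
move=> t0.
pose L w := cker_lin x y (U1 w) (U2 w).
pose Q w := cker_quad x y (U1 w ^+ 2) (U1 w * U2 w) (U2 w ^+ 2).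
have iK : Rintegrable P (fun w => cker (x + t * U1 w) * cker (y + t * U2 w)).
  by apply: (@bounded_Rintegrable _ _ _ P _ 1) => // w; exact: cker2_norm_le1.
have iL : Rintegrable P L.
  by apply: RintegrableD; exact: RintegrableZ.
have iQ : Rintegrable P Q.
  by apply: RintegrableD; [apply: RintegrableD|]; exact: RintegrableZ.
have EL : \int[P]_w L w = 0.
  rewrite RintegralD//; [|exact: RintegrableZ|exact: RintegrableZ].
  by rewrite !RintegralZl// EU1 EU2 !mulr0 addr0.
have EQ : \int[P]_w Q w = cker_quad x y c11 c12 c22.
  rewrite RintegralD//; [|apply: RintegrableD; exact: RintegrableZ|exact: RintegrableZ].
  rewrite RintegralD//; [|exact: RintegrableZ|exact: RintegrableZ].
  by rewrite !RintegralZl// EU11 EU12 EU22.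
pose rem w := cker (x + t * U1 w) * cker (y + t * U2 w) - cker x * cker y
  - t * L w - t ^+ 2 * Q w.
have irem1 : Rintegrable P (fun w => cker (x + t * U1 w) * cker (y + t * U2 w) - cker x * cker y).
  by apply: RintegrableB => //; exact: Rintegrable_cst.
have irem2 : Rintegrable P (fun w => cker (x + t * U1 w) * cker (y + t * U2 w) - cker x * cker y - t * L w).
  by apply: RintegrableB => //; exact: RintegrableZ.
have irem : Rintegrable P rem.
  by apply: RintegrableB => //; exact: RintegrableZ.
have -> : \int[P]_w (cker (x + t * U1 w) * cker (y + t * U2 w)) - cker x * cker y
    - t ^+ 2 * cker_quad x y c11 c12 c22 = \int[P]_w rem w.
  rewrite /rem RintegralB//; last exact: RintegrableZ.
  rewrite RintegralB//; last exact: RintegrableZ.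
  rewrite RintegralB//; last exact: Rintegrable_cst.
  rewrite (RintegralZl t measurableT iL) (RintegralZl (t ^+ 2) measurableT iQ).
  by rewrite EL EQ mulr0 subr0 Rintegral_probability_cst.
rewrite (le_trans (le_normr_Rintegral _ irem))//.
rewrite /lindeberg_tail -RintegralZl//; last exact: i_tail.
apply: le_Rintegral => //; first exact: (integrable_norm irem).
  by apply: RintegrableZ; exact: i_tail.
move=> w _; rewrite /rem.
have := cker_expansion x y (t * U1 w) (t * U2 w).
rewrite !normrM (ger0_norm t0) -mulrDr -/(S w).
have -> : cker_lin x y (t * U1 w) (t * U2 w) = t * L w.
  by rewrite /L /cker_lin; ring.
have -> : cker_quad x y ((t * U1 w) ^+ 2) (t * U1 w * (t * U2 w)) ((t * U2 w) ^+ 2) = t ^+ 2 * Q w.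
  by rewrite /Q /cker_quad; ring.
by move=> /le_trans; apply; rewrite exprMn !mulrA.
Qed.

Lemma cvg_sqrt_natV : (Num.sqrt (n%:R : R))^-1 @[n --> \oo] --> (0 : R).
Proof.
apply/cvgr0Pnorm_lt => e e0.
near=> n.
have n0 : e ^- 2 < n%:R by near: n; exact: nbhs_infty_gtr.
have e2 : 0 < e ^- 2 by rewrite invr_gt0 exprn_gt0.
have s0 : 0 < Num.sqrt (n%:R : R) by rewrite sqrtr_gt0 (lt_trans e2).
rewrite ger0_norm ?invr_ge0 ?sqrtr_ge0// invf_plt ?posrE//.
rewrite -(gtr0_norm (_ : 0 < e^-1)) ?invr_gt0// -sqrtr_sqr ltr_sqrt.
  by rewrite exprVn.
by rewrite (lt_trans e2).
Unshelve. all: by end_near. Qed.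

(** Dominated convergence with the integrable bound [S ^+ 2]; no moment beyond the second is
    required. *)
Lemma cvg_lindeberg_tail : lindeberg_tail (Num.sqrt n%:R)^-1 @[n --> \oo] --> 0.
Proof.
pose g n w := S w ^+ 2 * Num.min 1 ((Num.sqrt (n%:R : R))^-1 * S w).
have t0 n : 0 <= (Num.sqrt (n%:R : R))^-1 by rewrite invr_ge0 sqrtr_ge0.
rewrite -[X in _ --> X](Rintegral_probability_cst P).
apply: (@Rintegral_dominated_cvg _ _ _ P g (cst 0) (fun w => S w ^+ 2)) => //.
- by move=> n; exact: m_tail.
- move=> w; rewrite -[X in _ --> X](mulr0 (S w ^+ 2)); apply: cvgM; first exact: cvg_cst.
  apply: (@squeeze_cvgr _ _ _ _ (cst 0)
    (fun n => (Num.sqrt (n%:R : R))^-1 * S w)).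
  - apply: nearW => n /=; rewrite ge_min lexx orbT andbT le_min ler01/=.
    by rewrite mulr_ge0// addr_ge0.
  - exact: cvg_cst.
  - rewrite -[X in _ --> X](mul0r (S w)); apply: cvgM; last exact: cvg_cst.
    exact: cvg_sqrt_natV.
- by move=> n w; rewrite ger0_norm ?tail_ge0// tail_le.
Qed.

End one_step.

Section same_law.
Context d d1 (T : measurableType d) (S : measurableType d1) (R : realType)
  (P : probability T R) (Z W : {mfun T >-> S}).
Hypothesis lawZ : same_law P Z W.
Local Open Scope ereal_scope.

Lemma same_law_integral (f : S -> \bar R) : measurable_fun setT f ->
  \int[P]_w f (Z w) = \int[P]_w f (W w).
Proof.
move=> mf; rewrite -!integral_distributionE//; apply: eq_measure_integral.
by move=> A mA _; exact: lawZ.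
Qed.

Lemma same_law_Rintegral (f : S -> R) : measurable_fun setT f ->
  (\int[P]_w f (Z w) = \int[P]_w f (W w))%R.
Proof.
move=> mf; rewrite /Rintegral (same_law_integral (f := EFin \o f))//.
exact/measurable_EFinP.
Qed.

Lemma same_law_Rintegrable (f : S -> R) : measurable_fun setT f ->
  Rintegrable P (f \o W) -> Rintegrable P (f \o Z).
Proof.
move=> mf fi; apply: RintegrableP; first exact: measurableT_comp.
rewrite (same_law_integral (f := fun s => `|f s|%:E)).
  by case/integrableP : fi.
by apply/measurable_EFinP/measurableT_comp.
Qed.

End same_law.

(** * Lindeberg's replacement method *)

Section lindeberg.
Context d d1 (T : measurableType d) (S : measurableType d1) (R : realType)
  (P : probability T R) (Z : nat -> {mfun T >-> S}) (W : {mfun T >-> S}).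
Hypothesis indZ : independent_seq P Z.
Hypothesis lawZ : forall i, same_law P (Z i) W.
Variables (xi1 xi2 : S -> R).
Hypotheses (mxi1 : measurable_fun setT xi1) (mxi2 : measurable_fun setT xi2).
Variable gam : probability (R * R)%type R.
Hypothesis gam_stable : forall (s t : R) (G : R * R -> R), 0 < t ->
  measurable_fun setT G -> (forall z, 0 <= G z) ->
  (forall x, continuous (fun y => G (x, y))) ->
  (forall y, continuous (fun x => G (x, y))) ->
  (\int[gam]_z \int[gam]_z' (G (s * z.1 + t * z'.1, s * z.2 + t * z'.2))%:E =
   \int[gam]_z (G (Num.sqrt (s ^+ 2 + t ^+ 2) * z.1,
                   Num.sqrt (s ^+ 2 + t ^+ 2) * z.2))%:E)%E.
Variables a11 a12 a21 a22 : R.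

Let G1 (z : R * R) : R := a11 * z.1 + a12 * z.2.
Let G2 (z : R * R) : R := a21 * z.1 + a22 * z.2.
Let S1 (j : nat) (w : T) : R := \sum_(i < j) xi1 (Z i w).
Let S2 (j : nat) (w : T) : R := \sum_(i < j) xi2 (Z i w).
Let K (a b : R) : R := cker a * cker b.

Let mG1 : measurable_fun setT G1.
Proof. by apply: measurable_funD; apply: measurable_funM. Qed.

Let mG2 : measurable_fun setT G2.
Proof. by apply: measurable_funD; apply: measurable_funM. Qed.

Let mS1 j : measurable_fun setT (S1 j).
Proof. by apply: measurable_sum => i; exact: measurableT_comp. Qed.

Let mS2 j : measurable_fun setT (S2 j).
Proof. by apply: measurable_sum => i; exact: measurableT_comp. Qed.

Let mcker : measurable_fun setT (@cker R).
Proof. by apply: continuous_measurable_fun; exact: continuous_cker. Qed.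

Let mK dd (TT : measurableType dd) (u v : TT -> R) : measurable_fun setT u ->
  measurable_fun setT v -> measurable_fun setT (fun w => (K (u w) (v w))%:E).
Proof.
by move=> mu mv; apply/measurable_EFinP/measurable_funM; exact: measurableT_comp.
Qed.

Let mlin dd (TT : measurableType dd) (x t s : R) (u v : TT -> R) :
  measurable_fun setT u -> measurable_fun setT v ->
  measurable_fun setT (fun w => x + t * u w + s * v w).
Proof.
move=> mu mv; apply: measurable_funD; last exact: measurable_funM.
by apply: measurable_funD => //; exact: measurable_funM.
Qed.

Let K0 a b : (0 <= (K a b)%:E)%E. Proof. by rewrite lee_fin; exact: cker2_ge0. Qed.

Let K0R a b : 0 <= K a b. Proof. exact: cker2_ge0. Qed.

(** The last summand, the term [Z j], is independent of the first [j] ones: it is integrated over a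
    separate variable [w'], under the law of [W]. *)
Let replace_sample (x y t s : R) j :
  (\int[P]_w \int[gam]_z (K (x + t * S1 j.+1 w + s * G1 z) (y + t * S2 j.+1 w + s * G2 z))%:E =
   \int[P]_w \int[gam]_z \int[P]_w' (K (x + t * S1 j w + s * G1 z + t * xi1 (W w'))
                                      (y + t * S2 j w + s * G2 z + t * xi2 (W w')))%:E)%E.
Proof.
rewrite (fubini_tonelli (m1 := P) (m2 := gam) (fun u : T * (R * R) =>
  (K (x + t * S1 j.+1 u.1 + s * G1 u.2) (y + t * S2 j.+1 u.1 + s * G2 u.2))%:E)); last 2 first.
- by apply: mK; apply: mlin; apply: measurableT_comp.
- by move=> u; exact: K0.
rewrite [RHS](fubini_tonelli (m1 := P) (m2 := gam) (fun u : T * (R * R) =>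
  \int[P]_w' (K (x + t * S1 j u.1 + s * G1 u.2 + t * xi1 (W w'))
    (y + t * S2 j u.1 + s * G2 u.2 + t * xi2 (W w')))%:E)%E); last 2 first.
- apply: (measurable_fun_fubini_tonelli_F (m2 := P) (fun u : (T * (R * R)) * T =>
    (K (x + t * S1 j u.1.1 + s * G1 u.1.2 + t * xi1 (W u.2))
    (y + t * S2 j u.1.1 + s * G2 u.1.2 + t * xi2 (W u.2)))%:E)).
    apply: mK; apply: measurable_funD.
    + by apply: mlin; apply: measurableT_comp => //; apply: measurableT_comp.
    + by apply: measurable_funM => //; apply: measurableT_comp => //; apply: measurableT_comp.
    + by apply: mlin; apply: measurableT_comp => //; apply: measurableT_comp.
    + by apply: measurable_funM => //; apply: measurableT_comp => //; apply: measurableT_comp.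
  by move=> u; exact: K0.
- by move=> u; apply: integral_ge0 => w _; exact: K0.
apply: eq_integral => z _ /=.
pose f (u : S * sigma_off Z j) := (K (x + t * S1 j u.2 + s * G1 z + t * xi1 u.1)
   (y + t * S2 j u.2 + s * G2 z + t * xi2 u.1))%:E.
transitivity (\int[P]_w f (Z j w, @off_id _ _ _ _ Z j w))%E.
  apply: eq_integral => w _; rewrite /f /S1 /S2 !big_ord_recr/=.
  by congr ((K _ _)%:E); ring.
have moff (xi : S -> R) : measurable_fun setT xi ->
    measurable_fun [set: sigma_off Z j] (fun w => \sum_(i < j) xi (Z i w)).
  move=> mxi; apply: measurable_sum => i; apply: measurableT_comp => //.
  by apply: measurable_off; rewrite neq_ltn ltn_ord.
rewrite (ge0_independent_integral (independent_off (k := j) indZ)); last 2 first.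
- apply: mK; apply: measurable_funD.
  + apply: measurable_funD => //; apply: measurable_funD => //.
    by apply: measurable_funM => //; exact: measurableT_comp (moff _ mxi1) _.
  + by apply: measurable_funM => //; exact: measurableT_comp.
  + apply: measurable_funD => //; apply: measurable_funD => //.
    by apply: measurable_funM => //; exact: measurableT_comp (moff _ mxi2) _.
  + by apply: measurable_funM => //; exact: measurableT_comp.
- by move=> u; exact: K0.
apply: eq_integral => w _; rewrite /f /=.
apply: (same_law_integral (lawZ j) (f := fun v => (K (x + t * S1 j w + s * G1 z + t * xi1 v)
   (y + t * S2 j w + s * G2 z + t * xi2 v))%:E)).
by apply: mK; apply: measurable_funD => //; exact: measurable_funM.
Qed.

(** Stability writes a Gaussian vector of scale [sqrt (s^2 + t^2)] as a sum of independent ones of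
    scales [s] and [t]; the second will be exchanged with a sample term. *)
Let split_gaussian (x y t s : R) j : 0 < t ->
  (\int[P]_w \int[gam]_z (K (x + t * S1 j w + Num.sqrt (s ^+ 2 + t ^+ 2) * G1 z)
                           (y + t * S2 j w + Num.sqrt (s ^+ 2 + t ^+ 2) * G2 z))%:E =
   \int[P]_w \int[gam]_z \int[gam]_z' (K (x + t * S1 j w + s * G1 z + t * G1 z')
                                      (y + t * S2 j w + s * G2 z + t * G2 z'))%:E)%E.
Proof.
move=> t0; apply: eq_integral => w _.
pose F z := K (x + t * S1 j w + G1 z) (y + t * S2 j w + G2 z).
transitivity (\int[gam]_z (F (Num.sqrt (s ^+ 2 + t ^+ 2) * z.1, Num.sqrt (s ^+ 2 + t ^+ 2) * z.2))%:E)%E.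
  by apply: eq_integral => z _; congr ((K _ _)%:E); rewrite /G1 /G2 /=; ring.
have cck (c e : R) : continuous (fun v => cker (c + e * v)).
  move=> v; apply: (@continuous_comp _ _ _ (fun v => c + e * v) (@cker R)).
    apply: cvgD; first exact: cvg_cst.
    by apply: cvgM; [exact: cvg_cst|exact: cvg_id].
  exact: continuous_cker.
rewrite -gam_stable; first last.
- move=> v; rewrite (_ : (fun u => F (u, v)) = (fun u =>
    cker (x + t * S1 j w + a12 * v + a11 * u) *
    cker (y + t * S2 j w + a22 * v + a21 * u))).
    by move=> u; apply: cvgM; exact: cck.
  by apply/funext => u; rewrite /F /K /G1 /G2/=; congr (cker _ * cker _); ring.
- move=> u; rewrite (_ : (fun v => F (u, v)) = (fun v =>
    cker (x + t * S1 j w + a11 * u + a12 * v) *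
    cker (y + t * S2 j w + a21 * u + a22 * v))).
    by move=> v; apply: cvgM; exact: cck.
  by apply/funext => v; rewrite /F /K /G1 /G2/=; congr (cker _ * cker _); ring.
- by move=> z; exact: K0R.
- by apply/measurable_EFinP; apply: mK; apply: measurable_funD.
- exact: t0.
apply: eq_integral => z _; apply: eq_integral => z' _; congr ((K _ _)%:E);
  by rewrite /G1 /G2 /=; ring.
Qed.

Hypotheses (ixi11 : Rintegrable P (fun w => xi1 (W w) ^+ 2))
  (ixi22 : Rintegrable P (fun w => xi2 (W w) ^+ 2)).
Hypotheses (ixi1 : Rintegrable P (fun w => xi1 (W w)))
  (ixi2 : Rintegrable P (fun w => xi2 (W w))).
Hypotheses (Exi1 : \int[P]_w xi1 (W w) = 0) (Exi2 : \int[P]_w xi2 (W w) = 0).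
Hypotheses (iG1 : Rintegrable gam G1) (iG2 : Rintegrable gam G2)
  (iG11 : Rintegrable gam (fun z => G1 z ^+ 2))
  (iG22 : Rintegrable gam (fun z => G2 z ^+ 2))
  (EG1 : \int[gam]_z G1 z = 0) (EG2 : \int[gam]_z G2 z = 0).
Hypotheses (cov11 : \int[P]_w (xi1 (W w) ^+ 2) = \int[gam]_z (G1 z ^+ 2))
  (cov12 : \int[P]_w (xi1 (W w) * xi2 (W w)) = \int[gam]_z (G1 z * G2 z))
  (cov22 : \int[P]_w (xi2 (W w) ^+ 2) = \int[gam]_z (G2 z ^+ 2)).

Let tail (t : R) : R := lindeberg_tail P (fun w => xi1 (W w)) (fun w => xi2 (W w)) t
  + lindeberg_tail gam G1 G2 t.

(** Both laws are centered with the same second moments, so the expansions cancel up to order two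
    and only the two remainders are left. *)
Let swap_step (x y t : R) : 0 <= t ->
  `|\int[P]_w K (x + t * xi1 (W w)) (y + t * xi2 (W w)) -
    \int[gam]_z K (x + t * G1 z) (y + t * G2 z)| <= 2 * t ^+ 2 * tail t.
Proof.
move=> t0.
have := cker_one_step ixi1 ixi2 ixi11 ixi22 Exi1 Exi2 cov11 cov12 cov22 x y t0.
have := cker_one_step iG1 iG2 iG11 iG22 EG1 EG2 erefl erefl erefl x y t0.
rewrite -!/(K _ _) => h1 h2.
rewrite [leLHS](_ : _ = `|(\int[P]_w K (x + t * xi1 (W w)) (y + t * xi2 (W w)) - K x y
   - t ^+ 2 * cker_quad x y (\int[gam]_z (G1 z ^+ 2)) (\int[gam]_z (G1 z * G2 z))
     (\int[gam]_z (G2 z ^+ 2))) - (\int[gam]_z K (x + t * G1 z) (y + t * G2 z) - K x y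
   - t ^+ 2 * cker_quad x y (\int[gam]_z (G1 z ^+ 2)) (\int[gam]_z (G1 z * G2 z))
     (\int[gam]_z (G2 z ^+ 2)))|); last by congr (`|_|); ring.
by rewrite /tail [leRHS]mulrDr (le_trans (ler_normB _ _))// lerD.
Qed.

Let PG : probability (T * (R * R))%type R := [the probability _ _ of (P \x gam)%E].

Let PGE (f : T * (R * R) -> \bar R) : measurable_fun setT f ->
  (forall u, (0 <= f u)%E) ->
  (\int[PG]_u f u = \int[P]_w \int[gam]_z f (w, z))%E.
Proof. by move=> mf f0; exact: fubini_tonelli1. Qed.

(** [j] sample terms together with one Gaussian vector of scale [s], which stands for all the
    Gaussian terms of this stage. *)
Let hybrid_fun (x y t s : R) j (u : T * (R * R)) : R :=
  K (x + t * S1 j u.1 + s * G1 u.2) (y + t * S2 j u.1 + s * G2 u.2).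

(** Here, and in [gauss_fun], only the increment under exchange is integrated out; [u] freezes the
    rest, so [swap_step] applies at every [u]. *)
Let sample_fun (x y t s : R) j (u : T * (R * R)) : R :=
  \int[P]_w' K (x + t * S1 j u.1 + s * G1 u.2 + t * xi1 (W w'))
              (y + t * S2 j u.1 + s * G2 u.2 + t * xi2 (W w')).

Let gauss_fun (x y t s : R) j (u : T * (R * R)) : R :=
  \int[gam]_z' K (x + t * S1 j u.1 + s * G1 u.2 + t * G1 z')
              (y + t * S2 j u.1 + s * G2 u.2 + t * G2 z').

Let iK dd (TT : measurableType dd) (Q : probability TT R) (u v : TT -> R) :
  measurable_fun setT u -> measurable_fun setT v ->
  Rintegrable Q (fun w => K (u w) (v w)).
Proof.
move=> mu mv; apply: (@bounded_Rintegrable _ _ _ Q _ 1).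
  by apply/measurable_EFinP; exact: mK.
by move=> w; exact: cker2_norm_le1.
Qed.

Let mbase (x y t s : R) j dd (TT : measurableType dd) (p : TT -> T * (R * R)) (v1 v2 : TT -> R) :
  measurable_fun setT p -> measurable_fun setT v1 -> measurable_fun setT v2 ->
  measurable_fun setT (fun u => (K (x + t * S1 j (p u).1 + s * G1 (p u).2 + t * v1 u)
    (y + t * S2 j (p u).1 + s * G2 (p u).2 + t * v2 u))%:E).
Proof.
move=> mp mv1 mv2; apply: mK; (apply: measurable_funD; last exact: measurable_funM);
  by apply: mlin; apply: measurableT_comp => //; exact: measurableT_comp.
Qed.

Let sample_funE (x y t s : R) j u : (sample_fun x y t s j u)%:E =
  (\int[P]_w' (K (x + t * S1 j u.1 + s * G1 u.2 + t * xi1 (W w'))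
              (y + t * S2 j u.1 + s * G2 u.2 + t * xi2 (W w')))%:E)%E.
Proof.
rewrite EFin_Rintegral//; apply: iK; apply: measurable_funD => //;
  by apply: measurable_funM => //; exact: measurableT_comp.
Qed.

Let gauss_funE (x y t s : R) j u : (gauss_fun x y t s j u)%:E =
  (\int[gam]_z' (K (x + t * S1 j u.1 + s * G1 u.2 + t * G1 z')
              (y + t * S2 j u.1 + s * G2 u.2 + t * G2 z'))%:E)%E.
Proof.
by rewrite EFin_Rintegral//; apply: iK; apply: measurable_funD => //; exact: measurable_funM.
Qed.

Let m_sample_fun (x y t s : R) j : measurable_fun setT (sample_fun x y t s j).
Proof.
apply/measurable_EFinP; rewrite (funext (sample_funE x y t s j) : EFin \o _ = _).
apply: (measurable_fun_fubini_tonelli_F (m2 := P) (fun u : (T * (R * R)) * T =>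
    (K (x + t * S1 j u.1.1 + s * G1 u.1.2 + t * xi1 (W u.2))
    (y + t * S2 j u.1.1 + s * G2 u.1.2 + t * xi2 (W u.2)))%:E)) => [|u].
  apply: (@mbase x y t s j _ _ fst (fun u => xi1 (W u.2)) (fun u => xi2 (W u.2))) => //;
    by apply: measurableT_comp => //; exact: measurableT_comp.
exact: K0.
Qed.

Let m_gauss_fun (x y t s : R) j : measurable_fun setT (gauss_fun x y t s j).
Proof.
apply/measurable_EFinP; rewrite (funext (gauss_funE x y t s j) : EFin \o _ = _).
apply: (measurable_fun_fubini_tonelli_F (m2 := gam) (fun u : (T * (R * R)) * (R * R) =>
    (K (x + t * S1 j u.1.1 + s * G1 u.1.2 + t * G1 u.2)
    (y + t * S2 j u.1.1 + s * G2 u.1.2 + t * G2 u.2))%:E)) => [|u].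
  by apply: (@mbase x y t s j _ _ fst (fun u => G1 u.2) (fun u => G2 u.2)) => //;
    exact: measurableT_comp.
exact: K0.
Qed.

Let sample_fun_ge0 (x y t s : R) j u : 0 <= sample_fun x y t s j u.
Proof. by apply: Rintegral_ge0 => w _; exact: K0R. Qed.

Let gauss_fun_ge0 (x y t s : R) j u : 0 <= gauss_fun x y t s j u.
Proof. by apply: Rintegral_ge0 => w _; exact: K0R. Qed.

Let i_sample_fun (x y t s : R) j : Rintegrable PG (sample_fun x y t s j).
Proof.
apply: (@bounded_Rintegrable _ _ _ PG _ 1); first exact: m_sample_fun.
move=> u; rewrite ger0_norm ?sample_fun_ge0//.
apply: Rintegral_le_cst.
  apply: iK; apply: measurable_funD => //;
  by apply: measurable_funM => //; exact: measurableT_comp.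
by move=> w; apply: le_trans (cker2_norm_le1 _ _); exact: ler_norm.
Qed.

Let i_gauss_fun (x y t s : R) j : Rintegrable PG (gauss_fun x y t s j).
Proof.
apply: (@bounded_Rintegrable _ _ _ PG _ 1); first exact: m_gauss_fun.
move=> u; rewrite ger0_norm ?gauss_fun_ge0//.
apply: Rintegral_le_cst.
  by apply: iK; apply: measurable_funD => //; exact: measurable_funM.
by move=> w; apply: le_trans (cker2_norm_le1 _ _); exact: ler_norm.
Qed.

Let m_hybrid_fun (x y t s : R) j :
  measurable_fun setT (fun u => (hybrid_fun x y t s j u)%:E).
Proof. by apply: mK; apply: mlin; exact: measurableT_comp. Qed.

Let hybrid_sample (x y t s : R) j :
  (\int[PG]_u (hybrid_fun x y t s j.+1 u)%:E = \int[PG]_u (sample_fun x y t s j u)%:E)%E.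
Proof.
rewrite PGE; [|exact: m_hybrid_fun|by move=> u; exact: K0].
rewrite PGE; [|by apply/measurable_EFinP; exact: m_sample_fun|by move=> u; rewrite lee_fin sample_fun_ge0].
rewrite replace_sample; apply: eq_integral => w _; apply: eq_integral => z _.
by rewrite sample_funE.
Qed.

Let hybrid_gauss (x y t s : R) j : 0 < t ->
  (\int[PG]_u (hybrid_fun x y t (Num.sqrt (s ^+ 2 + t ^+ 2)) j u)%:E =
   \int[PG]_u (gauss_fun x y t s j u)%:E)%E.
Proof.
move=> t0.
rewrite PGE; [|exact: m_hybrid_fun|by move=> u; exact: K0].
rewrite PGE; [|by apply/measurable_EFinP; exact: m_gauss_fun|by move=> u; rewrite lee_fin gauss_fun_ge0].
rewrite (split_gaussian _ _ _ _ t0); apply: eq_integral => w _; apply: eq_integral => z _.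
by rewrite gauss_funE.
Qed.

Let hybrid_step (x y t s : R) j : 0 < t ->
  `|\int[PG]_u hybrid_fun x y t s j.+1 u -
    \int[PG]_u hybrid_fun x y t (Num.sqrt (s ^+ 2 + t ^+ 2)) j u| <= 2 * t ^+ 2 * tail t.
Proof.
move=> t0.
rewrite [X in `|X - _|](_ : _ = \int[PG]_u sample_fun x y t s j u); last first.
  by congr fine; exact: hybrid_sample.
rewrite [X in `|_ - X|](_ : _ = \int[PG]_u gauss_fun x y t s j u); last first.
  by congr fine; exact: hybrid_gauss.
rewrite -RintegralB//; last 2 first.
- exact: i_sample_fun.
- exact: i_gauss_fun.
have iB : Rintegrable PG (fun u => sample_fun x y t s j u - gauss_fun x y t s j u).
  by apply: RintegrableB; [exact: i_sample_fun|exact: i_gauss_fun].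
rewrite (le_trans (le_normr_Rintegral _ iB))//.
apply: Rintegral_le_cst; first exact: (integrable_norm iB).
by move=> u; apply: swap_step; exact: ltW.
Qed.

(** Stage [j] has [j] sample terms and a Gaussian vector of scale [sqrt (n - j) * t]; consecutive
    stages differ by one exchange. *)
Let hybrid_telescope (x y t : R) n j : 0 < t -> (j <= n)%N ->
  `|\int[PG]_u hybrid_fun x y t (Num.sqrt (n - j)%:R * t) j u -
    \int[PG]_u hybrid_fun x y t (Num.sqrt n%:R * t) 0 u| <= j%:R * (2 * t ^+ 2 * tail t).
Proof.
move=> t0; elim: j => [_|j IH jn]; first by rewrite subn0 subrr normr0 mul0r.
rewrite -(subrKA (\int[PG]_u hybrid_fun x y t (Num.sqrt (n - j)%:R * t) j u)).
rewrite (le_trans (ler_normD _ _))// -natr1 mulrDl mul1r [leRHS]addrC lerD ?IH// 1?ltnW//.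
(* Variances add: [(n - j) t^2 = (n - j.+1) t^2 + t^2], where [j < n] matters for the natural
   subtraction. *)
have -> : Num.sqrt (n - j)%:R * t = Num.sqrt ((Num.sqrt (n - j.+1)%:R * t) ^+ 2 + t ^+ 2).
  rewrite exprMn sqr_sqrtr// -[X in _ * _ + X]mul1r -mulrDl natr1 -subSn// subSS.
  by rewrite sqrtrM// sqrtr_sqr gtr0_norm.
exact: hybrid_step.
Qed.

(** With [t = 1 / sqrt n], the [n] exchanges cost [2 * t ^+ 2 * tail t] each, and [n * t ^+ 2 = 1].
    At stage [n] no Gaussian term remains, at stage 0 no sample term. *)
Lemma lindeberg_bound (x y : R) n : (0 < n)%N ->
  `|\int[P]_w (cker (x + (Num.sqrt n%:R)^-1 * \sum_(i < n) xi1 (Z i w)) *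
               cker (y + (Num.sqrt n%:R)^-1 * \sum_(i < n) xi2 (Z i w))) -
    \int[gam]_z (cker (x + G1 z) * cker (y + G2 z))| <= 2 * tail (Num.sqrt n%:R)^-1.
Proof.
move=> n0; set t := (Num.sqrt n%:R)^-1.
have s0 : 0 < Num.sqrt (n%:R : R) by rewrite sqrtr_gt0 ltr0n.
have t0 : 0 < t by rewrite invr_gt0.
have nt : n%:R * t ^+ 2 = 1.
  by rewrite exprVn sqr_sqrtr ?divff// pnatr_eq0 -lt0n.
have st : Num.sqrt n%:R * t = 1 by rewrite divff ?gt_eqF.
have := hybrid_telescope x y t0 (leqnn n).
have -> : n%:R * (2 * t ^+ 2 * tail t) = 2 * tail t.
  by rewrite -mulrA mulrCA (mulrA n%:R) nt mul1r.
rewrite subnn mulr0n sqrtr0 mul0r st.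
congr (`|_ - _| <= _).
- rewrite /Rintegral PGE; [|exact: m_hybrid_fun|by move=> u; exact: K0].
  congr fine; apply: eq_integral => w _; rewrite /hybrid_fun/=.
  under eq_integral do rewrite !mul0r !addr0.
  by rewrite integral_cst// -[X in (_ * X)%E]/(gam setT) probability_setT mule1.
- rewrite /Rintegral PGE; [|exact: m_hybrid_fun|by move=> u; exact: K0].
  congr fine.
  transitivity (\int[P]_w \int[gam]_z (cker (x + G1 z) * cker (y + G2 z))%:E)%E.
    apply: eq_integral => w _; apply: eq_integral => z _.
    by rewrite /hybrid_fun/= /S1 /S2 !big_ord0 !mulr0 !addr0 !mul1r.
  by rewrite integral_cst// -[X in (_ * X)%E]/(P setT) probability_setT mule1.
Qed.

Lemma cvg_clt_kernel (x y : R) :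
  \int[P]_w (cker (x + (Num.sqrt n%:R)^-1 * \sum_(i < n) xi1 (Z i w)) *
             cker (y + (Num.sqrt n%:R)^-1 * \sum_(i < n) xi2 (Z i w))) @[n --> \oo] -->
  \int[gam]_z (cker (x + G1 z) * cker (y + G2 z)).
Proof.
apply/subr_cvg0; apply: (@squeeze_cvgr _ _ _ _
  (fun n => - (2 * tail (Num.sqrt n%:R)^-1)) (fun n => 2 * tail (Num.sqrt n%:R)^-1)).
- near=> n; rewrite -ler_norml; apply: lindeberg_bound.
  by near: n; exact: nbhs_infty_gt.
- rewrite -oppr0; apply: cvgN; rewrite -[X in _ --> X](mulr0 2); apply: cvgM; first exact: cvg_cst.
  rewrite -[X in _ --> X]addr0; apply: cvgD; exact: cvg_lindeberg_tail.
- rewrite -[X in _ --> X](mulr0 2); apply: cvgM; first exact: cvg_cst.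
  rewrite -[X in _ --> X]addr0; apply: cvgD; exact: cvg_lindeberg_tail.
Unshelve. all: by end_near. Qed.

End lindeberg.

(** * From Cauchy kernels to bounded continuous functions *)

(* Lebesgue measure on [R] itself rather than on its copy [measurableTypeR R]. *)
Definition lebR (R : realType) (A : set R) : \bar R := @lebesgue_measure R A.

Section lebR.
Context (R : realType).

Let lebR0 : lebR (@set0 R) = 0%E.
Proof. exact: (measure0 (@lebesgue_measure R)). Qed.

Let lebR_ge0 (A : set R) : (0 <= lebR A)%E.
Proof. exact: (measure_ge0 (@lebesgue_measure R)). Qed.

Let lebR_sigma_additive : semi_sigma_additive (@lebR R).
Proof. exact: (@measure_semi_sigma_additive _ _ _ (@lebesgue_measure R)). Qed.

HB.instance Definition _ := isMeasure.Build _ R R (@lebR R)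
  lebR0 lebR_ge0 lebR_sigma_additive.

Let lebR_sigma_finite : sigma_finite setT (@lebR R).
Proof. exact: (@sigma_finiteT _ _ _ (@lebesgue_measure R)). Qed.

HB.instance Definition _ := Measure_isSigmaFinite.Build _ R R (@lebR R)
  lebR_sigma_finite.

Lemma ge0_integral_lebR (f : R -> \bar R) : measurable_fun setT f ->
  (forall x, (0 <= f x)%E) ->
  (\int[@lebR R]_x f x = \int[@lebesgue_measure R]_x f x)%E.
Proof.
move=> mf f0.
transitivity (\int[pushforward (@lebesgue_measure R) (@of_measurableTypeR R)]_x f x)%E.
  by [].
by rewrite ge0_integral_pushforward.
Qed.

Lemma ge0_integral_lebR_affine (G : R -> R) (a b : R) : 0 < a -> continuous G ->
  (forall x, 0 <= G x) ->
  (\int[@lebR R]_x (G x)%:E = \int[@lebR R]_x (a * G (a * x + b))%:E)%E.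
Proof.
move=> a0 cG G0.
have mG : measurable_fun setT G by exact: continuous_measurable_fun.
rewrite ge0_integral_lebR; [|exact/measurable_EFinP|by move=> x; rewrite lee_fin].
rewrite ge0_integral_lebR; [exact: ge0_integral_affine| |].
- apply/measurable_EFinP/measurable_funM => //; apply: measurableT_comp => //.
  by apply: measurable_funD => //; exact: measurable_funM.
- by move=> x; rewrite lee_fin mulr_ge0// ltW.
Qed.

Lemma integral_cker : (\int[@lebR R]_x (cker x)%:E = (pi : R)%:E)%E.
Proof.
rewrite ge0_integral_lebR; last 2 first.
- apply/measurable_EFinP; apply: continuous_measurable_fun; exact: continuous_cker.
- by move=> x; rewrite lee_fin cker_ge0.
rewrite ge0_symfun_integralT; last 3 first.
- exact: cker_ge0.
- exact: continuous_cker.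
- by move=> x; rewrite /cker /= sqrrN.
have -> : [set x : R | 0 <= x] = `[0%R, +oo[%classic.
  by apply/seteqP; split => x /=; rewrite in_itv/= andbT.
rewrite [X in (_ * X)%E](_ : _ = (pi / 2)%:E)%E; last exact: integral0y_oneDsqr.
by rewrite -EFinM mulrC divfK.
Qed.

End lebR.

Definition leb2 (R : realType) : set (R * R) -> \bar R := (@lebR R \x @lebR R)%E.

Section leb2.
Context (R : realType).

HB.instance Definition _ := Measure.on (@leb2 R).

Let leb2_sigma_finite : sigma_finite setT (@leb2 R).
Proof.
have /sigma_finiteP[F [TF ndF Foo]] := sigma_finiteT (@lebR R).
exists (fun n => F n `*` F n).
  rewrite predeqE => -[x y]; split => // _.
  have : (\bigcup_i F i) x by rewrite -TF.
  have : (\bigcup_i F i) y by rewrite -TF.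
  move=> [n _ Fny] [k _ Fkx]; exists (maxn n k) => //; split => /=.
    by move: x Fkx; exact/subsetPset/ndF/leq_maxr.
  by move: y Fny; exact/subsetPset/ndF/leq_maxl.
move=> k; have [mF Fk] := Foo k.
split; first exact: measurableX.
by rewrite /leb2 product_measure1E// lte_mul_pinfty// ge0_fin_numE.
Qed.

HB.instance Definition _ := Measure_isSigmaFinite.Build _ _ _ (@leb2 R)
  leb2_sigma_finite.

End leb2.

(** * Smoothing by the product Cauchy kernel *)

Section smoothing.
Context (R : realType).
Implicit Types (g : R * R -> R) (x z : R * R).

Lemma ge0_integral_leb2 (f : R * R -> \bar R) : measurable_fun setT f ->
  (forall z, (0 <= f z)%E) ->
  (\int[@leb2 R]_z f z = \int[@lebR R]_x \int[@lebR R]_y f (x, y))%E.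
Proof. by move=> mf f0; exact: fubini_tonelli1. Qed.

Let mcker : measurable_fun setT (@cker R).
Proof. by apply: continuous_measurable_fun; exact: continuous_cker. Qed.

Definition cker_pair z : R := cker z.1 * cker z.2.

Lemma cker_pair_ge0 z : 0 <= cker_pair z. Proof. exact: cker2_ge0. Qed.

Lemma measurable_cker_pair : measurable_fun setT cker_pair.
Proof. by apply: measurable_funM; exact: measurableT_comp. Qed.

Lemma integral_cker_pair : (\int[@leb2 R]_z (cker_pair z)%:E = (pi * pi : R)%:E)%E.
Proof.
rewrite ge0_integral_leb2; last 2 first.
- by apply/measurable_EFinP; exact: measurable_cker_pair.
- by move=> z; rewrite lee_fin cker_pair_ge0.
have inner (x : R) : (\int[@lebR R]_y (cker_pair (x, y))%:E = pi%:E * (cker x)%:E)%E.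
  rewrite muleC -integral_cker -ge0_integralZl//.
  - exact/measurable_EFinP.
  - by move=> y _; rewrite lee_fin cker_ge0.
  - by rewrite lee_fin cker_ge0.
under eq_integral do rewrite inner.
rewrite ge0_integralZl//.
- by rewrite integral_cker EFinM.
- exact/measurable_EFinP.
- by move=> y _; rewrite lee_fin cker_ge0.
- by rewrite lee_fin pi_ge0.
Qed.

Lemma Rintegrable_cker_pair : Rintegrable (@leb2 R) cker_pair.
Proof.
apply: RintegrableP; first exact: measurable_cker_pair.
under eq_integral do rewrite ger0_norm ?cker_pair_ge0//.
by rewrite integral_cker_pair ltry.
Qed.

(** The kernel is not normalized: for large [s] and [g] bounded Lipschitz, the value is close to
    [pi * pi * g x], not to [g x]. *)
Definition smooth g (s : R) x : \bar R :=
  (\int[@leb2 R]_z (g (x.1 + z.1 / s, x.2 + z.2 / s) * cker_pair z)%:E)%E.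

Variable g : R * R -> R.
Hypotheses (mg : measurable_fun setT g) (g0 : forall z, 0 <= g z).
Hypotheses (cg1 : forall x : R, continuous (fun y : R => g (x, y)))
           (cg2 : forall y : R, continuous (fun x : R => g (x, y))).

Let mgE dd (TT : measurableType dd) (u v : TT -> R) : measurable_fun setT u ->
  measurable_fun setT v -> measurable_fun setT (fun w => g (u w, v w)).
Proof.
by move=> mu mv; apply: (measurableT_comp mg); exact/measurable_fun_pair.
Qed.

Let cck (c e : R) : continuous (fun v => cker (c + e * v)).
Proof.
move=> v; apply: (@continuous_comp _ _ _ (fun v => c + e * v) (@cker R)).
  apply: cvgD; first exact: cvg_cst.
  by apply: cvgM; [exact: cvg_cst|exact: cvg_id].
exact: continuous_cker.
Qed.

Let caff (c e : R) : continuous (fun v : R => c + v / e).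
Proof.
move=> v; apply: cvgD; first exact: cvg_cst.
by apply: cvgM; [exact: cvg_id|exact: cvg_cst].
Qed.

(** The substitution [y = x + z / s], one coordinate at a time, moves the point [x] out of [g] and
    into the kernel, so that averaging over [x] will act on kernels only. *)
Lemma smoothE (s : R) x : 0 < s -> smooth g s x =
  (\int[@leb2 R]_y (s * (s * (g y * (cker (s * y.1 - s * x.1) * cker (s * y.2 - s * x.2)))))%:E)%E.
Proof.
move=> s0.
have mlin dd (TT : measurableType dd) (u : TT -> R) (c e : R) :
    measurable_fun setT u -> measurable_fun setT (fun w => c * u w - e).
  by move=> mu; apply: measurable_funD => //; exact: measurable_funM.
have mdiv dd (TT : measurableType dd) (u : TT -> R) (c e : R) :
    measurable_fun setT u -> measurable_fun setT (fun w => c + u w / e).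
  by move=> mu; apply: measurable_funD => //; exact: measurable_funM.
rewrite /smooth ge0_integral_leb2; last 2 first.
- apply/measurable_EFinP/measurable_funM; last exact: measurable_cker_pair.
  by apply: mgE; exact: mdiv.
- by move=> z; rewrite lee_fin mulr_ge0// cker_pair_ge0.
transitivity (\int[@lebR R]_z1 \int[@lebR R]_y2
    (s * (g (x.1 + z1 / s, y2) * (cker z1 * cker (s * y2 - s * x.2))))%:E)%E.
  apply: eq_integral => z1 _.
  rewrite (ge0_integral_lebR_affine (- (s * x.2)) s0); last 2 first.
  - have cF : continuous (fun z2 : R =>
        g (x.1 + z1 / s, x.2 + z2 / s) * (cker z1 * cker z2)).
      move=> z2; apply: cvgM.
        apply: (@continuous_comp _ _ _ (fun v : R => x.2 + v / s)
          (fun v => g (x.1 + z1 / s, v))); first exact: caff.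
        exact: cg1.
      by apply: cvgM; [exact: cvg_cst|exact: continuous_cker].
    exact: cF.
  - by move=> z2; rewrite mulr_ge0// cker_pair_ge0.
  apply: eq_integral => y2 _; congr ((s * (g (_, _) * _))%:E).
  by move=> /=; field; rewrite gt_eqF.
rewrite (fubini_tonelli (m1 := @lebR R) (m2 := @lebR R) (fun z : R * R =>
    (s * (g (x.1 + z.1 / s, z.2) * (cker z.1 * cker (s * z.2 - s * x.2))))%:E)); last 2 first.
- apply/measurable_EFinP/measurable_funM => //; apply: measurable_funM.
    by apply: mgE => //; exact: mdiv.
  by apply: measurable_funM; apply: measurableT_comp => //; exact: mlin.
- by move=> z; rewrite lee_fin !mulr_ge0 ?cker_ge0// ltW.
transitivity (\int[@lebR R]_y2 \int[@lebR R]_y1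
    (s * (s * (g (y1, y2) * (cker (s * y1 - s * x.1) * cker (s * y2 - s * x.2)))))%:E)%E.
  apply: eq_integral => y2 _.
  rewrite (ge0_integral_lebR_affine (- (s * x.1)) s0); last 2 first.
  - have cF : continuous (fun z1 : R =>
        s * (g (x.1 + z1 / s, y2) * (cker z1 * cker (s * y2 - s * x.2)))).
      move=> z1; apply: cvgM; first exact: cvg_cst.
      apply: cvgM.
        apply: (@continuous_comp _ _ _ (fun v : R => x.1 + v / s)
          (fun v => g (v, y2))); first exact: caff.
        exact: cg2.
      by apply: cvgM; [exact: continuous_cker|exact: cvg_cst].
    exact: cF.
  - by move=> z1; rewrite !mulr_ge0 ?cker_ge0// ltW.
  apply: eq_integral => y1 _; congr ((s * (s * (g (_, _) * _)))%:E).
  by move=> /=; field; rewrite gt_eqF.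
have mF : measurable_fun setT (fun y : R * R => (s * (s * (g y *
    (cker (s * y.1 - s * x.1) * cker (s * y.2 - s * x.2)))))%:E).
  apply/measurable_EFinP; do 2 (apply: measurable_funM => //).
  apply: measurable_funM => //.
  by apply: measurable_funM; apply: measurableT_comp => //; exact: mlin.
have F0 y : (0 <= (s * (s * (g y *
    (cker (s * y.1 - s * x.1) * cker (s * y.2 - s * x.2)))))%:E)%E.
  by rewrite lee_fin !mulr_ge0 ?cker_ge0// ltW.
rewrite [RHS]ge0_integral_leb2; [|exact: mF|exact: F0].
by rewrite (fubini_tonelli (m1 := @lebR R) (m2 := @lebR R) _ mF F0).
Qed.

End smoothing.

Section limn_einf.
Context (R : realType).

(** The lower limit is the supremum of the infima over tails, so one such infimum already exceeds
    [a]. *)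
Lemma lt_limn_einf_near (u : (\bar R)^nat) (a : \bar R) :
  (a < limn_einf u)%E -> \forall n \near \oo, (a < u n)%E.
Proof.
rewrite limn_einf_lim => au.
have cv : einfs u n @[n --> \oo] --> ereal_sup (range (einfs u)).
  apply: ereal_nondecreasing_cvgn; exact: nondecreasing_einfs.
move: au; rewrite (cvg_lim _ cv)// => /ereal_sup_gt[_ [N _ <-] aN].
exists N => // n /= Nn; apply: (lt_le_trans aN).
by apply: ereal_inf_lbound; exists n.
Qed.

End limn_einf.

Section smooth_liminf.
Context d d' (T : measurableType d) (T' : measurableType d') (R : realType)
  (P : probability T R) (Q : probability T' R).
Variables (V1 V2 : nat -> T -> R) (G1 G2 : T' -> R).
Hypotheses (mV1 : forall n, measurable_fun setT (V1 n))
  (mV2 : forall n, measurable_fun setT (V2 n))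
  (mG1 : measurable_fun setT G1) (mG2 : measurable_fun setT G2).
Hypothesis cker_cvg : forall s x y : R,
  \int[P]_w (cker (x - s * V1 n w) * cker (y - s * V2 n w)) @[n --> \oo] -->
  \int[Q]_w (cker (x - s * G1 w) * cker (y - s * G2 w)).

Variable g : R * R -> R.
Hypotheses (mg : measurable_fun setT g) (g0 : forall z, 0 <= g z).
Hypotheses (cg1 : forall x : R, continuous (fun y : R => g (x, y)))
           (cg2 : forall y : R, continuous (fun x : R => g (x, y))).

Let mcker : measurable_fun setT (@cker R).
Proof. by apply: continuous_measurable_fun; exact: continuous_cker. Qed.

Let mean_kernel dd (TT : measurableType dd) (M : probability TT R)
  (U1 U2 : TT -> R) (s : R) (y : R * R) : R :=
  \int[M]_w (cker (s * y.1 - s * U1 w) * cker (s * y.2 - s * U2 w)).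

Section one_law.
Context dd (TT : measurableType dd) (M : probability TT R).
Variables (U1 U2 : TT -> R).
Hypotheses (mU1 : measurable_fun setT U1) (mU2 : measurable_fun setT U2).

Let mK s : measurable_fun setT (fun u : TT * (R * R) =>
  cker (s * u.2.1 - s * U1 u.1) * cker (s * u.2.2 - s * U2 u.1)).
Proof.
apply: measurable_funM; apply: measurableT_comp => //; apply: measurable_funB;
  apply: measurable_funM => //; apply: measurableT_comp => //; exact: measurableT_comp.
Qed.

Let mean_kernelE s y : (mean_kernel M U1 U2 s y)%:E =
  (\int[M]_w (cker (s * y.1 - s * U1 w) * cker (s * y.2 - s * U2 w))%:E)%E.
Proof.
rewrite EFin_Rintegral//; apply: (@bounded_Rintegrable _ _ _ M _ 1).
  exact: (measurableT_comp (mK s) (pair2_measurable y)).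
by move=> w; exact: cker2_norm_le1.
Qed.

Lemma measurable_mean_kernel s : measurable_fun setT (mean_kernel M U1 U2 s).
Proof.
apply/measurable_EFinP; rewrite (funext (mean_kernelE s) : EFin \o _ = _).
apply: (measurable_fun_fubini_tonelli_G (m1 := M) (fun u : TT * (R * R) =>
  (cker (s * u.2.1 - s * U1 u.1) * cker (s * u.2.2 - s * U2 u.1))%:E)) => [|u].
  exact/measurable_EFinP.
by rewrite lee_fin cker2_ge0.
Qed.

Lemma mean_kernel_ge0 s y : 0 <= mean_kernel M U1 U2 s y.
Proof. by apply: Rintegral_ge0 => w _; exact: cker2_ge0. Qed.

(** By Tonelli the law of [(U1, U2)] enters only through [mean_kernel], the quantity whose
    convergence is assumed. *)
Lemma integral_smooth (s : R) : 0 < s ->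
  (\int[M]_w smooth g s (U1 w, U2 w) =
   \int[@leb2 R]_y (s * (s * (g y * mean_kernel M U1 U2 s y)))%:E)%E.
Proof.
move=> s0.
under eq_integral do rewrite smoothE//.
rewrite (fubini_tonelli (m1 := M) (m2 := @leb2 R) (fun u : TT * (R * R) =>
  (s * (s * (g u.2 * (cker (s * u.2.1 - s * U1 u.1) *
    cker (s * u.2.2 - s * U2 u.1)))))%:E)); last 2 first.
- apply/measurable_EFinP; do 2 (apply: measurable_funM => //).
  by apply: measurable_funM; [exact: measurableT_comp|exact: mK].
- by move=> u; rewrite lee_fin !mulr_ge0 ?cker_ge0// ltW.
apply: eq_integral => y _ /=.
under eq_integral do rewrite !mulrA -mulrA EFinM.
have sg0 : 0 <= s * s * g y by rewrite !mulr_ge0// ltW.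
rewrite ge0_integralZl//; last 2 first.
- apply/measurable_EFinP; exact: (measurableT_comp (mK s) (pair2_measurable y)).
- by move=> w _; rewrite lee_fin cker2_ge0.
by rewrite -mean_kernelE -EFinM !mulrA.
Qed.

End one_law.

(** Mean kernels are known to converge at each [y]; Fatou's lemma in [y] then gives a one-sided
    conclusion. *)
Lemma smooth_liminf (s : R) : 0 < s ->
  (\int[Q]_w smooth g s (G1 w, G2 w) <=
   limn_einf (fun n => \int[P]_w smooth g s (V1 n w, V2 n w)))%E.
Proof.
move=> s0; rewrite integral_smooth//.
rewrite [X in limn_einf X](_ : _ = fun n =>
  (\int[@leb2 R]_y (s * (s * (g y * mean_kernel P (V1 n) (V2 n) s y)))%:E)%E); last first.
  by apply/funext => n; rewrite integral_smooth.
have F0 n y : (0 <= (s * (s * (g y * mean_kernel P (V1 n) (V2 n) s y)))%:E)%E.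
  by rewrite lee_fin !mulr_ge0 ?mean_kernel_ge0// ltW.
have mF n : measurable_fun setT
    (fun y => (s * (s * (g y * mean_kernel P (V1 n) (V2 n) s y)))%:E).
  apply/measurable_EFinP; do 2 (apply: measurable_funM => //).
  by apply: measurable_funM => //; exact: measurable_mean_kernel.
apply: le_trans (fatou (@leb2 R) measurableT mF (fun n y _ => F0 n y)).
rewrite le_eqVlt; apply/orP; left; apply/eqP; apply: eq_integral => y _.
apply/esym; apply: (fst (cvg_limn_einf_sup _)).
apply: cvg_EFin; first exact: nearW.
do 3 (apply: cvgM; first exact: cvg_cst).
exact: cker_cvg.
Qed.

End smooth_liminf.

Section caratheodory.
Context (R : realType).

Let grid (n : nat) (x : R) : R := (Num.floor (n.+1%:R * x))%:~R / n.+1%:R.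

Let grid_near n x : `|x - grid n x| <= n.+1%:R^-1.
Proof.
have n0 : 0 < n.+1%:R :> R by rewrite ltr0n.
have /andP[h1 h2] := floor_itv (n.+1%:R * x).
rewrite -(ler_pM2l n0) -{1}(gtr0_norm n0) -normrM mulrBr divff ?gt_eqF//.
rewrite /grid mulrCA divff ?gt_eqF// mulr1 ger0_norm ?subr_ge0//.
by rewrite lerBlDr addrC -(intrD1 _) ltW.
Qed.

(** The first coordinate is rounded down to the grid of step [1 / n.+1]; continuity in that
    coordinate recovers [g] as a pointwise limit. *)
Lemma measurable_fun_caratheodory (g : R * R -> R) :
  (forall x, measurable_fun setT (fun y => g (x, y))) ->
  (forall y : R, continuous (fun x : R => g (x, y))) ->
  measurable_fun setT g.
Proof.
move=> mg cg.
apply: (@measurable_fun_cvg _ _ R setT (fun n z => g (grid n z.1, z.2))).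
- move=> n _ B mB; rewrite setTI.
  (* On the strip where the floor equals [k] the rounded function depends on [y] alone, so its
     preimage is a countable union of rectangles. *)
  rewrite [X in measurable X](_ : _ = \bigcup_(k : int)
    ([set x : R | k%:~R <= n.+1%:R * x < (k + 1)%:~R] `*`
     ((fun y => g (k%:~R / n.+1%:R, y)) @^-1` B))).
    apply: countable_bigcupT_measurable => // k; apply: measurableX; last first.
      by rewrite -[X in measurable X]setTI; exact: mg.
    rewrite [X in measurable X](_ : _ = (fun x => n.+1%:R * x) @^-1` `[k%:~R, (k + 1)%:~R[%classic).
      have mm : measurable_fun setT (fun x : R => n.+1%:R * x) by exact: measurable_funM.
      by rewrite -[X in measurable X]setTI; exact: mm.
    by apply/seteqP; split => x /=; rewrite in_itv.
  apply/seteqP; split => -[x y] /=.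
    move=> Bg; exists (Num.floor (n.+1%:R * x)) => //; split => //=.
    exact: floor_itv.
  move=> [k _ [/= kx]]; rewrite /grid; congr (B (g (_ / _, _))).
  by congr (_%:~R); apply/esym/floor_def.
- move=> [x y] _ /=; apply: (cvg_comp (grid^~ x) (fun x => g (x, y))); last exact: cg.
  apply/cvgrPdist_le => e e0; near=> n.
  apply: le_trans (grid_near n x) _.
  rewrite invf_ple ?posrE// ?ltr0n//; apply: ltW.
  apply: (@lt_le_trans _ _ n%:R); last by rewrite ler_nat.
  near: n; exact: nbhs_infty_gtr.
Unshelve. all: by end_near. Qed.

End caratheodory.

Section lipschitz_liminf.
Context d d' (T : measurableType d) (T' : measurableType d') (R : realType)
  (P : probability T R) (Q : probability T' R).
Variables (V1 V2 : nat -> T -> R) (G1 G2 : T' -> R).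
Hypotheses (mV1 : forall n, measurable_fun setT (V1 n))
  (mV2 : forall n, measurable_fun setT (V2 n))
  (mG1 : measurable_fun setT G1) (mG2 : measurable_fun setT G2).
Hypothesis cker_cvg : forall s x y : R,
  \int[P]_w (cker (x - s * V1 n w) * cker (y - s * V2 n w)) @[n --> \oo] -->
  \int[Q]_w (cker (x - s * G1 w) * cker (y - s * G2 w)).

Variables (g : R * R -> R) (B L : R).
Hypotheses (g0 : forall z, 0 <= g z) (gB : forall z, g z <= B) (L0 : 0 <= L).
Hypothesis gL : forall x y : R * R,
  `|g x - g y| <= L * (`|x.1 - y.1| + `|x.2 - y.2|).

Let B0 : 0 <= B. Proof. exact: le_trans (g0 (0, 0)) (gB _). Qed.

Let lip_continuous (h : R -> R) :
  (forall u v, `|h u - h v| <= L * `|u - v|) -> continuous h.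
Proof.
move=> hL u; apply/cvgrPdist_lt => e e0.
(* [L] may be 0, hence the divisor [L + 1]. *)
have L1 : 0 < L + 1 by rewrite ltr_wpDl.
exists (e / (L + 1)) => /=; first by rewrite divr_gt0.
move=> v /= uv; apply: (@le_lt_trans _ _ ((L + 1) * `|u - v|)).
  by rewrite (le_trans (hL _ _))// ler_wpM2r// lerDl.
by rewrite mulrC -ltr_pdivlMr.
Qed.

Let cg1 (x : R) : continuous (fun y : R => g (x, y)).
Proof.
apply: lip_continuous => u v; apply: le_trans (gL _ _) _.
by rewrite /= subrr normr0 add0r.
Qed.

Let cg2 (y : R) : continuous (fun x : R => g (x, y)).
Proof.
apply: lip_continuous => u v; apply: le_trans (gL _ _) _.
by rewrite /= subrr normr0 addr0.
Qed.

Let mg : measurable_fun setT g.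
Proof.
apply: measurable_fun_caratheodory => // x.
by apply: continuous_measurable_fun; exact: cg1.
Qed.

Let scale (n : nat) : R := n.+1%:R.

Let scale_gt0 n : 0 < scale n. Proof. by rewrite ltr0n. Qed.

(** The Lipschitz bound alone is not integrable against [cker_pair], which has no first moment; the
    cap [B] restores integrability. *)
Let modulus n (z : R * R) : R := Num.min (L * ((`|z.1| + `|z.2|) / scale n)) B.

Let modulus_ge0 n z : 0 <= modulus n z.
Proof.
by rewrite /modulus le_min B0 andbT mulr_ge0// divr_ge0 ?addr_ge0// ltW.
Qed.

Let measurable_modulus n : measurable_fun setT (modulus n).
Proof.
apply: measurable_minr => //; apply: measurable_funM => //.
apply: measurable_funM => //.
by apply: measurable_funD; apply: measurableT_comp => //; exact: measurable_normr.
Qed.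

Let i_modulus n : Rintegrable (@leb2 R) (fun z => modulus n z * cker_pair z).
Proof.
apply: (@le_Rintegrable _ _ _ _ _ (fun z => B * cker_pair z)).
- by apply: measurable_funM => //; exact: measurable_cker_pair.
- move=> z; rewrite ger0_norm; last by apply: mulr_ge0 => //; exact: cker_pair_ge0.
  by rewrite ler_wpM2r ?cker_pair_ge0// /modulus ge_min lexx orbT.
- by apply: RintegrableZ; exact: Rintegrable_cker_pair.
Qed.

Let error n : R := \int[@leb2 R]_z (modulus n z * cker_pair z).

Let error_cvg : error n @[n --> \oo] --> 0.
Proof.
have z0 : \int[@leb2 R]_z (0 : R) = 0 by rewrite /Rintegral integral0.
rewrite -[X in _ --> X]z0.
apply: (@Rintegral_dominated_cvg _ _ _ _ _ _ (fun z => B * cker_pair z)).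
- by move=> n; apply: measurable_funM => //; exact: measurable_cker_pair.
- move=> z; rewrite -[X in _ --> X](mul0r (cker_pair z)).
  apply: cvgM; last exact: cvg_cst.
  apply: (@squeeze_cvgr _ _ _ _ (cst 0)
    (fun n => L * ((`|z.1| + `|z.2|) / scale n))).
  + apply: nearW => n; rewrite modulus_ge0 /modulus ge_min lexx//.
  + exact: cvg_cst.
  + rewrite -[X in _ --> X](mulr0 L); apply: cvgM; first exact: cvg_cst.
    rewrite -[X in _ --> X](mulr0 (`|z.1| + `|z.2|)); apply: cvgM; first exact: cvg_cst.
    exact: cvg_harmonic.
- by apply: RintegrableZ; exact: Rintegrable_cker_pair.
- move=> n z; rewrite ger0_norm; last by apply: mulr_ge0 => //; exact: cker_pair_ge0.
  by rewrite ler_wpM2r ?cker_pair_ge0// /modulus ge_min lexx orbT.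
Qed.

Let shift n (x z : R * R) := (x.1 + z.1 / scale n, x.2 + z.2 / scale n).

Let measurable_shift dd (TT : measurableType dd) (u v : TT -> R * R) n :
  measurable_fun setT u -> measurable_fun setT v ->
  measurable_fun setT (fun w => shift n (u w) (v w)).
Proof.
move=> mu mv; apply/measurable_fun_pair; apply: measurable_funD.
- exact: measurableT_comp.
- by apply: measurable_funM => //; exact: measurableT_comp.
- exact: measurableT_comp.
- by apply: measurable_funM => //; exact: measurableT_comp.
Qed.

Let i_shift n x : Rintegrable (@leb2 R) (fun z => g (shift n x z) * cker_pair z).
Proof.
apply: (@le_Rintegrable _ _ _ _ _ (fun z => B * cker_pair z)).
- apply: measurable_funM => //; last exact: measurable_cker_pair.
  by apply: measurableT_comp => //; exact: (@measurable_shift _ _ (cst x) id).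
- move=> z; rewrite ger0_norm; last by apply: mulr_ge0 => //; exact: cker_pair_ge0.
  by rewrite ler_wpM2r ?cker_pair_ge0.
- by apply: RintegrableZ; exact: Rintegrable_cker_pair.
Qed.

Let smoothed n x : R := \int[@leb2 R]_z (g (shift n x z) * cker_pair z).

Let smoothedE n x : (smoothed n x)%:E = smooth g (scale n) x.
Proof. by rewrite EFin_Rintegral//; exact: i_shift. Qed.

(** The kernel has mass [pi * pi], and the shift by [z / scale n] changes [g] by at most
    [modulus n z]. *)
Let smoothed_dist n x : `|smoothed n x - pi * pi * g x| <= error n.
Proof.
have -> : pi * pi * g x = \int[@leb2 R]_z (g x * cker_pair z).
  rewrite RintegralZl//; last exact: Rintegrable_cker_pair.
  by rewrite mulrC [X in _ = _ * X]/Rintegral integral_cker_pair.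
have ic : Rintegrable (@leb2 R) (fun z => g x * cker_pair z).
  by apply: RintegrableZ; exact: Rintegrable_cker_pair.
rewrite -RintegralB//; last exact: i_shift.
have id : Rintegrable (@leb2 R)
    (fun z => g (shift n x z) * cker_pair z - g x * cker_pair z).
  by apply: RintegrableB => //; exact: i_shift.
rewrite (le_trans (le_normr_Rintegral _ id))//.
apply: le_Rintegral => //; [exact: (integrable_norm id)|exact: i_modulus|].
move=> z _; rewrite -mulrBl normrM (ger0_norm (cker_pair_ge0 z)).
rewrite ler_wpM2r ?cker_pair_ge0// /modulus le_min; apply/andP; split.
  apply: le_trans (gL _ _) _; rewrite /= ![_ + _ - _]addrC !addKr.
  by rewrite !normrM normfV (gtr0_norm (scale_gt0 n)) -mulrDl.
by rewrite ler_norml; apply/andP; split;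
  have := g0 (shift n x z); have := gB (shift n x z); have := g0 x; have := gB x; lra.
Qed.

Let m_smoothed dd (TT : measurableType dd) (u : TT -> R * R) n :
  measurable_fun setT u -> measurable_fun setT (fun w => smoothed n (u w)).
Proof.
move=> mu; apply/measurable_EFinP.
rewrite (_ : EFin \o _ = fun w => (\int[@leb2 R]_z (g (shift n (u w) z) * cker_pair z)%:E)%E); last first.
  by apply/funext => w; rewrite /= /smoothed EFin_Rintegral//; exact: i_shift.
apply: (measurable_fun_fubini_tonelli_F (m2 := @leb2 R) (fun q : TT * (R * R) =>
  (g (shift n (u q.1) q.2) * cker_pair q.2)%:E)) => [|q].
  apply/measurable_EFinP/measurable_funM.
    by apply: measurableT_comp => //; apply: measurable_shift => //; exact: measurableT_comp.
  by apply: measurableT_comp => //; exact: measurable_cker_pair.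
by rewrite lee_fin; apply: mulr_ge0 => //; exact: cker_pair_ge0.
Qed.

Let smoothed_ge0 n x : 0 <= smoothed n x.
Proof. by apply: Rintegral_ge0 => z _; apply: mulr_ge0 => //; exact: cker_pair_ge0. Qed.

Let i_g dd (TT : measurableType dd) (M : probability TT R) (u : TT -> R * R) :
  measurable_fun setT u -> Rintegrable M (fun w => g (u w)).
Proof.
move=> mu; apply: (@bounded_Rintegrable _ _ _ M _ B); first exact: measurableT_comp.
by move=> w; rewrite ger0_norm.
Qed.

Let i_smoothed dd (TT : measurableType dd) (M : probability TT R)
  (u : TT -> R * R) n : measurable_fun setT u -> Rintegrable M (fun w => smoothed n (u w)).
Proof.
move=> mu; apply: (@bounded_Rintegrable _ _ _ M _ (pi * pi * B + error n)).
  exact: m_smoothed.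
move=> w; rewrite ger0_norm//.
have := smoothed_dist n (u w); rewrite ler_norml => /andP[_].
rewrite lerBlDl => /le_trans; apply; rewrite lerD2r ler_wpM2l//.
by rewrite mulr_ge0// pi_ge0.
Qed.

Let mean_smoothed dd (TT : measurableType dd) (M : probability TT R)
    (u : TT -> R * R) n : measurable_fun setT u ->
  `|\int[M]_w smoothed n (u w) - pi * pi * \int[M]_w g (u w)| <= error n.
Proof.
move=> mu; rewrite -RintegralZl//; last exact: i_g.
have iZ : Rintegrable M (fun w => pi * pi * g (u w)) by apply: RintegrableZ; exact: i_g.
rewrite -RintegralB//; last exact: i_smoothed.
have iB : Rintegrable M (fun w => smoothed n (u w) - pi * pi * g (u w)).
  by apply: RintegrableB => //; exact: i_smoothed.
rewrite (le_trans (le_normr_Rintegral _ iB))//.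
by apply: Rintegral_le_cst; [exact: (integrable_norm iB)|move=> w].
Qed.

Lemma lipschitz_liminf (e : R) : 0 < e ->
  \forall n \near \oo,
    \int[Q]_w g (G1 w, G2 w) - e <= \int[P]_w g (V1 n w, V2 n w).
Proof.
move=> e0.
have pp0 : 0 < pi * pi :> R by rewrite mulr_gt0// pi_gt0.
set c : R := pi * pi in pp0 *.
(* Of the budget [c * e], where [c] is the mass of the kernel, one third goes to each of the two
   smoothing errors and one third to the slack below the lower limit. *)
have ce0 : 0 < c * e / 3 by rewrite divr_gt0// mulr_gt0.
have [k kE] : exists k, error k < c * e / 3.
  have /cvgrPdist_lt/(_ _ ce0)[k _ kP] := error_cvg.
  by exists k; have := kP k (leqnn k); rewrite sub0r normrN => /ltr_normlW.
have mG : measurable_fun setT (fun w => (G1 w, G2 w)) by exact/measurable_fun_pair.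
have mV n : measurable_fun setT (fun w => (V1 n w, V2 n w)) by exact/measurable_fun_pair.
have := smooth_liminf mV1 mV2 mG1 mG2 cker_cvg mg g0 cg1 cg2 (scale_gt0 k).
under eq_integral do rewrite -smoothedE.
rewrite -EFin_Rintegral; last exact: i_smoothed.
rewrite [X in limn_einf X](_ : _ = fun n => (\int[P]_w smoothed k (V1 n w, V2 n w))%:E); last first.
  apply/funext => n; rewrite EFin_Rintegral; last exact: i_smoothed.
  by apply: eq_integral => w _; rewrite smoothedE.
move=> lim.
have : ((\int[Q]_w smoothed k (G1 w, G2 w) - c * e / 3)%:E <
  limn_einf (fun n => (\int[P]_w smoothed k (V1 n w, V2 n w))%:E))%E.
  by apply: lt_le_trans lim; rewrite lte_fin ltrBlDr ltrDl.
move=> /lt_limn_einf_near; apply: filterS => n; rewrite lte_fin.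
have := mean_smoothed Q k mG; have := mean_smoothed P k (mV n).
rewrite -/c !ler_norml => /andP[_ h1] /andP[h2 _] h3.
rewrite -(ler_pM2l pp0) mulrBr.
lra.
Qed.

End lipschitz_liminf.

(** * Lipschitz envelopes *)

Section lipschitz_envelope.
Context (R : realType) (g : R * R -> R) (B : R).
Hypotheses (cg : continuous g) (g0 : forall z, 0 <= g z) (gB : forall z, g z <= B).

Let dist (x y : R * R) : R := `|x.1 - y.1| + `|x.2 - y.2|.

Let dist_ge0 x y : 0 <= dist x y. Proof. by rewrite addr_ge0. Qed.

Let dist_triangle x y z : dist x z <= dist x y + dist y z.
Proof.
by rewrite /dist addrACA lerD ?ler_distD.
Qed.

(** The Pasch-Hausdorff envelope: the largest function below [g] that is [k]-Lipschitz for
    [dist]. *)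
Definition envelope (k : nat) (x : R * R) : R :=
  inf [set g y + k%:R * dist x y | y in setT].

Let envelope_has_lb k x : has_lbound [set g y + k%:R * dist x y | y in setT].
Proof. by exists 0 => _ [y _ <-]; rewrite addr_ge0// mulr_ge0. Qed.

Let envelope_le k x y : envelope k x <= g y + k%:R * dist x y.
Proof. by apply: ge_inf => //; exists y. Qed.

Let envelope_ge k x c : (forall y, c <= g y + k%:R * dist x y) -> c <= envelope k x.
Proof.
move=> h; apply: lb_le_inf; first by exists (g x + k%:R * dist x x), x.
by move=> _ [y _ <-].
Qed.

Lemma envelope_ge0 k x : 0 <= envelope k x.
Proof. by apply: envelope_ge => y; rewrite addr_ge0// mulr_ge0. Qed.

Lemma envelope_le_fun k x : envelope k x <= g x.
Proof.
by rewrite (le_trans (envelope_le k x x))// /dist !subrr normr0 addr0 mulr0 addr0.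
Qed.

Lemma envelope_lipschitz k x y :
  `|envelope k x - envelope k y| <= k%:R * (`|x.1 - y.1| + `|x.2 - y.2|).
Proof.
have half u v : envelope k u - envelope k v <= k%:R * dist u v.
  rewrite lerBlDl -lerBlDr; apply: envelope_ge => z.
  rewrite lerBlDr (le_trans (envelope_le k u z))// -addrA lerD2l -mulrDr.
  by rewrite ler_wpM2l// addrC; exact: dist_triangle.
rewrite ler_norml half andbT lerNl opprB (le_trans (half _ _))//.
by rewrite /dist (distrC x.1) (distrC x.2).
Qed.

(** Near [x], continuity keeps [g y] above [g x - e]; away from [x], the penalty [k * dl] reaches
    [B] once [k] is large. *)
Lemma cvg_envelope x : envelope k x @[k --> \oo] --> g x.
Proof.
apply/cvgrPdist_le => e e0.
have /cvgrPdist_le/(_ _ e0)/nbhs_ballP[dl /= dl0 near_x] := @cg x.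
near=> k; rewrite ger0_norm; last by rewrite subr_ge0 envelope_le_fun.
rewrite lerBlDr -lerBlDl; apply: envelope_ge => y.
have [close|far] := ltP (dist x y) dl.
  have xy : ball x dl y.
    by split; rewrite /ball/=; apply: le_lt_trans close; rewrite /dist ?lerDl ?lerDr.
  have := near_x _ xy; rewrite ler_norml => /andP[_].
  have : 0 <= k%:R * dist x y by rewrite mulr_ge0.
  lra.
have : B <= k%:R * dist x y.
  apply: (@le_trans _ _ (k%:R * dl)); last by rewrite ler_wpM2l.
  rewrite -ler_pdivrMr//; near: k; exact: nbhs_infty_ger.
have := g0 y; have := gB x; lra.
Unshelve. all: by end_near. Qed.

End lipschitz_envelope.

Section portmanteau.
Context d d' (T : measurableType d) (T' : measurableType d') (R : realType)
  (P : probability T R) (Q : probability T' R).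
Variables (V1 V2 : nat -> T -> R) (G1 G2 : T' -> R).
Hypotheses (mV1 : forall n, measurable_fun setT (V1 n))
  (mV2 : forall n, measurable_fun setT (V2 n))
  (mG1 : measurable_fun setT G1) (mG2 : measurable_fun setT G2).
Hypothesis cker_cvg : forall s x y : R,
  \int[P]_w (cker (x - s * V1 n w) * cker (y - s * V2 n w)) @[n --> \oo] -->
  \int[Q]_w (cker (x - s * G1 w) * cker (y - s * G2 w)).

Lemma continuous_plane_measurable (g : R * R -> R) :
  continuous g -> measurable_fun setT g.
Proof.
move=> cg; apply: measurable_fun_caratheodory => [x|y].
  apply: continuous_measurable_fun => y.
  apply: (@cvg_comp _ _ _ (fun y => (x, y)) g _ (nbhs (x, y))); last exact: cg.
  apply/(@cvg_ballP R (R * R)%type) => e e0; exists e => // z yz; split => //=.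
  exact: ballxx.
move=> x; apply: (@cvg_comp _ _ _ (fun x => (x, y)) g _ (nbhs (x, y))); last exact: cg.
apply/(@cvg_ballP R (R * R)%type) => e e0; exists e => // z yz; split => //=.
exact: ballxx.
Qed.

Lemma continuous_bounded_Rintegrable dd (TT : measurableType dd)
    (M : probability TT R) (u1 u2 : TT -> R) (g : R * R -> R) (B : R) :
  measurable_fun setT u1 -> measurable_fun setT u2 -> continuous g ->
  (forall z, `|g z| <= B) -> Rintegrable M (fun w => g (u1 w, u2 w)).
Proof.
move=> mu1 mu2 cg gB; apply: (@bounded_Rintegrable _ _ _ M _ B) => //.
apply: measurableT_comp; first exact: continuous_plane_measurable.
exact/measurable_fun_pair.
Qed.

(** An envelope lies below [g] and, by dominated convergence, loses at most [e / 2] in the limit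
    law; the Lipschitz case costs the other half. *)
Let continuous_liminf (g : R * R -> R) (B e : R) : continuous g ->
  (forall z, 0 <= g z) -> (forall z, g z <= B) -> 0 < e ->
  \forall n \near \oo,
    \int[Q]_w g (G1 w, G2 w) - e <= \int[P]_w g (V1 n w, V2 n w).
Proof.
move=> cg g0 gB e0; have e20 : 0 < e / 2 by rewrite divr_gt0.
have gN z : `|g z| <= B by rewrite ger0_norm.
have eB k z : `|envelope g k z| <= B.
  by rewrite ger0_norm ?envelope_ge0// (le_trans (envelope_le_fun g0 k z)).
have ce k : continuous (envelope g k).
  move=> z; apply/cvgrPdist_lt => eta eta0.
  have K0 : 0 < 2 * (k%:R + 1) :> R by rewrite mulr_gt0// ltr_wpDl.
  apply/(@nbhs_ballP R (R * R)%type); exists (eta / (2 * (k%:R + 1))) => /=; first by rewrite divr_gt0.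
  move=> y [b1 b2]; apply: le_lt_trans (envelope_lipschitz g0 k z y) _.
  rewrite /ball/= in b1 b2.
  have : (`|z.1 - y.1| + `|z.2 - y.2|) * (k%:R + 1) < eta.
    rewrite -ltr_pdivlMr ?ltr_wpDl//.
    have -> : eta / (k%:R + 1) = eta / (2 * (k%:R + 1)) + eta / (2 * (k%:R + 1)).
      by field; rewrite gt_eqF// ltr_wpDl.
    exact: ltrD.
  apply: le_lt_trans; rewrite mulrC ler_wpM2l// ?addr_ge0// lerDl//.
have [k kP] : exists k,
    \int[Q]_w g (G1 w, G2 w) - e / 2 <= \int[Q]_w envelope g k (G1 w, G2 w).
  have : \int[Q]_w envelope g k (G1 w, G2 w) @[k --> \oo] --> \int[Q]_w g (G1 w, G2 w).
    apply: (@Rintegral_dominated_cvg _ _ _ _ _ _ (fun=> B)).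
    - move=> k; apply: measurableT_comp; first exact: continuous_plane_measurable.
      exact/measurable_fun_pair.
    - by move=> w; exact: cvg_envelope gB _.
    - exact: Rintegrable_cst.
    - by move=> k w; exact: eB.
  move=> /cvgrPdist_le/(_ _ e20)[k _ kP]; exists k.
  have := kP k (leqnn k); rewrite ler_norml => /andP[_]; lra.
have := @lipschitz_liminf _ _ _ _ _ P Q V1 V2 G1 G2 mV1 mV2 mG1 mG2 cker_cvg
  (envelope g k) B k%:R (envelope_ge0 g0 k) _ (ler0n _ _) (envelope_lipschitz g0 k) _ e20.
have eB' z : envelope g k z <= B by rewrite (le_trans (envelope_le_fun g0 k z)).
move=> /(_ eB'); apply: filterS => n h.
apply: (@le_trans _ _ (\int[P]_w envelope g k (V1 n w, V2 n w))).
  by apply: le_trans h; lra.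
apply: le_Rintegral; [by []| | |by move=> w _; exact: envelope_le_fun].
- exact: continuous_bounded_Rintegrable (mV1 n) (mV2 n) (ce k) (eB k).
- exact: continuous_bounded_Rintegrable (mV1 n) (mV2 n) cg gN.
Qed.

Lemma cvg_Rintegral_bounded_continuous (g : R * R -> R) (B : R) : continuous g ->
  (forall z, `|g z| <= B) ->
  \int[P]_w g (V1 n w, V2 n w) @[n --> \oo] --> \int[Q]_w g (G1 w, G2 w).
Proof.
move=> cg gB; have gB' z : - B <= g z <= B by rewrite -ler_norml.
have iQ : Rintegrable Q (fun w => g (G1 w, G2 w)).
  exact: continuous_bounded_Rintegrable mG1 mG2 cg gB.
have iP n : Rintegrable P (fun w => g (V1 n w, V2 n w)).
  exact: continuous_bounded_Rintegrable (mV1 n) (mV2 n) cg gB.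
have shiftD dd (TT : measurableType dd) (M : probability TT R) h :
    Rintegrable M h -> \int[M]_w (h w + B) = \int[M]_w h w + B.
  move=> ih; rewrite RintegralD ?Rintegral_probability_cst//.
  exact: Rintegrable_cst.
have shiftB dd (TT : measurableType dd) (M : probability TT R) h :
    Rintegrable M h -> \int[M]_w (B - h w) = B - \int[M]_w h w.
  move=> ih; rewrite RintegralB ?Rintegral_probability_cst//.
  exact: Rintegrable_cst.
apply/cvgrPdist_le => e e0.
(* The shifts by [B] make both functions nonnegative, with values at most [B + B]. *)
have up := @continuous_liminf (fun z => g z + B) (B + B) e _ _ _ e0.
have dn := @continuous_liminf (fun z => B - g z) (B + B) e _ _ _ e0.
near=> n; rewrite ler_norml; apply/andP; split.
- have : \int[Q]_w (B - g (G1 w, G2 w)) - e <= \int[P]_w (B - g (V1 n w, V2 n w)).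
    near: n; apply: dn.
    + by move=> z; apply: cvgB; [exact: cvg_cst|exact: cg].
    + by move=> z; have /andP[] := gB' z; lra.
    + by move=> z; have /andP[] := gB' z; lra.
  rewrite shiftB// shiftB//; lra.
- have : \int[Q]_w (g (G1 w, G2 w) + B) - e <= \int[P]_w (g (V1 n w, V2 n w) + B).
    near: n; apply: up.
    + by move=> z; apply: cvgD; [exact: cg|exact: cvg_cst].
    + by move=> z; have /andP[] := gB' z; lra.
    + by move=> z; have /andP[] := gB' z; lra.
  rewrite shiftD// shiftD//; lra.
Unshelve. all: by end_near. Qed.

End portmanteau.

(** * Slutsky's argument *)

Section high_probability.
Context d (T : measurableType d) (R : realType) (P : probability T R).
Implicit Types (Q : nat -> T -> Prop).

(* An inner approximation avoids any measurability requirement on Q. *)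
Definition outside_small (e : R) (Q : T -> Prop) : Prop :=
  exists2 B, measurable B /\ (P B <= e%:E)%E & forall w, ~ B w -> Q w.

Definition whp Q : Prop :=
  forall e : R, 0 < e -> \forall n \near \oo, outside_small e (Q n).

Lemma outside_smallI e1 e2 (Q1 Q2 : T -> Prop) :
  outside_small e1 Q1 -> outside_small e2 Q2 ->
  outside_small (e1 + e2) (fun w => Q1 w /\ Q2 w).
Proof.
move=> [B1 [mB1 PB1] h1] [B2 [mB2 PB2] h2]; exists (B1 `|` B2).
  split; first exact: measurableU.
  by rewrite (le_trans (measureU2 P mB1 mB2))// EFinD leeD.
move=> w /not_orP[n1 n2]; split; [exact: h1|exact: h2].
Qed.

Lemma outside_smallS e (Q1 Q2 : T -> Prop) : (forall w, Q1 w -> Q2 w) ->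
  outside_small e Q1 -> outside_small e Q2.
Proof. by move=> h [B [mB PB] hB]; exists B => // w /hB /h. Qed.

Lemma whpI Q1 Q2 : whp Q1 -> whp Q2 -> whp (fun n w => Q1 n w /\ Q2 n w).
Proof.
move=> h1 h2 e e0; have e20 : 0 < e / 2 by rewrite divr_gt0.
near=> n; rewrite (_ : e = e / 2 + e / 2); last by field.
apply: outside_smallI; near: n; [exact: h1|exact: h2].
Unshelve. all: by end_near. Qed.

Lemma outside_small_as e (Q : T -> Prop) : 0 <= e ->
  {ae P, forall w, Q w} -> outside_small e Q.
Proof.
move=> e0 [N [mN PN NQ]]; exists N; first by rewrite PN lee_fin.
by move=> w Nw; apply: contrapT => nQ; apply/Nw/NQ.
Qed.

Lemma markov_outside_small (f : T -> R) (c e : R) :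
  Rintegrable P f -> (forall w, 0 <= f w) -> 0 < c -> \int[P]_w f w <= e * c ->
  outside_small e (fun w => f w < c).
Proof.
move=> fi f0 c0 fe; exists [set w | c <= f w].
  split; last first.
    by rewrite (le_trans (markov_Rintegral fi f0 c0))// lee_fin ler_pdivrMr.
  rewrite -[X in measurable X]setTI; apply: measurable_fun_le => //.
  exact: Rintegrable_measurable fi.
by move=> w /= /negP; rewrite -ltNge.
Qed.

End high_probability.

Section slutsky.
Context d d' (T : measurableType d) (T' : measurableType d') (R : realType)
  (P : probability T R).
Variables (V1 V2 W1 W2 : nat -> T -> R).
Hypotheses (mV1 : forall n, measurable_fun setT (V1 n))
  (mV2 : forall n, measurable_fun setT (V2 n))
  (mW1 : forall n, measurable_fun setT (W1 n))
  (mW2 : forall n, measurable_fun setT (W2 n)).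
Hypothesis close : forall eta : R, 0 < eta ->
  whp P (fun n w => `|V1 n w - W1 n w| <= eta /\ `|V2 n w - W2 n w| <= eta).

Let cker_dist (a b : R) : `|cker a - cker b| <= `|a - b|.
Proof. by have [+ _ _] := cker_bounds b (a - b); rewrite subrKC. Qed.

Let cker2_dist (a b a' b' : R) :
  `|cker a * cker b - cker a' * cker b'| <= `|a - a'| + `|b - b'|.
Proof.
have -> : cker a * cker b - cker a' * cker b' =
  (cker a - cker a') * cker b + cker a' * (cker b - cker b') by ring.
rewrite (le_trans (ler_normD _ _))// !normrM lerD//.
- rewrite (le_trans _ (cker_dist a a'))// ler_piMr// ger0_norm ?cker_ge0//.
  exact: cker_le1.
- rewrite (le_trans _ (cker_dist b b'))// ler_piMl// ger0_norm ?cker_ge0//.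
  exact: cker_le1.
Qed.

(** The product kernel is 1-Lipschitz in each coordinate with values in [[0, 1]]: closeness controls
    the difference on the good event, and the bound 1 controls it on the exceptional set. *)
Lemma slutsky_kernel (s x y l : R) :
  \int[P]_w (cker (x - s * W1 n w) * cker (y - s * W2 n w)) @[n --> \oo] --> l ->
  \int[P]_w (cker (x - s * V1 n w) * cker (y - s * V2 n w)) @[n --> \oo] --> l.
Proof.
pose k (U1 U2 : nat -> T -> R) n w := cker (x - s * U1 n w) * cker (y - s * U2 n w).
have k0 U1 U2 n w : 0 <= k U1 U2 n w by rewrite mulr_ge0 ?cker_ge0.
have k1 U1 U2 n w : k U1 U2 n w <= 1 by rewrite mulr_ile1 ?cker_ge0 ?cker_le1.
have mk U1 U2 n : measurable_fun setT (U1 n) -> measurable_fun setT (U2 n) ->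
    measurable_fun setT (k U1 U2 n).
  have mc : measurable_fun setT (@cker R).
    by apply: continuous_measurable_fun; exact: continuous_cker.
  by move=> m1 m2; apply: measurable_funM; apply: (measurableT_comp mc);
    apply: measurable_funB => //; exact: measurable_funM.
have ik U1 U2 n : measurable_fun setT (U1 n) -> measurable_fun setT (U2 n) ->
    Rintegrable P (k U1 U2 n).
  move=> m1 m2; apply: (@bounded_Rintegrable _ _ _ P _ 1); first exact: mk.
  by move=> w; rewrite ger0_norm.
have iV n := ik _ _ _ (mV1 n) (mV2 n); have iW n := ik _ _ _ (mW1 n) (mW2 n).
move=> cvgW; suff diff : \int[P]_w k V1 V2 n w - \int[P]_w k W1 W2 n w @[n --> \oo] --> 0.
  rewrite -[l]add0r; apply: cvg_trans (cvgD diff cvgW).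
  by apply: near_eq_cvg; apply: nearW => n; rewrite subrK.
apply/cvgrPdist_le => e e0.
have s10 : 0 < `|s| + 1 by rewrite ltr_wpDl.
have e20 : 0 < e / 2 by rewrite divr_gt0.
(* The two coordinates together cost at most [e / 2] on the good event, and the exceptional set
   contributes at most [e / 2]; the [+ 1] covers [s = 0]. *)
have eta0 : 0 < e / 4 / (`|s| + 1) by rewrite !divr_gt0.
have /(_ _ e20) := close eta0; apply: filterS => n [B [mB PB] good].
rewrite sub0r normrN -RintegralB; [|by []|exact: iV|exact: iW].
have iD : Rintegrable P (fun w => k V1 V2 n w - k W1 W2 n w) by exact: RintegrableB.
apply: le_trans (le_normr_Rintegral _ iD) _ => //.
have i1 : Rintegrable P (fun w => e / 2 + \1_B w).
  apply: RintegrableD; first exact: Rintegrable_cst.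
  apply: (@bounded_Rintegrable _ _ _ P _ 1); first exact: measurable_indic.
  by move=> w; rewrite indicE; case: (_ \in _); rewrite ?normr1 ?normr0.
apply: (@le_trans _ _ (\int[P]_w (e / 2 + \1_B w))).
  apply: le_Rintegral => //; first exact: (integrable_norm iD).
  move=> w _; rewrite indicE; case: (boolP (w \in B)) => wB /=.
    have := k0 V1 V2 n w; have := k1 V1 V2 n w; have := k0 W1 W2 n w; have := k1 W1 W2 n w.
    by move: (e20) => ? *; rewrite mulr1n ler_norml; apply/andP; split; lra.
  rewrite mulr0n addr0.
  have [g1 g2] := good w (fun Bw => negP wB (mem_set Bw)).
  apply: le_trans (cker2_dist _ _ _ _) _.
  have dist u v t : t - s * u - (t - s * v) = - (s * (u - v)) by ring.
  rewrite !dist !normrN !normrM -mulrDr.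
  apply: (@le_trans _ _ ((`|s| + 1) * (e / 4 / (`|s| + 1) + e / 4 / (`|s| + 1)))).
    by apply: ler_pM; rewrite ?addr_ge0// ?lerDl// lerD.
  by rewrite le_eqVlt; apply/orP; left; apply/eqP; field; rewrite gt_eqF.
rewrite RintegralD//; [|exact: Rintegrable_cst|].
- rewrite Rintegral_probability_cst.
  have -> : \int[P]_w (\1_B w : R) = fine (P B).
    by rewrite /Rintegral integral_indic// setIT.
  have : fine (P B) <= e / 2.
    by rewrite -lee_fin fineK// fin_num_measure.
  lra.
- apply: (@bounded_Rintegrable _ _ _ P _ 1); first exact: measurable_indic.
  by move=> w; rewrite indicE; case: (_ \in _); rewrite ?normr1 ?normr0.
Qed.

End slutsky.

(** * Maximal inequality over thresholds *)

Section first_crossing.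
Context (R : realType).
Implicit Types (x m : nat -> R) (v lam : R) (n i j k : nat).

Definition tail_sum n x m v : R := \sum_(k < n) m k * (v <= x k)%R%:R.

(* Scanning the thresholds [x j] downwards, [first_crossing] holds of the first
   one at which the tail sum is large, ties being broken by the index. *)
Definition first_crossing lam n x m j : bool :=
  (lam <= `|tail_sum n x m (x j)|) &&
  [forall k : 'I_n, (lam <= `|tail_sum n x m (x k)|) ==>
     ((x k < x j) || ((x k == x j) && (j <= k)%N))].

(** At most one [j] is a first crossing, so this is the tail sum there when [x i] lies strictly
    below it, and 0 otherwise. *)
Definition crossing_coef lam n x m i : R :=
  \sum_(j < n) (first_crossing lam n x m j)%:R * tail_sum n x m (x j) *
               (x i < x j)%R%:R.

Lemma tail_sum_off n x m m' i v : x i < v -> (forall k, k != i -> m k = m' k) ->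
  tail_sum n x m v = tail_sum n x m' v.
Proof.
move=> iv mm'; apply: eq_bigr => k _; have [ki|ki] := eqVneq (k : nat) i.
  by rewrite ki leNgt iv !mulr0.
by rewrite mm'.
Qed.

(** Points at or below [x i] never compete with [x j], and tail sums at thresholds above [x i] do
    not contain [m i]. *)
Lemma first_crossing_off lam n x m m' i j : x i < x j ->
  (forall k, k != i -> m k = m' k) ->
  first_crossing lam n x m j = first_crossing lam n x m' j.
Proof.
move=> ij mm'; rewrite /first_crossing (tail_sum_off _ ij mm'); congr (_ && _).
apply: eq_forallb => k; have [ki|ik] := leP (x k) (x i).
  by rewrite (le_lt_trans ki ij)/= !implybT.
by rewrite (tail_sum_off _ ik mm').
Qed.

(** This is predictability: [j] contributes only if [x i < x j], and then everything it involves is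
    decided strictly above [x i]. *)
Lemma crossing_coef_off lam n x m m' i : (forall k, k != i -> m k = m' k) ->
  crossing_coef lam n x m i = crossing_coef lam n x m' i.
Proof.
move=> mm'; apply: eq_bigr => j _; case: (boolP (x i < x j)) => [ij|_].
  by rewrite (first_crossing_off _ _ ij mm') (tail_sum_off _ ij mm').
by rewrite !mulr0.
Qed.

(** A crude bound, meant for integrability only. *)
Lemma crossing_coef_bound lam n x m i :
  `|crossing_coef lam n x m i| <= n%:R * \sum_(k < n) `|m k|.
Proof.
rewrite (le_trans (ler_norm_sum _ _ _))//.
apply: (@le_trans _ _ (\sum_(j < n) \sum_(k < n) `|m k|)); last first.
  by rewrite sumr_const card_ord mulr_natl.
have b01 (b : bool) : `|b%:R| <= 1 :> R by case: b; rewrite ?normr1 ?normr0.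
apply: ler_sum => j _; rewrite !normrM.
apply: (@le_trans _ _ `|tail_sum n x m (x j)|).
  rewrite -[leRHS]mul1r -[leRHS]mulr1 ler_pM ?mulr_ge0// ler_pM//.
rewrite (le_trans (ler_norm_sum _ _ _))//; apply: ler_sum => k _.
by rewrite normrM ler_piMr.
Qed.

Let first_crossing_uniq lam n x m (j k : 'I_n) :
  first_crossing lam n x m j -> first_crossing lam n x m k -> j = k.
Proof.
move=> /andP[lj /forallP/(_ k)] + /andP[lk /forallP/(_ j)].
rewrite lj lk /= => /orP[kj|/andP[/eqP kj jk]] /orP[jk'|/andP[/eqP jk' kj']].
- by have := lt_trans kj jk'; rewrite ltxx.
- by rewrite jk' ltxx in kj.
- by rewrite kj ltxx in jk'.
- by apply/val_inj/eqP; rewrite eqn_leq jk kj'.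
Qed.

Let first_crossing_exists lam n x m v : 0 < lam -> lam <= `|tail_sum n x m v| ->
  exists j : 'I_n, first_crossing lam n x m j.
Proof.
move=> lam0 lv.
have [i0 vi0] : exists i : 'I_n, v <= x i.
  apply: contrapT => no; move: lv; rewrite leNgt => /negP; apply.
  rewrite /tail_sum big1 ?normr0// => k _; case: leP => vk; last by rewrite mulr0.
  by exfalso; apply: no; exists k.
have [j0 lj0] : exists j : 'I_n, lam <= `|tail_sum n x m (x j)|.
  (* No abscissa lies between [v] and the smallest one at or above [v], so these two thresholds have
     the same tail sum. *)
  exists [arg min_(i < i0 | v <= x i) x i]%O.
  case: arg_minP => // j vj jmin; rewrite (le_trans lv)// le_eqVlt; apply/orP; left.
  apply/eqP; congr `|_|; apply: eq_bigr => k _; congr (_ * (nat_of_bool _)%:R).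
  apply/idP/idP => [|jk]; last exact: le_trans jk.
  exact: jmin.
(* The crossing is the largest abscissa with a large tail sum, and the smallest index among its
   ties. *)
pose Q (j : 'I_n) := lam <= `|tail_sum n x m (x j)|.
case: (@arg_maxP _ _ _ j0 Q (fun j : 'I_n => x j) lj0) => j1 Qj1 j1max.
pose Q' (j : 'I_n) := Q j && (x j == x j1).
have Q'j1 : Q' j1 by rewrite /Q' Qj1 eqxx.
case: (@arg_minnP _ j1 Q' (fun j : 'I_n => j : nat) Q'j1) => j /andP[Qj /eqP xj] jmin.
exists j; rewrite /first_crossing; apply/andP; split => //.
apply/forallP => k; apply/implyP => Qk; rewrite xj.
have : x k <= x j1 := j1max k Qk; rewrite le_eqVlt => /orP[/eqP xk|->//].
by rewrite xk ltxx eqxx jmin// /Q' [Q k]Qk xk eqxx.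
Qed.

(** If [p] is the tail sum at the first crossing, the double sum collapses to [p * (tot - p)] and
    [f = (tot - p)^2 + p^2], which is at least [lam ^+ 2]. Without a crossing [f = tot^2], and every
    tail sum is below [lam]. Once the predictable sum has mean 0, this is a pathwise form of
    Kolmogorov's inequality. *)
Lemma crossing_energy lam n x m :
  let f := (\sum_(i < n) m i) ^+ 2 -
    2 * \sum_(i < n) m i * crossing_coef lam n x m i in
  0 <= f /\ (0 < lam -> f < lam ^+ 2 -> forall v, `|tail_sum n x m v| < lam).
Proof.
set tot := \sum_(i < n) m i.
have -> : \sum_(i < n) m i * crossing_coef lam n x m i =
    \sum_(j < n) (first_crossing lam n x m j)%:R *
      (tail_sum n x m (x j) * (tot - tail_sum n x m (x j))).
  rewrite /crossing_coef.
  under eq_bigr do rewrite mulr_sumr.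
  rewrite exchange_big/=; apply: eq_bigr => j _.
  have -> : tot - tail_sum n x m (x j) = \sum_(i < n) m i * (x i < x j)%R%:R.
    rewrite /tot /tail_sum -sumrB; apply: eq_bigr => i _.
    by rewrite ltNge; case: (x j <= x i) => /=; ring.
  by move: (tail_sum _ _ _ _) => p; rewrite !mulr_sumr; apply: eq_bigr => i _; ring.
have [[j cj]|no] := pselect (exists j : 'I_n, first_crossing lam n x m j).
  have -> : \sum_(j < n) (first_crossing lam n x m j)%:R *
      (tail_sum n x m (x j) * (tot - tail_sum n x m (x j))) =
      tail_sum n x m (x j) * (tot - tail_sum n x m (x j)).
    rewrite (bigD1 j)//= cj mul1r big1 ?addr0// => k kj.
    case: (boolP (first_crossing _ _ _ _ k)) => [ck|_]; last by rewrite mul0r.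
    by rewrite (first_crossing_uniq ck cj) eqxx in kj.
  set p := tail_sum n x m (x j).
  have -> : tot ^+ 2 - 2 * (p * (tot - p)) = (tot - p) ^+ 2 + p ^+ 2 by ring.
  split => [|lam0]; first by rewrite addr_ge0 ?sqr_ge0.
  rewrite ltNge => /negP[]; move: cj => /andP[lj _].
  rewrite (@le_trans _ _ (p ^+ 2))// ?lerDr ?sqr_ge0// -[leRHS]real_normK ?num_real//.
  by rewrite ler_sqr ?nnegrE// ltW.
rewrite big1 => [|j _]; last first.
  case: (boolP (first_crossing _ _ _ _ j)) => [cj|_]; last by rewrite mul0r.
  by exfalso; apply: no; exists j.
split => [|lam0 _ v]; first by rewrite mulr0 subr0 sqr_ge0.
by rewrite ltNge; apply/negP => /(first_crossing_exists lam0).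
Qed.

Context d (T : measurableType d) (xs ms : nat -> T -> R).
Hypotheses (mxs : forall i, measurable_fun setT (xs i))
  (mms : forall i, measurable_fun setT (ms i)).

Let measurable_b2r (b : T -> bool) : measurable_fun setT b ->
  measurable_fun setT (fun w => (b w)%:R : R).
Proof.
move=> mb; rewrite [X in measurable_fun _ X](_ : _ = fun w => if b w then 1 else 0).
  exact: measurable_fun_ifT.
by apply/funext => w; case: (b w).
Qed.

Let measurable_forall n (b : nat -> T -> bool) :
  (forall k, measurable_fun setT (b k)) ->
  measurable_fun setT (fun w => [forall k : 'I_n, b k w]).
Proof.
move=> mb.
rewrite [X in measurable_fun _ X](_ : _ = fun w => \big[andb/true]_(k < n) b k w); last first.
  by apply/funext => w; rewrite big_andE; exact: eq_forallb.
elim: n => [|n IH].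
  rewrite [X in measurable_fun _ X](_ : _ = cst true) //.
  by apply/funext => w; rewrite big_ord0.
rewrite [X in measurable_fun _ X](_ : _ = fun w =>
    (\big[andb/true]_(k < n) b k w) && b n w); first exact: measurable_and.
by apply/funext => w; rewrite big_ord_recr.
Qed.

Let measurable_tail_sum n (u : T -> R) : measurable_fun setT u ->
  measurable_fun setT (fun w => tail_sum n (xs^~ w) (ms^~ w) (u w)).
Proof.
move=> mu; apply: measurable_sum => k; apply: measurable_funM => //.
by apply: measurable_b2r; exact: measurable_fun_ler.
Qed.

Lemma measurable_crossing_coef lam n i :
  measurable_fun setT (fun w => crossing_coef lam n (xs^~ w) (ms^~ w) i).
Proof.
apply: measurable_sum => j; apply: measurable_funM; first apply: measurable_funM.
- apply: measurable_b2r; apply: measurable_and.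
    apply: measurable_fun_ler => //; apply: measurableT_comp => //.
    exact: measurable_tail_sum.
  apply: (measurable_forall n (b := fun k w => (lam <= `|tail_sum n (xs^~ w) (ms^~ w) (xs k w)|) ==>
    ((xs k w < xs j w) || ((xs k w == xs j w) && (j <= k)%N)))) => k.
  under eq_fun do rewrite implybE.
  apply: measurable_or.
    apply: measurableT_comp => //; apply: measurable_fun_ler => //.
    by apply: measurableT_comp => //; exact: measurable_tail_sum.
  apply: measurable_or; first exact: measurable_fun_ltr.
  by apply: measurable_and => //; exact: measurable_fun_eqr.
- exact: measurable_tail_sum.
- by apply: measurable_b2r; exact: measurable_fun_ltr.
Qed.

End first_crossing.

Lemma Rintegrable_mul d (T : measurableType d) (R : realType)
    (m : {measure set T -> \bar R}) (f g : T -> R) :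
  measurable_fun setT f -> measurable_fun setT g ->
  Rintegrable m (fun x => f x ^+ 2) -> Rintegrable m (fun x => g x ^+ 2) ->
  Rintegrable m (fun x => f x * g x).
Proof.
move=> mf mg f2 g2; apply: (@le_Rintegrable _ _ _ _ _ (fun x => f x ^+ 2 + g x ^+ 2)).
- exact: measurable_funM.
- by move=> x; rewrite ler_norml; apply/andP; split; nra.
- exact: RintegrableD.
Qed.

Section tail_sum_maximal.
Context d d1 (T : measurableType d) (S : measurableType d1) (R : realType)
  (P : probability T R) (Z : nat -> {mfun T >-> S}).
Hypothesis indZ : independent_seq P Z.
Variables (xs es : S -> R) (h : R -> R).
Hypotheses (mxs : measurable_fun setT xs) (mes : measurable_fun setT es)
  (mh : measurable_fun setT h).
(** Centering of the errors given the abscissas, expressed through test functions of the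
    abscissa. *)
Hypothesis mean0 : forall i (f : R -> R), measurable_fun setT f ->
  Rintegrable P (fun w => es (Z i w) * f (xs (Z i w))) ->
  \int[P]_w (es (Z i w) * f (xs (Z i w))) = 0.

Let eh (s : S) : R := es s * h (xs s).

Variable c : R.
Hypotheses (i_eh2 : forall i, Rintegrable P (fun w => eh (Z i w) ^+ 2))
  (eh2 : forall i, \int[P]_w (eh (Z i w) ^+ 2) = c).

Let measurable_eh : measurable_fun setT eh.
Proof. by apply: measurable_funM => //; exact: measurableT_comp. Qed.

Let mZ (f : S -> R) i : measurable_fun setT f -> measurable_fun setT (f \o Z i).
Proof. by move=> mf; exact: measurableT_comp. Qed.

Let i_eh_eh i j : Rintegrable P (fun w => eh (Z i w) * eh (Z j w)).
Proof. by apply: Rintegrable_mul => //; exact: mZ. Qed.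

Let i_eh i : Rintegrable P (fun w => eh (Z i w)).
Proof.
apply: (@le_Rintegrable _ _ _ _ _ (fun w => eh (Z i w) ^+ 2 + 1)); first exact: mZ.
- by move=> w; rewrite ler_norml; apply/andP; split; nra.
- by apply: RintegrableD => //; exact: Rintegrable_cst.
Qed.

Let measurable_snd_off i j : j != i ->
  measurable_fun setT (fun q : R * sigma_off Z i => Z j q.2).
Proof.
move=> ji.
have := @measurableT_comp _ _ _ _ _ _ (fun w : sigma_off Z i => Z j w)
  setT (@snd R (sigma_off Z i)).
by apply; [exact: measurable_off|exact: measurable_snd].
Qed.

(** Fubini freezes the other terms at [w], and what remains is an instance of [mean0] for the test
    function [C (_, w)]. *)
Let decoupled_mean i (C : R * sigma_off Z i -> R) :
  measurable_fun setT C ->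
  Rintegrable P (fun w => es (Z i w) * C (xs (Z i w), off_id Z i w)) ->
  (forall w, Rintegrable P (fun w' => es (Z i w') * C (xs (Z i w'), w))) ->
  \int[P]_w (es (Z i w) * C (xs (Z i w), off_id Z i w)) = 0.
Proof.
move=> mC iC iCw; pose f (q : S * sigma_off Z i) := es q.1 * C (xs q.1, q.2).
have mf : measurable_fun setT f.
  apply: measurable_funM; first exact: measurableT_comp.
  apply: (measurableT_comp mC); apply/measurable_fun_pair => //=.
  exact: measurableT_comp.
have decoupled := independent_integral (independent_off (k := i) indZ) mf iC.
apply: EFin_inj; rewrite (EFin_Rintegral iC); apply: etrans decoupled _.
rewrite -[RHS](integral0 P setT); apply: eq_integral => w _.
rewrite -[LHS](EFin_Rintegral (iCw w)) /f/=.
rewrite (mean0 (f := fun t => C (t, w)))//.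
apply: (measurableT_comp mC); apply/measurable_fun_pair => /=;
  [exact: measurable_id|exact: measurable_cst].
Qed.

Let eh_orthogonal i j : i != j -> \int[P]_w (eh (Z i w) * eh (Z j w)) = 0.
Proof.
move=> ij; have ji : j != i by rewrite eq_sym.
under eq_Rintegral do rewrite /eh -mulrA.
pose C (q : R * sigma_off Z i) := h q.1 * eh (Z j q.2).
apply: (@decoupled_mean i C).
- apply: measurable_funM; first exact: measurableT_comp.
  apply: (measurableT_comp measurable_eh).
  exact: measurable_snd_off.
- by rewrite /C/=; under eq_fun do rewrite mulrA; exact: i_eh_eh.
- move=> w; rewrite /C/=; under eq_fun do rewrite mulrA mulrC.
  by apply: RintegrableZ; exact: i_eh.
Qed.

Let eh_energy n : \int[P]_w ((\sum_(i < n) eh (Z i w)) ^+ 2) = n%:R * c.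
Proof.
under eq_Rintegral do rewrite expr2 mulr_suml.
rewrite Rintegral_sum => [|i _]; last first.
  by under eq_fun do rewrite mulr_sumr; exact: Rintegrable_sum.
rewrite (eq_bigr (fun=> c)); first by rewrite sumr_const card_ord mulr_natl.
move=> i _; under eq_Rintegral do rewrite mulr_sumr.
rewrite Rintegral_sum//.
rewrite (bigD1 i)//= big1 ?addr0 => [|j ji]; first by rewrite -(eh2 i).
by apply: eh_orthogonal; rewrite eq_sym.
Qed.

Let coef lam n i w := crossing_coef lam n (fun k => xs (Z k w)) (fun k => eh (Z k w)) i.

Let measurable_coef lam n i : measurable_fun setT (coef lam n i).
Proof.
by apply: (measurable_crossing_coef (xs := fun k w => xs (Z k w))
  (ms := fun k w => eh (Z k w))) => k; exact: mZ.
Qed.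

Let i_eh_coef lam n i : Rintegrable P (fun w => eh (Z i w) * coef lam n i w).
Proof.
apply: (@le_Rintegrable _ _ _ _ _
  (fun w => n%:R * \sum_(k < n) `|eh (Z i w) * eh (Z k w)|)).
- by apply: measurable_funM => //; exact: mZ.
- move=> w; rewrite normrM; under eq_bigr do rewrite normrM.
  by rewrite -mulr_sumr mulrCA ler_wpM2l//; exact: crossing_coef_bound.
- apply: RintegrableZ; apply: Rintegrable_sum => k _.
  exact: (integrable_norm (i_eh_eh i k)).
Qed.

(* After the first crossing the remaining increments are orthogonal to the past:
   [coef i] does not involve the error of the i-th term, only its abscissa. *)
Let eh_coef lam n i : \int[P]_w (eh (Z i w) * coef lam n i w) = 0.
Proof.
(* The coefficient is rewritten as a function of the [i]-th abscissa and of the other terms; the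
   increment of index [i] is set to 0, which [crossing_coef_off] permits. *)
pose xo k (q : R * sigma_off Z i) := if k == i then q.1 else xs (Z k q.2).
pose mo k (q : R * sigma_off Z i) := if k == i then 0 else eh (Z k q.2).
pose C q := h q.1 * crossing_coef lam n (xo^~ q) (mo^~ q) i.
have coefE w : eh (Z i w) * coef lam n i w =
    es (Z i w) * C (xs (Z i w), off_id Z i w).
  rewrite /eh -mulrA; congr (_ * (_ * _)).
  rewrite /coef (_ : xo^~ _ = fun k => xs (Z k w)); last first.
    by apply/funext => k; rewrite /xo; case: eqP => [->|].
  apply: crossing_coef_off => k /negPf ki; by rewrite /mo ki.
have mC : measurable_fun setT C.
  apply: measurable_funM; first exact: measurableT_comp.
  apply: measurable_crossing_coef => k; rewrite /xo /mo.
    case: (boolP (k == i)) => ki; first exact: measurable_fst.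
    apply: (measurableT_comp mxs).
    exact: measurable_snd_off.
  case: (boolP (k == i)) => ki; first exact: measurable_cst.
  apply: (measurableT_comp measurable_eh).
  exact: measurable_snd_off.
under eq_Rintegral do rewrite coefE.
apply: decoupled_mean => //.
  by under eq_fun do rewrite -coefE; exact: i_eh_coef.
move=> w; pose K := n%:R * \sum_(k < n) `|mo k (0, w)|.
apply: (@le_Rintegrable _ _ _ _ _ (fun w' => K * `|eh (Z i w')|)).
- apply: measurable_funM; first exact: mZ.
  apply: (measurableT_comp mC); apply/measurable_fun_pair => //=; exact: mZ.
- move=> w'; rewrite /C/= mulrA normrM mulrC ler_wpM2r//.
  exact: crossing_coef_bound.
- apply: RintegrableZ; exact: (integrable_norm (i_eh i)).
Qed.

(** Markov's inequality for the energy of [crossing_energy], whose mean is [n * c]: the predictable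
    part vanishes by [eh_coef] and the products of distinct increments by orthogonality. *)
Lemma tail_sum_maximal n lam : 0 < lam ->
  outside_small P (n%:R * c / lam ^+ 2)
    (fun w => forall v, `|\sum_(k < n) eh (Z k w) * (v <= xs (Z k w))%R%:R| < lam).
Proof.
move=> lam0.
pose f w := (\sum_(i < n) eh (Z i w)) ^+ 2 -
    2 * \sum_(i < n) eh (Z i w) * coef lam n i w.
have i1 : Rintegrable P (fun w => (\sum_(i < n) eh (Z i w)) ^+ 2).
  under eq_fun do rewrite expr2 mulr_suml; apply: Rintegrable_sum => i _.
  by under eq_fun do rewrite mulr_sumr; exact: Rintegrable_sum.
have i2 : Rintegrable P (fun w => \sum_(i < n) eh (Z i w) * coef lam n i w).
  by apply: Rintegrable_sum => i _; exact: i_eh_coef.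
have i3 : Rintegrable P (fun w => 2 * \sum_(i < n) eh (Z i w) * coef lam n i w).
  exact: RintegrableZ.
have ff w := crossing_energy lam n (fun k => xs (Z k w)) (fun k => eh (Z k w)).
apply: (@outside_smallS _ _ _ _ _ (fun w => f w < lam ^+ 2)).
  by move=> w fw v; exact: (ff w).2.
apply: markov_outside_small.
- exact: RintegrableB.
- by move=> w; exact: (ff w).1.
- by rewrite exprn_gt0.
- rewrite divfK ?gt_eqF ?exprn_gt0// /f RintegralB//.
  rewrite RintegralZl// Rintegral_sum => [|i _]; last exact: i_eh_coef.
  by rewrite big1 ?mulr0 ?subr0 ?eh_energy.
Qed.

End tail_sum_maximal.

(** * Weak law of large numbers *)

Section weak_law.
Context d d1 (T : measurableType d) (S : measurableType d1) (R : realType)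
  (P : probability T R) (Z : nat -> {mfun T >-> S}) (W : {mfun T >-> S}).
Hypotheses (indZ : independent_seq P Z) (lawZ : forall i, same_law P (Z i) W).

(** The maximal inequality with all abscissas equal to 0: at the threshold 0 the tail sum is the
    full sum, and the bound is Chebyshev's. *)
Let weak_law_centered (g : S -> R) : measurable_fun setT g ->
  Rintegrable P (fun w => g (W w) ^+ 2) -> Rintegrable P (g \o W) ->
  \int[P]_w g (W w) = 0 ->
  forall eta : R, 0 < eta -> whp P (fun n w => `|n%:R^-1 * \sum_(i < n) g (Z i w)| <= eta).
Proof.
move=> mg ig2 ig g0 eta eta0 e e0; set c := \int[P]_w (g (W w) ^+ 2).
have c0 : 0 <= c by apply: Rintegral_ge0 => w _; exact: sqr_ge0.
have mg2 : measurable_fun setT (fun s => g s ^+ 2).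
  by under eq_fun do rewrite expr2; exact: measurable_funM.
have maxi := @tail_sum_maximal _ _ T S R P Z indZ (fun=> 0) g (fun=> 1)
  (measurable_cst _) mg (measurable_cst _) _ c _ _.
near=> n.
have n0 : 0 < n%:R :> R by rewrite ltr0n; near: n; exact: nbhs_infty_gt.
have ne0 : 0 < n%:R * eta by rewrite mulr_gt0.
have small : n%:R * c / (n%:R * eta) ^+ 2 <= e.
  have -> : n%:R * c / (n%:R * eta) ^+ 2 = (c / eta ^+ 2) / n%:R.
    by field; rewrite !gt_eqF.
  rewrite ler_pdivrMr// -ler_pdivrMl//.
  by near: n; exact: nbhs_infty_ger.
have [] := maxi _ _ _ n _ ne0.
- move=> i f mf _; under eq_Rintegral do rewrite mulrC.
  rewrite RintegralZl//; last exact: (same_law_Rintegrable (lawZ i)).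
  by rewrite (same_law_Rintegral (lawZ i) mg) g0 mulr0.
- move=> i; under eq_fun do rewrite mulr1.
  exact: (same_law_Rintegrable (lawZ i) mg2).
- move=> i; under eq_Rintegral do rewrite mulr1.
  exact: (same_law_Rintegral (lawZ i) mg2).
move=> B [mB PB] hB; exists B.
  by split=> //; rewrite (le_trans PB)// lee_fin.
move=> w /hB/(_ 0); under eq_bigr do rewrite lexx !mulr1.
move=> /ltW; rewrite normrM gtr0_norm ?invr_gt0// => h.
by rewrite mulrC ler_pdivrMr// mulrC.
Unshelve. all: by end_near. Qed.

(** Truncation at level [M] makes the variance finite; the truncated part follows the centered law,
    and the remainder is small in mean, uniformly in [n]. *)
Lemma weak_law (g : S -> R) : measurable_fun setT g -> Rintegrable P (g \o W) ->
  forall eta : R, 0 < eta ->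
  whp P (fun n w => `|n%:R^-1 * \sum_(i < n) g (Z i w) - \int[P]_w g (W w)| <= eta).
Proof.
move=> mg ig eta eta0 e e0.
pose t (M : nat) s := if `|g s| <= M%:R then g s else 0.
have mt M : measurable_fun setT (t M).
  apply: measurable_fun_ifT => //; apply: measurable_fun_ler => //.
  exact: measurableT_comp.
have tg M s : `|t M s| <= `|g s| by rewrite /t; case: ifP; rewrite ?normr0.
have tM M s : `|t M s| <= M%:R by rewrite /t; case: ifP; rewrite ?normr0.
have ig' : Rintegrable P (fun w => g (W w)) by exact: ig.
have it M : Rintegrable P (fun w => t M (W w)).
  by apply: (@bounded_Rintegrable _ _ _ P _ M%:R) => [|w]; [exact: measurableT_comp|exact: tM].
pose u M s : R := `|g s - t M s|.
have mu M : measurable_fun setT (u M).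
  by apply: measurableT_comp => //; exact: measurable_funB.
have iu M : Rintegrable P (u M \o W).
  have iD : Rintegrable P (fun w => g (W w) - t M (W w)).
    by apply: RintegrableB; [exact: ig|exact: it].
  exact: (integrable_norm iD).
(* The first bound controls the bias of the truncated mean, the second gives probability at most
   [e / 2] in Markov's inequality at level [eta / 3]. *)
have e3 : 0 < Num.min (eta / 3) (e / 2 * (eta / 3)).
  by rewrite lt_min !mulr_gt0// ?invr_gt0.
have [M uM] : exists M, \int[P]_w u M (W w) <= Num.min (eta / 3) (e / 2 * (eta / 3)).
  have lim : \int[P]_w u M (W w) @[M --> \oo] --> \int[P]_w (0 : R).
    apply: (@Rintegral_dominated_cvg _ _ _ _ _ _ (fun w => `|g (W w)| + `|g (W w)|)).
    - by move=> M; exact: measurableT_comp.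
    - move=> w; apply: cvg_near_cst; near=> M.
      rewrite /u /t ifT ?subrr ?normr0//; near: M; exact: nbhs_infty_ger.
    - by apply: RintegrableD; exact: (integrable_norm ig).
    - move=> M w; rewrite /u normr_id (le_trans (ler_normB _ _))// lerD ?tg//.
  rewrite Rintegral_probability_cst in lim.
  have /cvgrPdist_le/(_ _ e3)[M _ MP] := lim; exists M.
  by have := MP M (leqnn M); rewrite sub0r normrN => /ler_normlW.
rewrite le_min in uM; move: uM => /andP[uM1 uM2].
set mu_t := \int[P]_w t M (W w).
have mean_dist : `|mu_t - \int[P]_w g (W w)| <= eta / 3.
  rewrite /mu_t -RintegralB; [|by []|exact: it|exact: ig'].
  have iD : Rintegrable P (fun w => t M (W w) - g (W w)) by apply: RintegrableB; [exact: it|exact: ig'].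
  apply: le_trans (le_normr_Rintegral _ iD) _ => //.
  by under eq_Rintegral do rewrite distrC.
have centered : whp P
    (fun n w => `|n%:R^-1 * \sum_(i < n) (t M (Z i w) - mu_t)| <= eta / 3).
  apply: (weak_law_centered (g := fun s => t M s - mu_t)); last by rewrite divr_gt0.
  - exact: measurable_funB.
  - apply: (@bounded_Rintegrable _ _ _ P _ ((M%:R + `|mu_t|) ^+ 2)) => [|w].
      by under eq_fun do rewrite expr2; apply: measurable_funM;
        apply: measurable_funB => //; exact: measurableT_comp.
    rewrite normrX ler_sqr ?nnegrE ?addr_ge0// (le_trans (ler_normB _ _))// lerD2r.
    exact: tM.
  - by apply: RintegrableB; [exact: it|exact: Rintegrable_cst].
  - rewrite RintegralB; [|by []|exact: it|exact: Rintegrable_cst].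
    by rewrite Rintegral_probability_cst subrr.
have e20 : 0 < e / 2 by rewrite divr_gt0.
near=> n.
have n0 : 0 < n%:R :> R by rewrite ltr0n; near: n; exact: nbhs_infty_gt.
have rem : outside_small P (e / 2)
    (fun w => n%:R^-1 * \sum_(i < n) u M (Z i w) < eta / 3).
  have iuZ i : Rintegrable P (u M \o Z i) by exact: (same_law_Rintegrable (lawZ i)).
  have iS : Rintegrable P (fun w => \sum_(i < n) u M (Z i w)).
    by apply: Rintegrable_sum => i _; exact: iuZ.
  apply: markov_outside_small.
  - exact: RintegrableZ.
  - move=> w; apply: mulr_ge0; first by rewrite invr_ge0 ltW.
    by apply: sumr_ge0 => i _; exact: normr_ge0.
  - by rewrite divr_gt0.
  - rewrite RintegralZl// Rintegral_sum => [|i _]; last exact: iuZ.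
    rewrite (eq_bigr (fun=> \int[P]_w u M (W w))) => [|i _]; last first.
      exact: (same_law_Rintegral (lawZ i) (mu M)).
    by rewrite sumr_const card_ord -[X in _ * X]mulr_natl mulKf ?gt_eqF.
have cen : outside_small P (e / 2)
    (fun w => `|n%:R^-1 * \sum_(i < n) (t M (Z i w) - mu_t)| <= eta / 3).
  by near: n; exact: centered.
have := outside_smallI cen rem; rewrite (_ : e / 2 + e / 2 = e); last by field.
apply: outside_smallS.
move=> w [h1 h2].
have -> : n%:R^-1 * \sum_(i < n) g (Z i w) - \int[P]_w g (W w) =
  n%:R^-1 * \sum_(i < n) (t M (Z i w) - mu_t) +
  (n%:R^-1 * \sum_(i < n) (g (Z i w) - t M (Z i w)) +
  (mu_t - \int[P]_w g (W w))).
  rewrite !sumrB sumr_const card_ord -[mu_t *+ n]mulr_natl; field.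
  by rewrite gt_eqF.
have h3 : `|n%:R^-1 * \sum_(i < n) (g (Z i w) - t M (Z i w))| <= eta / 3.
  apply: le_trans (ltW h2); rewrite normrM gtr0_norm ?invr_gt0//.
  by apply: ler_wpM2l; [rewrite invr_ge0 ltW|exact: ler_norm_sum].
apply: le_trans (ler_normD _ _) _.
have := ler_normD (n%:R^-1 * \sum_(i < n) (g (Z i w) - t M (Z i w)))
  (mu_t - \int[P]_w g (W w)).
lra.
Unshelve. all: by end_near. Qed.

End weak_law.

(** * Least squares beyond a threshold *)

Section least_squares.
Context (R : realType).
Implicit Types (n : nat) (z : nat -> R * R) (u : R) (th : R * R).

Let quadratic_min (q g : R) : 0 <= q -> (forall t, 0 <= t ^+ 2 * q - 2 * t * g) -> g = 0.
Proof.
(* At [t = g / (q + 1)] the polynomial equals [- g^2 (q + 2) / (q + 1)^2]; the exact minimizer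
   [g / q] would exclude [q = 0]. *)
move=> q0 /(_ (g / (q + 1))) h; apply/eqP; rewrite -sqrf_eq0 eq_le sqr_ge0 andbT.
have q1 : 0 < q + 1 by rewrite ltr_wpDl.
have q2 : 0 < q + 2 by rewrite ltr_wpDl.
have : (g / (q + 1)) ^+ 2 * q - 2 * (g / (q + 1)) * g =
    - (g ^+ 2 * (q + 2)) / (q + 1) ^+ 2 by field; rewrite gt_eqF.
move=> E; rewrite E pmulr_lge0 ?invr_gt0 ?exprn_gt0// oppr_ge0 in h.
by rewrite -(pmulr_lle0 _ q2).
Qed.

(** The first-order condition in the direction [(a, b)]: along [th + t (a, b)] the change of the
    loss is a quadratic polynomial in [t] that never becomes negative. *)
Lemma normal_equations n z u th (a b : R) : is_lse n z u th ->
  \sum_(i < n) ((z i).2 - (th.1 + th.2 * (z i).1)) * (a + b * (z i).1) *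
               (u <= (z i).1)%R%:R = 0.
Proof.
(* For [n = 0] the loss is constantly 0 and carries no information, but the sum is empty. *)
case: n => [|n] lse; first by rewrite big_ord0.
have n0 : 0 < n.+1%:R^-1 :> R by rewrite invr_gt0 ltr0n.
apply: (@quadratic_min (\sum_(i < n.+1) (a + b * (z i).1) ^+ 2 * (u <= (z i).1)%R%:R)).
  by apply: sumr_ge0 => i _; rewrite mulr_ge0 ?sqr_ge0.
move=> t; have := lse (th.1 + t * a, th.2 + t * b).
rewrite /trunc_loss /emp_mean ler_pM2l// -subr_ge0; congr (_ <= _).
rewrite -sumrB !mulr_sumr -sumrB; apply: eq_bigr => i _ /=; ring.
Qed.

(* The n_ij are the entries of the inverse of [[M0, M1], [M1, M2]], and (D1, D2)
   solves the perturbed system with matrix [[m0, m1], [m1, m2]]. *)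
Lemma lse_perturbation (M0 M1 M2 m0 m1 m2 n00 n01 n11 w0 w1 w0' w1' D1 D2 rho : R)
    (V1 := n00 * w0 + n01 * w1) (V2 := n01 * w0 + n11 * w1)
    (k := `|n00| + `|n01| + `|n11|) :
  n00 * M0 + n01 * M1 = 1 -> n00 * M1 + n01 * M2 = 0 ->
  n01 * M0 + n11 * M1 = 0 -> n01 * M1 + n11 * M2 = 1 ->
  m0 * D1 + m1 * D2 = w0' -> m1 * D1 + m2 * D2 = w1' ->
  `|m0 - M0| <= rho -> `|m1 - M1| <= rho -> `|m2 - M2| <= rho ->
  8 * k * rho <= 1 ->
  `|D1 - V1| + `|D2 - V2| <=
    8 * k * rho * (`|V1| + `|V2|) + 4 * k * (`|w0' - w0| + `|w1' - w1|).
Proof.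
move=> e1 e2 e3 e4 f1 f2 h0 h1 h2 hk.
set E1 := D1 - V1; set E2 := D2 - V2.
(* The perturbed system is the unperturbed one with right-hand side [w + g], so the error [E] is the
   inverse matrix applied to [g]. *)
pose g0 := (M0 - m0) * D1 + (M1 - m1) * D2 + (w0' - w0).
pose g1 := (M1 - m1) * D1 + (M2 - m2) * D2 + (w1' - w1).
have E1E : E1 = n00 * g0 + n01 * g1.
  have -> : E1 = (n00 * M0 + n01 * M1) * D1 + (n00 * M1 + n01 * M2) * D2 - V1.
    by rewrite e1 e2 /E1; ring.
  by rewrite /V1 /g0 /g1 -f1 -f2; ring.
have E2E : E2 = n01 * g0 + n11 * g1.
  have -> : E2 = (n01 * M0 + n11 * M1) * D1 + (n01 * M1 + n11 * M2) * D2 - V2.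
    by rewrite e3 e4 /E2; ring.
  by rewrite /V2 /g0 /g1 -f1 -f2; ring.
have D1E : D1 = E1 + V1 by rewrite subrK.
have D2E : D2 = E2 + V2 by rewrite subrK.
clearbody E1 E2 V1 V2.
have k0 : 0 <= k by rewrite !addr_ge0.
have rho0 : 0 <= rho by exact: le_trans h0.
have nD : `|D1| + `|D2| <= `|E1| + `|E2| + (`|V1| + `|V2|).
  by rewrite D1E D2E addrACA lerD ?ler_normD.
have bound (p q x : R) : `|p| <= rho -> `|q| <= rho ->
    `|p * D1 + q * D2 + x| <= rho * (`|D1| + `|D2|) + `|x|.
  move=> hp hq; rewrite (le_trans (ler_normD _ _))// lerD2r.
  by rewrite (le_trans (ler_normD _ _))// mulrDr !normrM lerD// ler_wpM2r.
have b0 : `|g0| <= rho * (`|D1| + `|D2|) + `|w0' - w0| by apply: bound; rewrite distrC.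
have b1 : `|g1| <= rho * (`|D1| + `|D2|) + `|w1' - w1| by apply: bound; rewrite distrC.
clearbody g0 g1.
have nE (p q : R) : `|p| <= k -> `|q| <= k ->
    `|p * g0 + q * g1| <= k * (`|g0| + `|g1|).
  move=> hp hq; rewrite (le_trans (ler_normD _ _))// mulrDr !normrM.
  by rewrite lerD// ler_wpM2r.
have k00 : `|n00| <= k by rewrite /k -addrA lerDl addr_ge0.
have k01 : `|n01| <= k by rewrite /k addrAC lerDr addr_ge0.
have k11 : `|n11| <= k by rewrite /k lerDr addr_ge0.
have a1 := nE _ _ k00 k01; have a2 := nE _ _ k01 k11.
rewrite -E1E in a1; rewrite -E2E in a2.
set e := `|E1| + `|E2| in nD *; set v := `|V1| + `|V2| in nD *.
set wd := `|w0' - w0| + `|w1' - w1|.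
(* [D] has been bounded through the error [e] itself; since [8 * k * rho <= 1], the resulting term
   [4 * k * rho * e] is at most [e / 2] and is absorbed. *)
have : e <= 2 * k * (2 * rho * (e + v) + wd).
  apply: (@le_trans _ _ (2 * (k * (`|g0| + `|g1|)))); first by rewrite /e mulr_natl mulr2n lerD.
  rewrite mulrA ler_wpM2l ?mulr_ge0//.
  have : rho * (`|D1| + `|D2|) <= rho * (e + v) by rewrite ler_wpM2l.
  rewrite /wd; lra.
have e0 : 0 <= e by rewrite addr_ge0.
have kr : 8 * k * rho * e <= e by rewrite ler_piMl.
move=> h; nra.
Qed.

End least_squares.

(** * Asymptotics of the scaled least squares error *)

Section sample_regression.
Context d (T : measurableType d) (R : realType) (P : probability T R).
Variables (Z : nat -> {mfun T >-> (R * R)%type}) (W : {mfun T >-> (R * R)%type}).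
Hypotheses (indZ : independent_seq P Z) (lawZ : forall i, same_law P (Z i) W).
Variables (r : R -> R) (X eps : {mfun T >-> R}).
Hypotheses (mr : measurable_fun setT r) (indep : independent2 P X eps).

Definition residual (s : R * R) : R := s.2 - r s.1.

Hypotheses (XE : forall w, (W w).1 = X w) (epsE : forall w, residual (W w) = eps w).
Hypotheses (i_eps2 : Rintegrable P (fun w => eps w ^+ 2))
  (eps0 : \int[P]_w eps w = 0).
Let sigma2 := \int[P]_w (eps w ^+ 2).

Lemma measurable_residual : measurable_fun setT residual.
Proof. by apply: measurable_funB => //; exact: measurableT_comp. Qed.

Let i_eps : Rintegrable P (fun w => eps w).
Proof.
apply: (@le_Rintegrable _ _ _ _ _ (fun w => eps w ^+ 2 + 1)) => //.
- by move=> w; rewrite ler_norml; apply/andP; split; nra.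
- by apply: RintegrableD => //; exact: Rintegrable_cst.
Qed.

(** Only the product is assumed integrable, not [f (X)], so the product rule for means is replaced
    by Fubini with [eps] integrated first. *)
Lemma residual_mean0 (f : R -> R) : measurable_fun setT f ->
  Rintegrable P (fun w => residual (W w) * f (W w).1) ->
  \int[P]_w (residual (W w) * f (W w).1) = 0.
Proof.
move=> mf; under eq_fun do rewrite epsE XE.
move=> iF.
have indep' : independent2 P eps X.
  by move=> A B mA mB; rewrite setIC indep// muleC.
have mF : measurable_fun setT (fun q : R * R => q.1 * f q.2).
  by apply: measurable_funM => //; exact: measurableT_comp.
have decoupled := independent_integral indep' mF iF.
apply: EFin_inj; rewrite (EFin_Rintegral iF); apply: etrans decoupled _.
rewrite -[RHS](integral0 P setT); apply: eq_integral => w _ /=.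
have iw : Rintegrable P (fun w' => f (X w) * eps w') by exact: RintegrableZ.
under eq_integral do rewrite mulrC.
by rewrite -EFin_Rintegral// RintegralZl// eps0 mulr0.
Qed.

Lemma residual_sqr (g : R -> R) : measurable_fun setT g ->
  Rintegrable P (fun w => g (X w)) ->
  Rintegrable P (fun w => residual (W w) ^+ 2 * g (W w).1) /\
  \int[P]_w (residual (W w) ^+ 2 * g (W w).1) = sigma2 * \int[P]_w g (X w).
Proof.
move=> mg ig.
have indep' : independent2 P eps X.
  by move=> A B mA mB; rewrite setIC indep// muleC.
have m2 : measurable_fun setT (fun x : R => x ^+ 2) by exact: exprn_measurable.
have [h1 h2] := independent_RintegralM indep' m2 mg i_eps2 ig.
split.
  by under eq_fun do rewrite epsE XE.
by under eq_Rintegral do rewrite epsE XE; rewrite h2.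
Qed.

(** With [h] constantly 1 and [h] the identity, these are the two coordinates of [W_n (v)]. *)
Definition tail_stat (h : R -> R) (n : nat) (v : R) (w : T) : R :=
  (Num.sqrt n%:R)^-1 *
  \sum_(i < n) residual (Z i w) * h (Z i w).1 * (v <= (Z i w).1)%R%:R.

Let maximal (h : R -> R) n (K : R) : measurable_fun setT h ->
  Rintegrable P (fun w => h (X w) ^+ 2) -> 0 < K -> (0 < n)%N ->
  outside_small P (sigma2 * \int[P]_w (h (X w) ^+ 2) / K ^+ 2)
    (fun w => forall v, `|tail_stat h n v w| < K).
Proof.
move=> mh ih K0 n0; have nR : 0 < n%:R :> R by rewrite ltr0n.
have s0 : 0 < Num.sqrt n%:R :> R by rewrite sqrtr_gt0.
have mh2 : measurable_fun setT (fun x => h x ^+ 2).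
  by under eq_fun do rewrite expr2; exact: measurable_funM.
have [i2 e2] := residual_sqr mh2 ih.
have mrh : measurable_fun setT (fun s : R * R => (residual s * h s.1) ^+ 2).
  apply: (@measurableT_comp _ _ _ _ _ _ (fun x : R => x ^+ 2)) => //.
  apply: measurable_funM; first exact: measurable_residual.
  exact: measurableT_comp.
have i2' : Rintegrable P (fun w => (residual (W w) * h (W w).1) ^+ 2).
  by under eq_fun do rewrite exprMn.
have := @tail_sum_maximal _ _ T _ R P Z indZ fst residual h measurable_fst
  measurable_residual mh _ (sigma2 * \int[P]_w (h (X w) ^+ 2)) _ _ n
  (Num.sqrt n%:R * K).
have -> : n%:R * (sigma2 * \int[P]_w (h (X w) ^+ 2)) / (Num.sqrt n%:R * K) ^+ 2
    = sigma2 * \int[P]_w (h (X w) ^+ 2) / K ^+ 2.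
  rewrite exprMn sqr_sqrtr ?ltW//; field; rewrite !gt_eqF//.
move=> maxi; apply: outside_smallS (maxi _ _ _ _).
- move=> w hw v; rewrite /tail_stat normrM gtr0_norm ?invr_gt0// mulrC.
  by rewrite ltr_pdivrMr// mulrC; exact: hw.
- move=> i f mf i_f.
  have mrf : measurable_fun setT (fun s : R * R => residual s * f s.1).
    apply: measurable_funM; first exact: measurable_residual.
    exact: measurableT_comp.
  have lawZ' : same_law P W (Z i) by move=> A mA; rewrite lawZ.
  rewrite (same_law_Rintegral (lawZ i) mrf) residual_mean0//.
  exact: (same_law_Rintegrable lawZ' mrf).
- by move=> i; exact: (same_law_Rintegrable (lawZ i) mrh).
- move=> i; rewrite (same_law_Rintegral (lawZ i) mrh) -e2.
  by apply: eq_Rintegral => w _; rewrite exprMn.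
- by rewrite mulr_gt0.
Qed.

Lemma tail_stat_tight (h : R -> R) (e : R) : measurable_fun setT h ->
  Rintegrable P (fun w => h (X w) ^+ 2) -> 0 < e ->
  exists2 K, 0 < K & forall n, (0 < n)%N ->
    outside_small P e (fun w => forall v, `|tail_stat h n v w| < K).
Proof.
move=> mh ih e0; set c := sigma2 * \int[P]_w (h (X w) ^+ 2).
have c0 : 0 <= c by apply: mulr_ge0; apply: Rintegral_ge0 => w _; exact: sqr_ge0.
(* This gives [c / K ^+ 2 <= e]; the [+ 1] keeps the level positive when [c = 0]. *)
exists (Num.sqrt (c / e) + 1) => [|n n0]; first by rewrite ltr_wpDl// sqrtr_ge0.
have K0 : 0 < Num.sqrt (c / e) + 1 by rewrite ltr_wpDl ?sqrtr_ge0.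
have [B [mB PB] hB] := maximal mh ih K0 n0; exists B => //; split => //.
rewrite (le_trans PB)// lee_fin -/c ler_pdivrMr ?exprn_gt0// mulrC -ler_pdivrMr//.
rewrite -[leLHS]sqr_sqrtr ?divr_ge0 ?(ltW e0)// ler_sqr ?nnegrE ?sqrtr_ge0 ?(ltW K0)//.
by rewrite lerDl.
Qed.

Variable v0 : R.
Hypothesis noatom : P [set w | X w = v0] = 0%E.

Let window (dl x : R) : R := (`|x - v0| <= dl)%R%:R.

Let measurable_window dl : measurable_fun setT (window dl).
Proof.
rewrite [X in measurable_fun _ X](_ : _ = fun x => if `|x - v0| <= dl then 1 else 0).
  apply: measurable_fun_ifT => //; apply: measurable_fun_ler => //.
  by apply: measurableT_comp => //; exact: measurable_funB.
by apply/funext => x; rewrite /window; case: ifP.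
Qed.

Let window_ge0 dl x : 0 <= window dl x. Proof. exact: ler0n. Qed.

Let window_le1 dl x : window dl x <= 1. Proof. by rewrite lern1 leq_b1. Qed.

Let window_diff dl v x : `|v - v0| <= dl ->
  `|(v <= x)%R%:R - (v0 <= x)%R%:R| <= window dl x /\
  (v <= x)%R%:R - (v0 <= x)%R%:R =
  window dl x * ((v <= x)%R%:R - (v0 <= x)%R%:R) :> R.
Proof.
rewrite ler_norml => /andP[d1 d2]; rewrite /window.
case: (leP v x) => vx; case: (leP v0 x) => v0x; rewrite ?subrr ?normr0 ?mulr0 ?ler0n//.
- have -> : `|x - v0| <= dl by rewrite ler_norml; apply/andP; split; lra.
  by rewrite subr0 normr1 mul1r.
- have -> : `|x - v0| <= dl by rewrite ler_norml; apply/andP; split; lra.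
  by rewrite sub0r normrN normr1 mul1r.
Qed.

(** As the window shrinks, dominated convergence leaves the integral over the event [X = v0], which
    is null. *)
Let window_small (g : R -> R) (e : R) : measurable_fun setT g ->
  Rintegrable P (fun w => g (X w)) -> 0 < e ->
  exists2 dl, 0 < dl & \int[P]_w (`|g (X w)| * window dl (X w)) <= e.
Proof.
move=> mg ig e0.
have mgX : measurable_fun setT (fun w => `|g (X w)|).
  by do 2 apply: measurableT_comp => //.
have lim : \int[P]_w (`|g (X w)| * window k.+1%:R^-1 (X w)) @[k --> \oo] -->
    \int[P]_w (`|g (X w)| * (X w == v0)%:R).
  apply: (@Rintegral_dominated_cvg _ _ _ _ _ _ (fun w => `|g (X w)|)).
  - move=> k; apply: measurable_funM => //; exact: measurableT_comp.
  - move=> w; apply: cvgM; first exact: cvg_cst.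
    have [->|Xv] := eqVneq (X w) v0; rewrite /window.
      by under eq_fun do rewrite subrr normr0 invr_ge0 ler0n; exact: cvg_cst.
    have d0 : 0 < `|X w - v0| by rewrite normr_gt0 subr_eq0.
    apply: cvg_near_cst; near=> k; rewrite leNgt (_ : _ < _ = true)//.
    rewrite -invf_plt ?posrE ?ltr0n//.
    apply: (@lt_le_trans _ _ k%:R); last by rewrite ler_nat.
    near: k; exact: nbhs_infty_gtr.
  - exact: (integrable_norm ig).
  - move=> k w; rewrite ger0_norm ?mulr_ge0// ler_piMr//.
have lim0 : \int[P]_w (`|g (X w)| * (X w == v0)%:R) = 0.
  have m1 : measurable_fun setT (fun w => `|g (X w)| * (X w == v0)%:R).
    apply: measurable_funM => //.
    rewrite [X in measurable_fun _ X](_ : _ = fun w => if X w == v0 then 1 else 0).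
      by apply: measurable_fun_ifT => //; exact: measurable_fun_eqr.
    by apply/funext => w; case: eqP.
  rewrite /Rintegral (ae_eq_integral (cst 0%E)) ?integral0//.
    exact/measurable_EFinP.
  exists [set w | X w = v0]; split => //.
    have := measurable_funPT X measurableT [set v0] (measurable_set1 v0).
    by rewrite setTI.
  by move=> w /= h; apply: contrapT => /eqP/negPf Xv; apply: h => _; rewrite Xv mulr0.
rewrite lim0 in lim.
have /cvgrPdist_le/(_ _ e0)[k _ kP] := lim; exists k.+1%:R^-1; first by rewrite invr_gt0 ltr0n.
by have := kP k (leqnn k); rewrite sub0r normrN => /ler_normlW.
Unshelve. all: by end_near. Qed.

Lemma tail_stat_equicontinuous (h : R -> R) (e eta : R) : measurable_fun setT h ->
  Rintegrable P (fun w => h (X w) ^+ 2) -> 0 < e -> 0 < eta ->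
  exists2 dl, 0 < dl & forall n, (0 < n)%N ->
    outside_small P e (fun w => forall v, `|v - v0| <= dl ->
      `|tail_stat h n v w - tail_stat h n v0 w| <= eta).
Proof.
move=> mh ih e0 eta0.
have mh2 : measurable_fun setT (fun x => h x ^+ 2).
  by under eq_fun do rewrite expr2; exact: measurable_funM.
have s0 : 0 <= sigma2 by apply: Rintegral_ge0 => w _; exact: sqr_ge0.
have s1 : 0 < sigma2 + 1 by rewrite ltr_wpDl.
(* Chosen so that the maximal inequality at level [eta / 2] fails with probability at most [e];
   [sigma2 + 1] covers a vanishing variance. *)
have b0 : 0 < e * (eta / 2) ^+ 2 / (sigma2 + 1).
  by rewrite divr_gt0// mulr_gt0// exprn_gt0// divr_gt0.
have [dl dl0 small] := window_small mh2 ih b0.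
exists dl => // n n0; pose hw x := h x * window dl x.
have mhw : measurable_fun setT hw by exact: measurable_funM.
have hwE x : hw x ^+ 2 = `|h x ^+ 2| * window dl x.
  rewrite exprMn ger0_norm ?sqr_ge0//; congr (_ * _).
  by rewrite /window; case: (_ <= dl); rewrite ?expr1n ?expr0n.
have ihw : Rintegrable P (fun w => hw (X w) ^+ 2).
  apply: (@le_Rintegrable _ _ _ _ _ (fun w => h (X w) ^+ 2)) => //.
    apply: (@measurableT_comp _ _ _ _ _ _ (fun x => hw x ^+ 2)) => //.
    by under eq_fun do rewrite expr2; exact: measurable_funM.
  move=> w; rewrite ger0_norm ?sqr_ge0// hwE ger0_norm ?sqr_ge0//.
  by rewrite ler_piMr ?sqr_ge0.
have eta20 : 0 < eta / 2 by rewrite divr_gt0.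
have [B [mB PB] hB] := maximal mhw ihw eta20 n0.
exists B.
  split=> //; rewrite (le_trans PB)// lee_fin ler_pdivrMr ?exprn_gt0//.
  under eq_Rintegral do rewrite hwE.
  apply: le_trans (ler_wpM2l s0 small) _.
  rewrite mulrA ler_pdivrMr// mulrC ler_wpM2l// ?lerDl//.
  by rewrite mulr_ge0 ?sqr_ge0// ltW.
move=> w /hB tight v vdl.
(* The two indicators differ only inside the window, so [h] may be replaced by [hw], for which both
   statistics are below [eta / 2]. *)
have -> : tail_stat h n v w - tail_stat h n v0 w = tail_stat hw n v w - tail_stat hw n v0 w.
  rewrite /tail_stat -!mulrBr -!sumrB; congr (_ * _); apply: eq_bigr => i _.
  transitivity (residual (Z i w) * h (Z i w).1 *
    ((v <= (Z i w).1)%R%:R - (v0 <= (Z i w).1)%R%:R)); first by ring.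
  by rewrite (window_diff _ vdl).2 /hw; ring.
rewrite (le_trans (ler_normB _ _))//; have := tight v; have := tight v0; lra.
Qed.

Definition tail_moment (g : R -> R) (n : nat) (v : R) (w : T) : R :=
  n%:R^-1 * \sum_(i < n) g (Z i w).1 * (v <= (Z i w).1)%R%:R.

(** Two weak laws serve all [v]: one at [v0], and one for [|g|] on the window, which dominates the
    change from [v0] to [v]. The window mean, its fluctuation and the fluctuation at [v0] take a
    third of [eta] each. *)
Lemma tail_moment_cvg (g : R -> R) (e eta : R) : measurable_fun setT g ->
  Rintegrable P (fun w => g (X w)) -> 0 < e -> 0 < eta ->
  exists2 dl, 0 < dl & \forall n \near \oo,
    outside_small P e (fun w => forall v, `|v - v0| <= dl ->
      `|tail_moment g n v w - \int[P]_w (g (X w) * (v0 <= X w)%R%:R)| <= eta).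
Proof.
move=> mg ig e0 eta0; have eta30 : 0 < eta / 3 by rewrite divr_gt0.
have e20 : 0 < e / 2 by rewrite divr_gt0.
have [dl dl0 small] := window_small mg ig eta30.
exists dl => //.
have mI : measurable_fun setT (fun x : R => (v0 <= x)%R%:R : R).
  rewrite [A in measurable_fun _ A](_ : _ = fun x => if v0 <= x then 1 else 0).
    by apply: measurable_fun_ifT => //; exact: measurable_fun_ler.
  by apply/funext => x; case: ifP.
have mg1 : measurable_fun setT (fun s : R * R => g s.1 * (v0 <= s.1)%R%:R).
  apply: (@measurableT_comp _ _ _ _ _ _ (fun x => g x * (v0 <= x)%R%:R)) => //.
  exact: measurable_funM.
have mg2 : measurable_fun setT (fun s : R * R => `|g s.1| * window dl s.1).
  apply: (@measurableT_comp _ _ _ _ _ _ (fun x => `|g x| * window dl x)) => //.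
  by apply: measurable_funM => //; exact: measurableT_comp.
have dominated (b : R -> R) : measurable_fun setT b -> (forall x, `|b x| <= `|g x|) ->
    Rintegrable P (fun w => b (W w).1).
  move=> mb bg; under eq_fun do rewrite XE.
  apply: (@le_Rintegrable _ _ _ _ _ (fun w => `|g (X w)|)) => //.
    exact: measurableT_comp.
  exact: (integrable_norm ig).
have i1 : Rintegrable P (fun w => g (W w).1 * (v0 <= (W w).1)%R%:R).
  apply: (dominated (fun x => g x * (v0 <= x)%R%:R)) => [|x]; first exact: measurable_funM.
  by rewrite normrM ler_piMr//; case: (v0 <= x); rewrite ?normr1 ?normr0.
have i2 : Rintegrable P (fun w => `|g (W w).1| * window dl (W w).1).
  apply: (dominated (fun x => `|g x| * window dl x)) => [|x].
    by apply: measurable_funM => //; exact: measurableT_comp.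
  by rewrite normrM normr_id ler_piMr// ger0_norm.
have law1 := weak_law indZ lawZ mg1 i1 eta30.
have law2 := weak_law indZ lawZ mg2 i2 eta30.
apply: filterS2 (nbhs_infty_gt 0) (whpI law1 law2 e0) => n npos.
have n0 : 0 < n%:R :> R by rewrite ltr0n.
apply: outside_smallS.
move=> w [h1 h2] v vdl.
have I1 : \int[P]_w (g (W w).1 * (v0 <= (W w).1)%R%:R) =
    \int[P]_w (g (X w) * (v0 <= X w)%R%:R) by apply: eq_Rintegral => ? _; rewrite XE.
have I2 : \int[P]_w (`|g (W w).1| * window dl (W w).1) <= eta / 3.
  by under eq_Rintegral do rewrite XE.
rewrite I1 in h1.
rewrite -(subrKA (tail_moment g n v0 w)) (le_trans (ler_normD _ _))//.
have : `|tail_moment g n v w - tail_moment g n v0 w| <=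
    n%:R^-1 * \sum_(i < n) `|g (Z i w).1| * window dl (Z i w).1.
  rewrite /tail_moment -mulrBr -sumrB normrM gtr0_norm ?invr_gt0//.
  apply: ler_wpM2l; first by rewrite invr_ge0 ltW.
  rewrite (le_trans (ler_norm_sum _ _ _))//; apply: ler_sum => i _.
  by rewrite -mulrBr normrM ler_wpM2l//; exact: (window_diff _ vdl).1.
have h1' : `|tail_moment g n v0 w - \int[P]_w (g (X w) * (v0 <= X w)%R%:R)| <= eta / 3.
  exact: h1.
move: h2; rewrite ler_norml => /andP[_]; lra.
Qed.

Hypothesis i_X2 : Rintegrable P (fun w => X w ^+ 2).

Let scaled dd (TT : measurableType dd) (m : probability TT R) (k : R) (f : TT -> R) :
  Rintegrable m f -> \int[m]_x (k * f x) = k * \int[m]_x f x.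
Proof. by move=> fi; rewrite RintegralZl. Qed.

Definition tail_mean (g : R -> R) : R := \int[P]_w (g (X w) * (v0 <= X w)%R%:R).

Let M0 := tail_mean (fun=> 1).
Let M1 := tail_mean id.
Let M2 := tail_mean (fun x => x ^+ 2).

Let measurable_tail : measurable_fun setT (fun x : R => (v0 <= x)%R%:R : R).
Proof.
rewrite [A in measurable_fun _ A](_ : _ = fun x => if v0 <= x then 1 else 0).
  by apply: measurable_fun_ifT => //; exact: measurable_fun_ler.
by apply/funext => x; case: ifP.
Qed.

Let Rintegrable_tail (g : R -> R) : measurable_fun setT g ->
  Rintegrable P (fun w => g (X w)) ->
  Rintegrable P (fun w => g (X w) * (v0 <= X w)%R%:R).
Proof.
move=> mg ig; apply: (@le_Rintegrable _ _ _ _ _ (fun w => `|g (X w)|)).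
- apply: (@measurableT_comp _ _ _ _ _ _ (fun x => g x * (v0 <= x)%R%:R)) => //.
  exact: measurable_funM.
- by move=> w; rewrite normrM ler_piMr//; case: (v0 <= _); rewrite ?normr1 ?normr0.
- exact: (integrable_norm ig).
Qed.

Let i_X : Rintegrable P (fun w => X w).
Proof.
apply: (@le_Rintegrable _ _ _ _ _ (fun w => X w ^+ 2 + 1)) => //.
- by move=> w; rewrite ler_norml; apply/andP; split; nra.
- by apply: RintegrableD => //; exact: Rintegrable_cst.
Qed.

Definition tail_affine (a b x : R) : R := (a + b * x) * (v0 <= x)%R%:R.

Let measurable_tail_affine a b : measurable_fun setT (tail_affine a b).
Proof.
by apply: measurable_funM => //; apply: measurable_funD => //.
Qed.

Lemma tail_affine_moment a b c e :
  Rintegrable P (fun w => tail_affine a b (X w) * tail_affine c e (X w)) /\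
  \int[P]_w (tail_affine a b (X w) * tail_affine c e (X w)) =
  a * c * tail_mean (fun=> 1) + (a * e + b * c) * tail_mean id +
  b * e * tail_mean (fun x => x ^+ 2).
Proof.
have E w : tail_affine a b (X w) * tail_affine c e (X w) =
    (a * c) * (1 * (v0 <= X w)%R%:R) + (a * e + b * c) * (X w * (v0 <= X w)%R%:R) +
    (b * e) * (X w ^+ 2 * (v0 <= X w)%R%:R).
  by rewrite /tail_affine; case: (v0 <= X w) => /=; ring.
have j0 : Rintegrable P (fun w => 1 * (v0 <= X w)%R%:R).
  by apply: (@Rintegrable_tail (fun=> 1)) => //; exact: Rintegrable_cst.
have j1 : Rintegrable P (fun w => X w * (v0 <= X w)%R%:R).
  exact: (@Rintegrable_tail id).
have j2 : Rintegrable P (fun w => X w ^+ 2 * (v0 <= X w)%R%:R).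
  exact: (@Rintegrable_tail (fun x => x ^+ 2)).
have i0 := RintegrableZ (a * c) j0.
have i1 := RintegrableZ (a * e + b * c) j1.
have i2 := RintegrableZ (b * e) j2.
have i01 := RintegrableD i0 i1.
split; first by under eq_fun do rewrite E; exact: RintegrableD.
under eq_Rintegral do rewrite E.
rewrite (RintegralD measurableT i01 i2)// (RintegralD measurableT i0 i1)//.
by rewrite (scaled _ j0)// (scaled _ j1)// (scaled _ j2).
Qed.

Let score a b (s : R * R) : R := residual s * tail_affine a b s.1.

Let measurable_score a b : measurable_fun setT (score a b).
Proof.
by apply: measurable_funM; [exact: measurable_residual|exact: measurableT_comp].
Qed.

Let score_cov a b c e :
  Rintegrable P (fun w => score a b (W w) * score c e (W w)) /\
  \int[P]_w (score a b (W w) * score c e (W w)) =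
  sigma2 * (a * c * M0 + (a * e + b * c) * M1 + b * e * M2).
Proof.
have [iq eq] := tail_affine_moment a b c e; rewrite -eq.
have mq : measurable_fun setT (fun x => tail_affine a b x * tail_affine c e x).
  exact: measurable_funM.
have [iqs eqs] := residual_sqr mq iq; rewrite -eqs.
have E w : score a b (W w) * score c e (W w) =
    residual (W w) ^+ 2 * (tail_affine a b (W w).1 * tail_affine c e (W w).1).
  by rewrite /score; ring.
by split; [under eq_fun do rewrite E|apply: eq_Rintegral => w _; rewrite E].
Qed.

Let score_mean a b :
  Rintegrable P (fun w => score a b (W w)) /\ \int[P]_w score a b (W w) = 0.
Proof.
have i1 : Rintegrable P (fun w => score a b (W w)).
  apply: (@le_Rintegrable _ _ _ _ _ (fun w => score a b (W w) * score a b (W w) + 1)).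
  - exact: measurableT_comp.
  - by move=> w; rewrite ler_norml; apply/andP; split; nra.
  - by apply: RintegrableD; [exact: (score_cov _ _ _ _).1|exact: Rintegrable_cst].
by split => //; apply: residual_mean0.
Qed.

(** The inverse design matrix, and below the factor [a11], ..., [a22] of the limit covariance, are
    described by scalar equations, which keeps matrices out of the limit argument. *)
Variables n00 n01 n11 : R.
Hypotheses (NM00 : n00 * M0 + n01 * M1 = 1) (NM01 : n00 * M1 + n01 * M2 = 0)
  (NM10 : n01 * M0 + n11 * M1 = 0) (NM11 : n01 * M1 + n11 * M2 = 1).

Variables a11 a12 a21 a22 : R.
Hypotheses (cov11 : a11 ^+ 2 + a12 ^+ 2 = sigma2 * n00)
  (cov12 : a11 * a21 + a12 * a22 = sigma2 * n01)
  (cov22 : a21 ^+ 2 + a22 ^+ 2 = sigma2 * n11).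

Let V1 n w := n00 * tail_stat (fun=> 1) n v0 w + n01 * tail_stat id n v0 w.
Let V2 n w := n01 * tail_stat (fun=> 1) n v0 w + n11 * tail_stat id n v0 w.

Let binormal_form (a b c e : R) :
  Rintegrable (std_binormal R) (fun z => (a * z.1 + b * z.2) * (c * z.1 + e * z.2)) /\
  \int[std_binormal R]_z ((a * z.1 + b * z.2) * (c * z.1 + e * z.2)) = a * c + b * e.
Proof.
have E (z : R * R) : (a * z.1 + b * z.2) * (c * z.1 + e * z.2) =
    a * c * z.1 ^+ 2 + b * e * z.2 ^+ 2 + (a * e + b * c) * (z.1 * z.2) by ring.
have i1 := RintegrableZ (a * c) (Rintegrable_binormal_sqr1 R).
have i2 := RintegrableZ (b * e) (Rintegrable_binormal_sqr2 R).
have [i12 e12] := binormal_cross R.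
have i3 := RintegrableZ (a * e + b * c) i12.
split.
  by under eq_fun do rewrite E; apply: RintegrableD => //; exact: RintegrableD.
under eq_Rintegral do rewrite E.
rewrite (RintegralD measurableT (RintegrableD i1 i2) i3)// (RintegralD measurableT i1 i2)//.
rewrite (scaled _ (Rintegrable_binormal_sqr1 R))//.
rewrite (scaled _ (Rintegrable_binormal_sqr2 R))// (scaled _ i12)//.
by rewrite binormal_sqr1 binormal_sqr2 e12; ring.
Qed.

Let binormal_lin (a b : R) :
  Rintegrable (std_binormal R) (fun z => a * z.1 + b * z.2) /\
  \int[std_binormal R]_z (a * z.1 + b * z.2) = 0.
Proof.
have i1 := RintegrableZ a (Rintegrable_binormal1 R).
have i2 := RintegrableZ b (Rintegrable_binormal2 R).
split; first exact: RintegrableD.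
rewrite (RintegralD measurableT i1 i2)// (scaled _ (Rintegrable_binormal1 R))//.
rewrite (scaled _ (Rintegrable_binormal2 R))// binormal_mean1 binormal_mean2.
by ring.
Qed.

(** The factor [- s] is absorbed into the coefficients of the scores and of the normal vector, so
    the limit theorem is applied once for each [s]. *)
Lemma cvg_tail_stat_kernel (s x y : R) :
  \int[P]_w (cker (x - s * V1 n w) * cker (y - s * V2 n w)) @[n --> \oo] -->
  \int[std_binormal R]_z (cker (x - s * (a11 * z.1 + a12 * z.2)) *
                          cker (y - s * (a21 * z.1 + a22 * z.2))).
Proof.
pose xi1 := score (- s * n00) (- s * n01); pose xi2 := score (- s * n01) (- s * n11).
have ntv a b n w : - s * (a * tail_stat (fun=> 1) n v0 w + b * tail_stat id n v0 w) =
    (Num.sqrt n%:R)^-1 * \sum_(i < n) score (- s * a) (- s * b) (Z i w).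
  rewrite /tail_stat !(mulrCA _ (Num.sqrt n%:R)^-1) -mulrDr mulrCA; congr (_ * _).
  rewrite !mulr_sumr -big_split/= mulr_sumr; apply: eq_bigr => i _.
  by rewrite /score /tail_affine; ring.
have [i11 e11] := score_cov (- s * n00) (- s * n01) (- s * n00) (- s * n01).
have [_ e12] := score_cov (- s * n00) (- s * n01) (- s * n01) (- s * n11).
have [i22 e22] := score_cov (- s * n01) (- s * n11) (- s * n01) (- s * n11).
have [j1 f1] := score_mean (- s * n00) (- s * n01).
have [j2 f2] := score_mean (- s * n01) (- s * n11).
have [k11 g11] := binormal_form (- s * a11) (- s * a12) (- s * a11) (- s * a12).
have [_ g12] := binormal_form (- s * a11) (- s * a12) (- s * a21) (- s * a22).
have [k22 g22] := binormal_form (- s * a21) (- s * a22) (- s * a21) (- s * a22).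
have [k1 h1] := binormal_lin (- s * a11) (- s * a12).
have [k2 h2] := binormal_lin (- s * a21) (- s * a22).
have clt := @cvg_clt_kernel _ _ T _ R P Z W indZ lawZ xi1 xi2
  (measurable_score _ _) (measurable_score _ _) (std_binormal R)
  (fun s t G => @std_binormal_stable R s t G)
  (- s * a11) (- s * a12) (- s * a21) (- s * a22)
  i11 i22 j1 j2 f1 f2 k1 k2 k11 k22 h1 h2 _ _ _ x y.
(* These are the entries of [N M N = N], with [N] the inverse of [M]: applying [N] to scores of
   covariance [sigma2 M] gives covariance [sigma2 N]. *)
have k00 : n00 * n00 * M0 + (n00 * n01 + n01 * n00) * M1 + n01 * n01 * M2 = n00.
  transitivity (n00 * (n00 * M0 + n01 * M1) + n01 * (n00 * M1 + n01 * M2)); first by ring.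
  by rewrite NM00 NM01; ring.
have k01 : n00 * n01 * M0 + (n00 * n11 + n01 * n01) * M1 + n01 * n11 * M2 = n01.
  transitivity (n01 * (n00 * M0 + n01 * M1) + n11 * (n00 * M1 + n01 * M2)); first by ring.
  by rewrite NM00 NM01; ring.
have k1' : n01 * n01 * M0 + (n01 * n11 + n11 * n01) * M1 + n11 * n11 * M2 = n11.
  transitivity (n01 * (n01 * M0 + n11 * M1) + n11 * (n01 * M1 + n11 * M2)); first by ring.
  by rewrite NM10 NM11; ring.
have scale_cov (a b c e a1 a2 c1 c2 m : R) :
    a * c * M0 + (a * e + b * c) * M1 + b * e * M2 = m ->
    a1 * c1 + a2 * c2 = sigma2 * m ->
    sigma2 * (- s * a * (- s * c) * M0 +
      (- s * a * (- s * e) + - s * b * (- s * c)) * M1 + - s * b * (- s * e) * M2) =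
    - s * a1 * (- s * c1) + - s * a2 * (- s * c2).
  move=> m1 m2.
  transitivity (s ^+ 2 * (sigma2 * (a * c * M0 + (a * e + b * c) * M1 + b * e * M2))).
    by ring.
  by rewrite m1 -m2; ring.
have {}clt := clt (etrans e11 (etrans (scale_cov _ _ _ _ _ _ _ _ _ k00 cov11) (esym g11)))
  (etrans e12 (etrans (scale_cov _ _ _ _ _ _ _ _ _ k01 cov12) (esym g12)))
  (etrans e22 (etrans (scale_cov _ _ _ _ _ _ _ _ _ k1' cov22) (esym g22))).
have limE : \int[std_binormal R]_z (cker (x - s * (a11 * z.1 + a12 * z.2)) *
      cker (y - s * (a21 * z.1 + a22 * z.2))) =
    \int[std_binormal R]_z (cker (x + (- s * a11 * z.1 + - s * a12 * z.2)) *
      cker (y + (- s * a21 * z.1 + - s * a22 * z.2))).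
  by apply: eq_Rintegral => z _; congr (cker _ * cker _); ring.
rewrite limE; apply: cvg_trans clt.
apply: near_eq_cvg; apply: nearW => n; apply: eq_Rintegral => w _.
by rewrite -!ntv !mulNr.
Qed.

Variables (u0 psi alpha0 beta0 : R) (uhat : nat -> T -> R) (theta : nat -> T -> R * R).
Hypotheses (psi0 : 0 < psi) (v0E : v0 = u0 + psi).
Hypothesis linear : {ae P, forall w, forall i, u0 < (Z i w).1 ->
  r (Z i w).1 = alpha0 + beta0 * (Z i w).1}.
Hypotheses (muhat : forall n, measurable_fun setT (uhat n))
  (uhat_cvg : cvg_in_prob P uhat u0).
Hypotheses (lse : forall n w, is_lse n (fun i => Z i w) (uhat n w + psi) (theta n w))
  (mtheta : forall n, measurable_fun setT (theta n)).

Let D1 n w := Num.sqrt n%:R * ((theta n w).1 - alpha0).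
Let D2 n w := Num.sqrt n%:R * ((theta n w).2 - beta0).

Let mD1 n : measurable_fun setT (D1 n).
Proof.
apply: measurable_funM => //; apply: measurable_funB => //.
exact: measurableT_comp.
Qed.

Let mD2 n : measurable_fun setT (D2 n).
Proof.
apply: measurable_funM => //; apply: measurable_funB => //.
exact: measurableT_comp.
Qed.

Let measurable_tail_stat h n : measurable_fun setT h ->
  measurable_fun setT (tail_stat h n v0).
Proof.
move=> mh; apply: measurable_funM => //; apply: measurable_sum => i.
apply: measurable_funM; last exact: measurableT_comp (measurableT_comp measurable_tail measurable_fst) _.
apply: measurable_funM; first exact: measurableT_comp measurable_residual _.
exact: measurableT_comp (measurableT_comp mh measurable_fst) _.
Qed.

Let mV1 n : measurable_fun setT (V1 n).
Proof.
by apply: measurable_funD; apply: measurable_funM => //; exact: measurable_tail_stat.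
Qed.

Let mV2 n : measurable_fun setT (V2 n).
Proof.
by apply: measurable_funD; apply: measurable_funM => //; exact: measurable_tail_stat.
Qed.

(** Every observation kept has abscissa at least [v > u0], where the response is affine plus the
    residual; the normal equation in the direction [(a, b)] is then linear in the scaled error. *)
Let scaled_normal_equation n w (v := uhat n w + psi) a b : (0 < n)%N -> u0 < v ->
  (forall i, u0 < (Z i w).1 -> r (Z i w).1 = alpha0 + beta0 * (Z i w).1) ->
  tail_stat (fun x => a + b * x) n v w =
  tail_moment (fun x => a + b * x) n v w * D1 n w +
  tail_moment (fun x => x * (a + b * x)) n v w * D2 n w.
Proof.
move=> n0 u0v lin; have s0 : 0 < Num.sqrt n%:R :> R by rewrite sqrtr_gt0 ltr0n.
have sE : n%:R^-1 * Num.sqrt n%:R = (Num.sqrt n%:R)^-1 :> R.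
  by rewrite -[X in X^-1 * _]sqr_sqrtr ?ler0n//; field; rewrite gt_eqF.
rewrite /tail_stat /tail_moment /D1 /D2.
have -> (A B d1 d2 : R) : n%:R^-1 * A * (Num.sqrt n%:R * d1) +
    n%:R^-1 * B * (Num.sqrt n%:R * d2) = (Num.sqrt n%:R)^-1 * (A * d1 + B * d2).
  by rewrite -sE; ring.
congr (_ * _); apply/eqP; rewrite -subr_eq0; apply/eqP.
rewrite -[RHS](normal_equations a b (lse n w)) -/v.
rewrite !mulr_suml -big_split/= -sumrB; apply: eq_bigr => i _.
have [vx|_] := boolP (v <= (Z i w).1); last by rewrite !mulr0; ring.
by rewrite /residual lin ?(lt_le_trans u0v)//; ring.
Qed.

Let lse_close (eta : R) : 0 < eta ->
  whp P (fun n w => `|D1 n w - V1 n w| <= eta /\ `|D2 n w - V2 n w| <= eta).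
Proof.
move=> eta0 e e0.
set k := `|n00| + `|n01| + `|n11|.
have k0 : 0 <= k by rewrite !addr_ge0.
have k1 : 0 < k + 1 by rewrite ltr_wpDl.
(* Nine exceptional sets: one for linearity, one for the estimated threshold, three for moments, two
   for tightness, two for equicontinuity. *)
have e9 : 0 < e / 9 by rewrite divr_gt0.
have m_one : measurable_fun (setT : set R) (fun _ : R => 1 : R) by [].
have m_id : measurable_fun setT (@id R) by [].
have m_sqr : measurable_fun setT (fun x : R => x ^+ 2) by exact: exprn_measurable.
have i_one2 : Rintegrable P (fun w => (fun _ : R => 1 : R) (X w) ^+ 2).
  exact: Rintegrable_cst.
have i_one : Rintegrable P (fun w => (fun _ : R => 1 : R) (X w)) by exact: Rintegrable_cst.
have [K0 K0_gt0 tight0] := tail_stat_tight m_one i_one2 e9.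
have [K1 K1_gt0 tight1] := tail_stat_tight m_id i_X2 e9.
pose K := 2 * k * (K0 + K1).
have K_ge0 : 0 <= K by rewrite !mulr_ge0// addr_ge0// ltW.
have K1' : 0 < K + 1 by rewrite ltr_wpDl.
(* Keeps [8 * k * rho] below 1, as the perturbation bound demands, and below [eta / 2 / (K + 1)],
   where [K] is the bound on [|V1| + |V2|] given by tightness. *)
pose rho := Num.min 1 (eta / 2 / (K + 1)) / (8 * (k + 1)).
have min0 : 0 < Num.min 1 (eta / 2 / (K + 1)) by rewrite lt_min ltr01 !divr_gt0.
have rho0 : 0 < rho by rewrite divr_gt0// mulr_gt0.
have rhoE : 8 * (k + 1) * rho = Num.min 1 (eta / 2 / (K + 1)).
  by rewrite mulrC divfK// gt_eqF// mulr_gt0.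
(* Gives [4 * k * (eta' + eta') <= eta / 2], the share due to the change of the statistics between
   [v] and [v0]. *)
pose eta' := eta / (16 * (k + 1)).
have eta'0 : 0 < eta' by rewrite divr_gt0// mulr_gt0.
have eta'E : 16 * (k + 1) * eta' = eta by rewrite mulrC divfK// gt_eqF// mulr_gt0.
have [dl1 dl1_gt0 eq0] := tail_stat_equicontinuous m_one i_one2 e9 eta'0.
have [dl2 dl2_gt0 eq1] := tail_stat_equicontinuous m_id i_X2 e9 eta'0.
have [dl3 dl3_gt0 mom0] := tail_moment_cvg m_one i_one e9 rho0.
have [dl4 dl4_gt0 mom1] := tail_moment_cvg m_id i_X e9 rho0.
have [dl5 dl5_gt0 mom2] := tail_moment_cvg m_sqr i_X2 e9 rho0.
(* The bound by [psi] keeps the random threshold above [u0], where the regression function is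
   affine. *)
pose dl := Num.min (Num.min (Num.min dl1 dl2) (Num.min (Num.min dl3 dl4) dl5)) psi.
have dl0 : 0 < dl by rewrite !lt_min dl1_gt0 dl2_gt0 dl3_gt0 dl4_gt0 dl5_gt0.
have uhat_near : \forall n \near \oo,
    outside_small P (e / 9) (fun w => `|uhat n w - u0| < dl).
  have := uhat_cvg dl0.
  move=> /fine_cvgP[fin /cvgrPdist_lt/(_ _ e9)]; apply: filterS2 fin => n fin small.
  exists [set w | dl <= `|uhat n w - u0|].
    split.
      rewrite -[A in measurable A]setTI; apply: measurable_fun_le => //.
      by apply: measurableT_comp => //; exact: measurable_funB.
    by rewrite -(fineK fin) lee_fin; move: small; rewrite /= sub0r normrN => /ltW/ler_normlW.
  by move=> w /= /negP; rewrite -ltNge.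
have lin_out := outside_small_as (ltW e9) linear.
near=> n.
have n0 : (0 < n)%N by near: n; exact: nbhs_infty_gt.
have u_n : outside_small P (e / 9) (fun w => `|uhat n w - u0| < dl) by near: n.
have mom0_n : outside_small P (e / 9) (fun w => forall v, `|v - v0| <= dl3 ->
      `|tail_moment (fun=> 1) n v w - tail_mean (fun=> 1)| <= rho) by near: n.
have mom1_n : outside_small P (e / 9) (fun w => forall v, `|v - v0| <= dl4 ->
      `|tail_moment id n v w - tail_mean id| <= rho) by near: n.
have mom2_n : outside_small P (e / 9) (fun w => forall v, `|v - v0| <= dl5 ->
      `|tail_moment (fun x => x ^+ 2) n v w - tail_mean (fun x => x ^+ 2)| <= rho)
  by near: n.
have := outside_smallI lin_out (outside_smallI u_n (outside_smallI mom0_n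
  (outside_smallI mom1_n (outside_smallI mom2_n (outside_smallI (tight0 n n0)
  (outside_smallI (tight1 n n0) (outside_smallI (eq0 n n0) (eq1 n n0)))))))).
rewrite (_ : e / 9 + _ = e); last by field.
apply: outside_smallS => w [lin [uw [hm0 [hm1 [hm2 [ht0 [ht1 [he0 he1]]]]]]]].
set v := uhat n w + psi.
have vv0 : `|v - v0| < dl by rewrite v0E /v opprD addrACA subrr addr0.
have u0v : u0 < v.
  have : `|uhat n w - u0| < psi.
    by apply: lt_le_trans uw _; rewrite /dl !ge_min lexx !orbT.
  by rewrite ltr_norml ltrBrDl /v -ltrBlDr => /andP[].
have dle c : dl <= c -> `|v - v0| <= c by move=> /(lt_le_trans vv0)/ltW.
have le1 : dl <= dl1 by rewrite /dl !ge_min lexx.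
have le2 : dl <= dl2 by rewrite /dl !ge_min lexx !orbT.
have le3 : dl <= dl3 by rewrite /dl !ge_min lexx !orbT.
have le4 : dl <= dl4 by rewrite /dl !ge_min lexx !orbT.
have le5 : dl <= dl5 by rewrite /dl !ge_min lexx !orbT.
have ne0 := scaled_normal_equation 1 0 n0 u0v lin.
have ne1 := scaled_normal_equation 0 1 n0 u0v lin.
have f_one : (fun x : R => 1 + 0 * x) = (fun=> 1) by apply/funext => x; ring.
have f_x1 : (fun x : R => x * (1 + 0 * x)) = id by apply/funext => x; rewrite mul0r addr0 mulr1.
have f_id : (fun x : R => 0 + 1 * x) = id by apply/funext => x; rewrite add0r mul1r.
have f_xx : (fun x : R => x * (0 + 1 * x)) = (fun x => x ^+ 2) by apply/funext => x; ring.
rewrite f_one f_x1 -/v in ne0; rewrite f_id f_xx -/v in ne1.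
have hk : 8 * k * rho <= Num.min 1 (eta / 2 / (K + 1)).
  by rewrite -rhoE ler_wpM2r ?(ltW rho0)// ler_wpM2l// lerDl.
have hk1 : 8 * k * rho <= 1 by rewrite (le_trans hk)// ge_min lexx.
have hk2 : 8 * k * rho <= eta / 2 / (K + 1) by rewrite (le_trans hk)// ge_min lexx orbT.
have := lse_perturbation (tail_stat (fun=> 1) n v0 w) (tail_stat id n v0 w)
  NM00 NM01 NM10 NM11 (esym ne0) (esym ne1)
  (hm0 v (dle _ le3)) (hm1 v (dle _ le4)) (hm2 v (dle _ le5)) hk1.
rewrite -/k -/(V1 n w) -/(V2 n w) => bound.
have {}he0 := he0 v (dle _ le1); have {}he1 := he1 v (dle _ le2).
have Vk : `|V1 n w| + `|V2 n w| <= K.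
  have c00 : `|n00| <= k by rewrite /k -addrA lerDl addr_ge0.
  have c01 : `|n01| <= k by rewrite /k addrAC lerDr addr_ge0.
  have c11 : `|n11| <= k by rewrite /k lerDr addr_ge0.
  have half p q : `|p| <= k -> `|q| <= k ->
      `|p * tail_stat (fun=> 1) n v0 w + q * tail_stat id n v0 w| <= k * (K0 + K1).
    move=> pk qk; rewrite (le_trans (ler_normD _ _))// mulrDr (normrM p) (normrM q).
    by apply: lerD; apply: ler_pM => //; apply: ltW; [exact: ht0|exact: ht1].
  rewrite /K -mulrA mulr_natl mulr2n lerD//; exact: half.
have V0 : 0 <= `|V1 n w| + `|V2 n w| by rewrite addr_ge0.
have first_term : 8 * k * rho * (`|V1 n w| + `|V2 n w|) <= eta / 2.
  have kr0 : 0 <= 8 * k * rho by apply: mulr_ge0 (ltW rho0); exact: mulr_ge0.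
  apply: le_trans (ler_pM kr0 V0 hk2 Vk) _.
  by rewrite mulrAC ler_pdivrMr// ler_wpM2l ?lerDl// divr_ge0// ltW.
have second_term : 4 * k * (`|tail_stat (fun=> 1) n v w - tail_stat (fun=> 1) n v0 w| +
    `|tail_stat id n v w - tail_stat id n v0 w|) <= eta / 2.
  apply: (@le_trans _ _ (4 * (k + 1) * (eta' + eta'))).
    apply: ler_pM; rewrite ?mulr_ge0 ?addr_ge0//; last exact: lerD.
    by rewrite ler_wpM2l// lerDl.
  by rewrite -eta'E le_eqVlt; apply/orP; left; apply/eqP; field.
have total : `|D1 n w - V1 n w| + `|D2 n w - V2 n w| <= eta.
  by apply: le_trans bound _; rewrite [leRHS](splitr eta) lerD.
by split; apply: le_trans total; rewrite ?lerDl ?lerDr.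
Unshelve. all: by end_near. Qed.

Lemma cvg_least_squares (g : R * R -> R) (B : R) : continuous g ->
  (forall z, `|g z| <= B) ->
  \int[P]_w g (D1 n w, D2 n w) @[n --> \oo] -->
  \int[std_binormal R]_z g (a11 * z.1 + a12 * z.2, a21 * z.1 + a22 * z.2).
Proof.
apply: cvg_Rintegral_bounded_continuous => //.
- by apply: measurable_funD; apply: measurable_funM.
- by apply: measurable_funD; apply: measurable_funM.
- move=> s x y; apply: (slutsky_kernel mD1 mD2 mV1 mV2 lse_close).
  exact: cvg_tail_stat_kernel.
Qed.

End sample_regression.

(** * The model *)

Section design.
Context d (T : measurableType d) (R : realType) (P : probability T R).
Variable X : {RV P >-> R}.

Lemma L2_Rintegrable (f : {RV P >-> R}) :
  ('E_P[fun w => (f w ^+ 2)%R] < +oo)%E -> Rintegrable P (fun w => f w ^+ 2).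
Proof.
rewrite unlock => f2; apply: RintegrableP; first exact: measurable_funX.
by under eq_integral do rewrite ger0_norm ?sqr_ge0//.
Qed.

(** An atom at [t] separates [cdf X s] from [cdf X t] by its mass for every [s < t], against
    continuity from the left. *)
Lemma continuous_cdf_no_atom (t : R) : continuous (cdf X) ->
  P [set w | X w = t] = 0%E.
Proof.
move=> cX; set A := [set w | X w = t].
have mA : measurable A.
  by have := measurable_funPT X measurableT [set t] (measurable_set1 t); rewrite setTI.
have step s : s < t -> (cdf X s + P A <= cdf X t)%E.
  move=> st.
  have mI u : measurable (X @^-1` `]-oo, u]).
    by have := measurable_funPT X measurableT `]-oo, u]%classic (measurable_itv _);
      rewrite setTI.
  rewrite -[cdf X s]/(P (X @^-1` `]-oo, s])) -[cdf X t]/(P (X @^-1` `]-oo, t])).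
  rewrite -measureU//; last first.
    apply/seteqP; split => // w [/=]; rewrite in_itv/= /A/= => + Xt.
    by rewrite Xt leNgt st.
  apply: le_measure; rewrite ?inE//; first exact: measurableU.
  move=> w [|]/=; rewrite !in_itv/=; last by move->.
  by move=> /le_trans; apply; exact: ltW.
have finX s : cdf X s \is a fin_num by exact: fin_num_measure.
have /fine_cvgP[_] : cdf X s @[s --> t] --> (fine (cdf X t))%:E.
  by rewrite fineK//; exact: cX.
have finA : P A \is a fin_num by exact: fin_num_measure.
apply: contraPP => /eqP PA0 lim.
have p0 : 0 < fine (P A).
  by rewrite fine_gt0// lt0e PA0 measure_ge0/= ltey_eq finA.
move/cvgrPdist_lt : lim => /(_ _ p0)/nbhs_ballP[dl /= dl0 near_t].
have dl20 : 0 < dl / 2 by rewrite divr_gt0.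
have bt : ball t dl (t - dl / 2).
  by rewrite /ball/= opprB addrC subrK gtr0_norm// ltr_pdivrMr// ltr_pMr// ltr1n.
have := near_t _ bt; rewrite /= ltNge => /negP; apply.
have st : t - dl / 2 < t by rewrite ltrBlDr ltrDl.
have := step _ st.
rewrite -(fineK (finX t)) -(fineK (finX (t - dl / 2))) -(fineK finA) -EFinD lee_fin.
by move=> h; rewrite (le_trans _ (ler_norm _))// lerBrDl.
Qed.

Let Rintegral_gt0 (q : R -> R) (c rho kappa : R) : Rintegrable P (fun w => q (X w)) ->
  (forall x, 0 <= q x) -> law_support X c -> 0 < rho -> 0 < kappa ->
  (forall x, `|c - x| < rho -> kappa <= q x) -> 0 < \int[P]_w q (X w).
Proof.
move=> iq q0 supp_c rho0 kappa0 qball.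
have pos := supp_c _ rho0.
have mball : measurable (X @^-1` ball c rho).
  have := measurable_funPT X measurableT (ball c rho) (measurable_ball _ _).
  by rewrite setTI.
have finp : P (X @^-1` ball c rho) \is a fin_num by exact: fin_num_measure.
have p0 : 0 < fine (P (X @^-1` ball c rho)).
  by rewrite fine_gt0// pos ltey_eq finp.
apply: (@lt_le_trans _ _ (kappa * fine (P (X @^-1` ball c rho)))); first exact: mulr_gt0.
have i1 : Rintegrable P (\1_(X @^-1` ball c rho) : T -> R).
  apply: (@bounded_Rintegrable _ _ _ P _ 1); first exact: measurable_indic.
  by move=> w; rewrite indicE; case: (_ \in _); rewrite ?normr1 ?normr0.
have -> : fine (P (X @^-1` ball c rho)) = \int[P]_w (\1_(X @^-1` ball c rho) w : R).
  by rewrite /Rintegral integral_indic// setIT.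
rewrite -RintegralZl//; apply: le_Rintegral => //; first exact: RintegrableZ.
move=> w _; rewrite indicE; case: (boolP (w \in _)) => [|_]; last by rewrite mulr0.
by rewrite inE mulr1 => wb; exact: qball.
Qed.

Variable v0 : R.
Hypothesis i_X2 : Rintegrable P (fun w => X w ^+ 2).
Hypothesis supp : exists2 c, v0 < c & forall x, v0 < x <= c -> law_support X x.

Let M0 := tail_mean P X v0 (fun=> 1).
Let M1 := tail_mean P X v0 id.
Let M2 := tail_mean P X v0 (fun x => x ^+ 2).

(** The second expression is the mean of [(X - m)^2] on [X >= v0]; it is positive because the
    support has a point beyond [v0] other than [m]. *)
Let quadratic_gt0 (m : R) :
  0 < M0 /\ 0 < m ^+ 2 * M0 - 2 * m * M1 + M2.
Proof.
have [c v0c sc] := supp.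
(* If [c] happens to be [m], the midpoint of [v0] and [c] serves instead. *)
have [c' [v0c' cc' cm]] : exists c', [/\ v0 < c', c' <= c & c' != m].
  have [cm|cm] := eqVneq c m; last by exists c.
  exists ((v0 + c) / 2); split; [lra|lra|rewrite -cm].
  by apply/negP => /eqP; lra.
have sc' : law_support X c' by apply: sc; rewrite v0c'.
(* The ball of this radius stays above [v0] and at distance at least [|c' - m| / 2] from [m]. *)
pose rho := Num.min (c' - v0) (`|c' - m| / 2).
have cm0 : 0 < `|c' - m| by rewrite normr_gt0 subr_eq0.
have rho0 : 0 < rho by rewrite lt_min subr_gt0 v0c' divr_gt0.
have above x : `|c' - x| < rho -> v0 <= x.
  rewrite lt_min => /andP[+ _]; rewrite ltr_norml => /andP[_]; lra.
split.
- have [i e] := @tail_affine_moment _ _ _ P X v0 i_X2 1 0 1 0.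
  have -> : M0 = \int[P]_w (tail_affine v0 1 0 (X w) * tail_affine v0 1 0 (X w)).
    by rewrite e -/M0; ring.
  apply: (Rintegral_gt0 (q := fun x => tail_affine v0 1 0 x * tail_affine v0 1 0 x)
    i _ sc' rho0 ltr01) => x; first by rewrite -expr2 sqr_ge0.
  by move=> /above v0x; rewrite /tail_affine v0x mul0r addr0 !mulr1.
- have [i e] := @tail_affine_moment _ _ _ P X v0 i_X2 (- m) 1 (- m) 1.
  have -> : m ^+ 2 * M0 - 2 * m * M1 + M2 =
      \int[P]_w (tail_affine v0 (- m) 1 (X w) * tail_affine v0 (- m) 1 (X w)).
    by rewrite e -/M0 -/M1 -/M2; ring.
  apply: (Rintegral_gt0 (q := fun x => tail_affine v0 (- m) 1 x * tail_affine v0 (- m) 1 x)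
    (kappa := (`|c' - m| / 2) ^+ 2) i _ sc' rho0).
  + by move=> x; rewrite -expr2 sqr_ge0.
  + by rewrite exprn_gt0// divr_gt0.
  + move=> x xc; rewrite /tail_affine (above _ xc) mul1r !mulr1 -expr2 [- m + x]addrC.
    rewrite -[leRHS]real_normK ?num_real// ler_sqr ?nnegrE ?divr_ge0//.
    move: xc; rewrite lt_min => /andP[_ xc].
    have := ler_distD x c' m; lra.
Qed.

(** The quadratic in [m] is taken at its minimizer [M1 / M0]; multiplied by [M0], its value there is
    the determinant. *)
Lemma tail_design_pos : 0 < M0 /\ 0 < M0 * M2 - M1 ^+ 2.
Proof.
have [M00 pos] := quadratic_gt0 (M1 / M0); split => //.
have := mulr_gt0 M00 pos; congr (0 < _).
by field; rewrite gt_eqF.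
Qed.

End design.

(** * Normal laws of the plane and symmetric matrices of size two *)

Section planar_map.
Context (R : realType).
Variable A : 'M[R]_2.

Definition planar_map (z : R * R) : R * R :=
  (A 0 0 * z.1 + A 0 1 * z.2, A 1 0 * z.1 + A 1 1 * z.2).

Lemma measurable_planar_map : measurable_fun setT planar_map.
Proof.
by apply/measurable_fun_pair; apply: measurable_funD; apply: measurable_funM.
Qed.

HB.instance Definition _ :=
  isMeasurableFun.Build _ _ _ _ planar_map measurable_planar_map.

Definition binormal_law : probability (R * R)%type R :=
  [the probability _ _ of distribution (std_binormal R) planar_map].

Lemma is_binormal_law : is_binormal binormal_law (0, 0) (A *m A^T).
Proof.
exists A => // B mB.
have mAB : measurable (planar_map @^-1` B).
  by rewrite -[X in measurable X]setTI; exact: measurable_planar_map.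
have -> : [set z | B ((0 : R, 0 : R).1 + (A 0 0 * z.1 + A 0 1 * z.2),
    (0 : R, 0 : R).2 + (A 1 0 * z.1 + A 1 1 * z.2))] = planar_map @^-1` B.
  by apply/seteqP; split => z; rewrite /preimage/planar_map/= !add0r.
exact: etrans (std_binormalE mAB).
Qed.

End planar_map.

Section two_by_two.
Context (R : rcfType).
Implicit Types a b c : R.

Definition sym_mx a b c : 'M[R]_2 :=
  \matrix_(i, j) if i == 0 then (if j == 0 then a else b)
                 else (if j == 0 then b else c).

Lemma ord2_cases (i : 'I_2) : i = 0 \/ i = 1.
Proof. by case: i => [[|[|//]] ?]; [left|right]; exact/val_inj. Qed.

Lemma invmx_sym_mx a b c : 0 < a * c - b ^+ 2 ->
  invmx (sym_mx a b c) = (a * c - b ^+ 2)^-1 *: sym_mx c (- b) a.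
Proof.
set D := a * c - b ^+ 2 => D0; set N := D^-1 *: sym_mx c (- b) a.
have D1 : D != 0 by rewrite gt_eqF.
have NM : N *m sym_mx a b c = 1%:M.
  apply/matrixP => i j; rewrite !mxE big_ord_recl big_ord1 !mxE/=.
  by case: (ord2_cases i) => ->; case: (ord2_cases j) => -> /=; rewrite ?mulr1n ?mulr0n /D; field.
have [_ uM] := mulmx1_unit NM.
by rewrite -[LHS]mul1mx -NM -mulmxA mulmxV// mulmx1.
Qed.

Definition cholesky (s a b c : R) : 'M[R]_2 :=
  \matrix_(i, j) (s * if i == 0 then (if j == 0 then Num.sqrt a else 0)
    else (if j == 0 then b / Num.sqrt a else Num.sqrt (c - b ^+ 2 / a))).

(** Only [sym_mx a b c] is factored, while [s2] enters through its square root; the degenerate case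
    [s2 = 0] is thereby included. *)
Lemma cholesky_spec (s2 a b c : R) (A := cholesky (Num.sqrt s2) a b c) :
  0 <= s2 -> 0 < a -> 0 <= a * c - b ^+ 2 ->
  [/\ A 0 0 ^+ 2 + A 0 1 ^+ 2 = s2 * a, A 0 0 * A 1 0 + A 0 1 * A 1 1 = s2 * b,
      A 1 0 ^+ 2 + A 1 1 ^+ 2 = s2 * c & A *m A^T = s2 *: sym_mx a b c].
Proof.
move=> s0 a0 d0.
have ra0 : 0 < Num.sqrt a by rewrite sqrtr_gt0.
have raE : Num.sqrt a ^+ 2 = a by rewrite sqr_sqrtr// ltW.
have rsE : Num.sqrt s2 ^+ 2 = s2 by rewrite sqr_sqrtr.
have c0 : 0 <= c - b ^+ 2 / a.
  by rewrite subr_ge0 ler_pdivrMr// mulrC -subr_ge0.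
have rcE : Num.sqrt (c - b ^+ 2 / a) ^+ 2 = c - b ^+ 2 / a by rewrite sqr_sqrtr.
have e11 : A 0 0 ^+ 2 + A 0 1 ^+ 2 = s2 * a.
  by rewrite !mxE/= mulr0 expr0n addr0 exprMn rsE raE.
have e12 : A 0 0 * A 1 0 + A 0 1 * A 1 1 = s2 * b.
  by rewrite !mxE/= mulr0 mul0r addr0 -[in RHS]rsE; field; rewrite gt_eqF.
have e22 : A 1 0 ^+ 2 + A 1 1 ^+ 2 = s2 * c.
  by rewrite !mxE/= !exprMn rsE rcE exprVn raE; field; rewrite gt_eqF.
split=> //; apply/matrixP => i j.
rewrite !mxE big_ord_recl big_ord1 ![A^T _ _]mxE.
have -> : lift ord0 ord0 = 1 :> 'I_2 by exact/val_inj.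
case: (ord2_cases i) => ->; case: (ord2_cases j) => -> /=.
- exact: e11.
- exact: e12.
- by rewrite -e12; ring.
- exact: e22.
Qed.

End two_by_two.

Section model.
Context d (T : measurableType d) (R : realType) (P : probability T R).
Variable X : {RV P >-> R}.

Lemma cond_prob1_negligible (A B : set T) : measurable A -> measurable B ->
  cond_prob P A B = 1 -> P (B `\` A) = 0%E.
Proof.
move=> mA mB; rewrite /cond_prob => AB1.
have finB : P B \is a fin_num by exact: fin_num_measure.
have finAB : P (A `&` B) \is a fin_num by apply: fin_num_measure; exact: measurableI.
(* A conditional probability equal to 1 excludes [P B = 0], since division by 0 yields 0. *)
have B0 : fine (P B) != 0.
  by apply/eqP => B0; move: AB1; rewrite B0 invr0 mulr0 => /eqP; rewrite eq_sym oner_eq0.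
have eqAB : fine (P (A `&` B)) = fine (P B) by rewrite -[LHS](divfK B0) AB1 mul1r.
have PAB : P (A `&` B) = P B by rewrite -(fineK finB) -(fineK finAB) eqAB.
transitivity (P B - P (B `&` A))%E; last by rewrite setIC PAB subee.
by apply: measureD => //; rewrite ltey_eq finB.
Qed.

(** The threshold is an infimum of points of the support, hence at least [a]; being different from
    [a] makes this strict and excludes [-oo], and the upper bound [g] excludes [+oo]. *)
Lemma threshold_bounds (r : R -> R) (a b g : \bar R) :
  law_support X = [set x : R | (a <= x%:E <= b)%E] ->
  threshold X r b != a -> (threshold X r b < g)%E ->
  (a < (fine (threshold X r b))%:E)%E /\ threshold X r b \is a fin_num.
Proof.
move=> supp neq_a lt_g.
have age : (a <= threshold X r b)%E.
  apply/ereal_infP => _ [u [su _ _] <-].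
  by move: su; rewrite supp => /= /andP[].
have alt : (a < threshold X r b)%E by rewrite lt_neqAle eq_sym neq_a.
have fin : threshold X r b \is a fin_num.
  rewrite fin_numE; apply/andP; split.
    by rewrite -ltNye; apply: le_lt_trans alt; exact: leNye.
  by rewrite -ltey; apply: lt_le_trans lt_g _; exact: leey.
by split=> //; rewrite fineK.
Qed.

Lemma design_momentE (v0 : R) : design_moment X v0 =
  sym_mx (tail_mean P X v0 (fun=> 1)) (tail_mean P X v0 id)
         (tail_mean P X v0 (fun x => x ^+ 2)).
Proof.
apply/matrixP => i j; rewrite !mxE [in LHS]unlock -[LHS]/(Rintegral _ _ _).
have E w : (xtilde (X w) *m (xtilde (X w))^T) i j =
    (if i == 0 then 1 else X w) * (if j == 0 then 1 else X w).
  by rewrite !mxE big_ord1 !mxE.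
under eq_Rintegral do rewrite E mulrC.
by case: (ord2_cases i) => ->; case: (ord2_cases j) => -> /=;
  apply: eq_Rintegral => w _; rewrite ?mul1r ?mulr1.
Qed.

Lemma centered_variance (eps : {RV P >-> R}) : ('E_P[eps] = 0)%E ->
  fine 'V_P[eps] = \int[P]_w (eps w ^+ 2).
Proof.
move=> e0; rewrite /variance unlock e0/= unlock.
by apply: eq_Rintegral => w _; rewrite /= !fctE/= !subr0.
Qed.

End model.

Theorem theorem3p3 (d : measure_display) (T : measurableType d) (R : realType)
  (P : probability T R)
  (* the model *)
  (X Y eps : {RV P >-> R}) (r : R -> R) (a b : \bar R)
  (mr : measurable_fun [set: R] r)
  (X_L2 : ('E_P[fun w => (X w ^+ 2)%R] < +oo)%E)
  (Y_L2 : ('E_P[fun w => (Y w ^+ 2)%R] < +oo)%E)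
  (model : forall w, Y w = r (X w) + eps w)
  (indep : independent2 P X eps)
  (ab : (a < b)%E)
  (supp : law_support X = [set x : R | (a <= x%:E <= b)%E])
  (u0e := threshold X r b) (u0 := fine u0e)
  (* the sample *)
  (Xs Ys : nat -> {RV P >-> R})
  (sample_indep : independent_seq P (fun i w => (Xs i w, Ys i w)))
  (sample_law : forall i,
    same_law P (fun w => (Xs i w, Ys i w)) (fun w => (X w, Y w)))
  (eps_L2 : ('E_P[fun w => (eps w ^+ 2)%R] < +oo)%E)
  (eps_mean : ('E_P[eps] = 0)%E)
  (cdf_cont : continuous (cdf X))
  (u0_neq_a : u0e != a)
  (eta1 : R) (eta1_bnd : 0 < eta1 < 1)
  (u0_lt_gamma : (u0e < (quantile X (1 - eta1))%:E)%E)
  (f : R -> R) (f_ge0 : forall x, 0 <= f x)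
  (f_nondecr : {homo f : x y / x <= y})
  (f_incr : exists2 U : set R, nbhs u0 U &
     forall x y, U x -> U y -> x < y -> f x < f y)
  (XY_L2 : ('E_P[fun w => (X w ^+ 2 * Y w ^+ 2)%R] < +oo)%E)
  (* the linear coefficients beyond u_0 *)
  (alpha0 beta0 : R)
  (lin0 : cond_prob P [set w | r (X w) = alpha0 + beta0 * X w]
                      [set w | u0 < X w] = 1)
  (* the estimators *)
  (lambda : nat -> R) (lambda_gt0 : forall n, 0 < lambda n)
  (theta : nat -> R -> T -> R * R)
  (theta_lse : forall n u w,
     is_lse n (fun i => (Xs i w, Ys i w)) u (theta n u w))
  (uhat : nat -> {RV P >-> R})
  (tau : nat -> R) (tau_ge0 : forall n, 0 <= tau n)
  (tau_cvg : tau n @[n --> \oo] --> 0)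
  (uhat_argmin : forall n w, (0 < n)%N ->
     let z := fun i => (Xs i w, Ys i w) in
     pen_argmin n z (lambda n) f (fun u => theta n u w)
       (emp_quantile n z (1 - eta1)) (tau n) (uhat n w))
  (uhat_cvg : cvg_in_prob P uhat u0)
  (psi : R) (psi_gt0 : 0 < psi)
  (psi_lt : ((u0 + psi)%:E < b)%E)
  (theta_meas : forall n,
     measurable_fun [set: T] (fun w => theta n (uhat n w + psi) w)) :
  exists2 mu : probability (R * R)%type R,
    is_binormal mu (0, 0)
      (asymptotic_cov X (fine 'V_P[eps]) (u0 + psi)) &
    cvg_in_law P
      (fun n w =>
         (Num.sqrt n%:R * ((theta n (uhat n w + psi) w).1 - alpha0),
          Num.sqrt n%:R * ((theta n (uhat n w + psi) w).2 - beta0)))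
      mu.
Proof.
set v0 := u0 + psi.
have [a_lt_u0 _] := threshold_bounds supp u0_neq_a u0_lt_gamma.
rewrite -/u0e -/u0 in a_lt_u0.
have i_X2 := L2_Rintegrable X_L2.
have i_eps2 := L2_Rintegrable eps_L2.
have eps0 : \int[P]_w eps w = 0.
  by move: eps_mean; rewrite unlock /Rintegral => ->.
(* Since [a < u0 < v0 < b], an interval to the right of [v0] lies in the support; this is what makes
   the design matrix invertible. *)
have supp_v0 : exists2 c, v0 < c & forall x, v0 < x <= c -> law_support X x.
  have [c v0c cb] : exists2 c, v0 < c & (c%:E <= b)%E.
    have pick (b' : \bar R) : (v0%:E < b')%E -> exists2 c, v0 < c & (c%:E <= b')%E.
      case: b' => [b'||]//; first by rewrite lte_fin => ?; exists b'.
      by move=> _; exists (v0 + 1); rewrite ?ltrDl// leey.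
    exact: pick.
  exists c => // x /andP[v0x xc]; rewrite supp /=; apply/andP; split.
    apply: le_trans (ltW a_lt_u0) _; rewrite lee_fin ltW// (lt_trans _ v0x)//.
    by rewrite /v0 ltrDl.
  by apply: le_trans cb; rewrite lee_fin.
have [M0_gt0 det_gt0] := tail_design_pos i_X2 supp_v0.
set M0 := tail_mean P X v0 (fun=> 1) in M0_gt0 det_gt0 *.
set M1 := tail_mean P X v0 id in det_gt0 *.
set M2 := tail_mean P X v0 (fun x => x ^+ 2) in det_gt0 *.
set D := M0 * M2 - M1 ^+ 2 in det_gt0 *.
have M2_gt0 : 0 < M2.
  by rewrite -(pmulr_rgt0 _ M0_gt0) -[_ * _](subrK (M1 ^+ 2)) ltr_wpDr ?sqr_ge0.
have D_neq0 : D != 0 by rewrite gt_eqF.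
set s2 := \int[P]_w (eps w ^+ 2).
have s2_ge0 : 0 <= s2 by apply: Rintegral_ge0 => w _; exact: sqr_ge0.
(* Entries of the inverse design matrix, by cofactors. *)
pose n00 := D^-1 * M2; pose n01 := D^-1 * - M1; pose n11 := D^-1 * M0.
have n00_gt0 : 0 < n00 by rewrite mulr_gt0 ?invr_gt0.
have det_n : 0 <= n00 * n11 - n01 ^+ 2.
  rewrite (_ : n00 * n11 - n01 ^+ 2 = D^-1) ?invr_ge0 ?(ltW det_gt0)//.
  by rewrite /n00 /n01 /n11 /D; field.
have [cov11 cov12 cov22 covA] := cholesky_spec s2_ge0 n00_gt0 det_n.
set A := cholesky _ _ _ _ in cov11 cov12 cov22 covA.
exists (binormal_law A).
  have -> : asymptotic_cov X (fine 'V_P[eps]) v0 = A *m A^T.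
    rewrite /asymptotic_cov design_momentE invmx_sym_mx// centered_variance// covA.
    congr (_ *: _); apply/matrixP => i j; rewrite !mxE.
    by case: (i == 0); case: (j == 0).
  exact: is_binormal_law.
pose Z i : {mfun T >-> (R * R)%type} := pair_mfun (Xs i) (Ys i).
pose W : {mfun T >-> (R * R)%type} := pair_mfun X Y.
have indZ : independent_seq P Z := sample_indep.
have lawZ i : same_law P (Z i) W := sample_law i.
have epsE w : residual r (W w) = eps w by rewrite /residual/= model addrAC subrr add0r.
(* The null set attached to [(X, Y)] by [lin0] is carried to each observation by equality of laws;
   countably many null sets are then combined. *)
have linear : {ae P, forall w, forall i, u0 < (Z i w).1 ->
    r (Z i w).1 = alpha0 + beta0 * (Z i w).1}.
  apply/ae_foralln => i.
  pose Lt := [set s : R * R | u0 < s.1].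
  pose Eq := [set s : R * R | r s.1 = alpha0 + beta0 * s.1].
  have mr1 : measurable_fun setT (fun s : R * R => r s.1) by exact: measurableT_comp.
  have maff : measurable_fun setT (fun s : R * R => alpha0 + beta0 * s.1).
    by apply: measurable_funD => //; exact: measurable_funM.
  have mLt : measurable Lt.
    have mb : measurable_fun setT (fun s : R * R => u0 < s.1) by exact: measurable_fun_ltr.
    by have := mb measurableT [set true] I; rewrite setTI.
  have mEq : measurable Eq.
    have mb : measurable_fun setT (fun s : R * R => r s.1 == alpha0 + beta0 * s.1).
      exact: measurable_fun_eqr.
    have := mb measurableT [set true] I; rewrite setTI.
    by congr measurable; apply/seteqP; split => s /eqP.
  have mW C : measurable C -> measurable (W @^-1` C).
    by move=> mC; rewrite -[X in measurable X]setTI; exact: measurable_funPT.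
  pose N := Lt `\` Eq.
  have mN : measurable N by exact: measurableD.
  have PN : P (W @^-1` N) = 0%E.
    exact: (cond_prob1_negligible (mW _ mEq) (mW _ mLt) lin0).
  exists (Z i @^-1` N); split.
  - by rewrite -[X in measurable X]setTI; exact: measurable_funPT.
  - by apply: etrans PN; exact: lawZ.
  - move=> w /= nlin; apply: contrapT => nN; apply: nlin => u0Z.
    by apply: contrapT => neq; apply: nN.
move=> g cg [B gB].
have mg : measurable_fun setT g by exact: continuous_plane_measurable.
have := cvg_least_squares indZ lawZ mr indep (fun=> erefl) epsE i_eps2 eps0
  (continuous_cdf_no_atom v0 cdf_cont) i_X2 (n00 := n00) (n01 := n01) (n11 := n11)
  _ _ _ _ cov11 cov12 cov22 psi_gt0 (erefl v0) linear _ uhat_cvg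
  (fun n w => theta_lse n (uhat n w + psi) w) theta_meas cg gB.
have e1 : n00 * M0 + n01 * M1 = 1 by rewrite /n00 /n01 /D; field.
have e2 : n00 * M1 + n01 * M2 = 0 by rewrite /n00 /n01 /D; field.
have e3 : n01 * M0 + n11 * M1 = 0 by rewrite /n01 /n11 /D; field.
have e4 : n01 * M1 + n11 * M2 = 1 by rewrite /n01 /n11 /D; field.
move=> /(_ e1 e2 e3 e4 (fun n => measurable_funP (uhat n))) lim.
have i_theta n : Rintegrable P (fun w =>
    g (Num.sqrt n%:R * ((theta n (uhat n w + psi) w).1 - alpha0),
       Num.sqrt n%:R * ((theta n (uhat n w + psi) w).2 - beta0))).
  have m1 := measurableT_comp measurable_fst (theta_meas n).
  have m2 := measurableT_comp measurable_snd (theta_meas n).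
  apply: (@continuous_bounded_Rintegrable _ _ _ P
    (fun w => Num.sqrt n%:R * ((theta n (uhat n w + psi) w).1 - alpha0))
    (fun w => Num.sqrt n%:R * ((theta n (uhat n w + psi) w).2 - beta0)) g B) => //.
    by apply: measurable_funM => //; exact: measurable_funB.
  by apply: measurable_funM => //; exact: measurable_funB.
have i_normal : Rintegrable (std_binormal R) (fun z => g (planar_map A z)).
  apply: (@bounded_Rintegrable _ _ _ (std_binormal R) _ B) => //.
  by apply: measurableT_comp => //; exact: measurable_planar_map.
have -> : (\int[binormal_law A]_z (g z)%:E)%E =
    (\int[std_binormal R]_z g (planar_map A z))%:E.
  rewrite (EFin_Rintegral i_normal).
  have mgE : measurable_fun setT (EFin \o g) by exact/measurable_EFinP.
  exact: (@integral_distributionE _ _ _ _ _ (std_binormal R) (planar_map A) _ mgE).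
under eq_fun do rewrite -EFin_Rintegral//.
(* All these integrals are finite, so convergence of their real values is enough. *)
apply/fine_cvgP; split => //; exact: nearW.
Qed.
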